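(* Let $0\le t<n<\infty$. The reserve at time $t$ with expiry date $n$, $$Y_t=\mathbb{E}\left[\int_t^n e^{-\int_t^s r(y)\,dy}\,dB_s\,\Big|\,\mathcal{F}_t\right],$$ is given by $$Y_t=X_t\left\{f_1(\boldsymbol{\Lambda})(\boldsymbol{a}-\boldsymbol{c})+f_2(\boldsymbol{\Lambda})(\boldsymbol{\Lambda}\cdot\boldsymbol{B})\boldsymbol{e}\right\},$$ where $$f_1(w)=\int_t^n e^{-\int_t^u r(y)\,dy+w(g^{-1}(u)-g^{-1}(t))}\,du,$$ $$f_2(w)=\int_t^n e^{-\int_t^u r(y)\,dy+w(g^{-1}(u)-g^{-1}(t))}\lambda(u)\,du.$$
   Context: **The process.** Let $(Z_t)_{t\ge0}$ be a time-homogeneous Markov jump process on the finite state space $\{1,\dots,p\}$ with intensity matrix $\boldsymbol{\Lambda}=(\lambda_{ij})$ (off-diagonal entries are jump rates, rows sum to zero), so that its transition matrices are $\exp(\boldsymbol{\Lambda}(t-s))$, $s\le t$. Some of the states may be absorbing. Let $g:\mathbb{R}_+\to\mathbb{R}_+$ be an increasing function with $g(0)=0$, whose inverse $g^{-1}$ is defined and differentiable on $\mathbb{R}_+$ (and equal to the integral of its derivative), and put $\lambda(t)=\frac{d}{dt}g^{-1}(t)$. Let $\boldsymbol{e}_k$ be the $k$-th unit basis (row) vector of $\mathbb{R}^p$ and define the time-changed process $X_t=\boldsymbol{e}_{Z_{g^{-1}(t)}}$, i.e. $X_t=(1\{Z_{g^{-1}(t)}=1\},\dots,1\{Z_{g^{-1}(t)}=p\})$.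 Let $(\mathcal{F}_t)_{t\ge0}$ be the natural filtration of $(X_t)$. **Payments.** For $i\ne j$ let $N^{ij}_t=\#\{s\in(0,t]: X_{s-}=\boldsymbol{e}_i,\ X_s=\boldsymbol{e}_j\}$. Let $\boldsymbol{a}=(a_1,\dots,a_p)$ (annuity rates) and $\boldsymbol{c}=(c_1,\dots,c_p)$ (premium rates) be real column vectors and $\boldsymbol{B}=(b_{ij})$ a real $p\times p$ matrix (lump sums paid at transitions) with $b_{ii}=0$ for all $i$. The process of total benefits less premiums is given by $$dB_t=\sum_{i=1}^p1\{X_t=\boldsymbol{e}_i\}(a_i-c_i)\,dt+\sum_{i\ne j}b_{ij}\,dN^{ij}_t .$$ The interest rate $r$ is a deterministic (locally integrable) function of time. **Notation.** $\boldsymbol{e}$ is the $p$-dimensional column vector of ones. For matrices of the same dimension, $\boldsymbol{M}\cdot\boldsymbol{N}$ denotes the component-wise product $(m_{ij}n_{ij})$. For an analytic function $f$ and a square matrix $\boldsymbol{A}$, $f(\boldsymbol{A})=\frac{1}{2\pi i}\oint_\gamma f(w)(w\boldsymbol{I}-\boldsymbol{A})^{-1}dw$, with $\gamma$ a simple path enclosing the eigenvalues of $\boldsymbol{A}$. *)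

(* Defs.v *)
From HB Require Import structures.
From mathcomp Require Import all_boot all_order all_algebra.
From mathcomp Require Import all_classical all_reals all_analysis.
From mathcomp Require Import complex.
Import Order.TTheory GRing.Theory Num.Theory.
Import numFieldNormedType.Exports.

Set Implicit Arguments.
Unset Strict Implicit.
Unset Printing Implicit Defensive.

Local Open Scope classical_set_scope.
Local Open Scope ring_scope.
Local Open Scope complex_scope.

Section ContourIntegral.
Context {R : realType}.
Implicit Types (gamma : R -> R[i]) (F : R[i] -> R[i]).

Definition cexp (z : R[i]) : R[i] :=
  (expR (@complex.Re R z) * cos (@complex.Im R z))
    +i* (expR (@complex.Re R z) * sin (@complex.Im R z)).

Definition cintegral (D : set R) (f : R -> R[i]) : R[i] :=
  (\int[lebesgue_measure]_(s in D) @complex.Re R (f s))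
    +i* (\int[lebesgue_measure]_(s in D) @complex.Im R (f s)).

Definition path_derive gamma (s : R) : R[i] :=
  derive1 (@complex.Re R \o gamma) s +i* derive1 (@complex.Im R \o gamma) s.

(* C^1 on the closed interval [u, v], with one-sided derivatives at the end
   points: the restriction to [u, v] of a C^1 function on the line. *)
Definition C1_on (u v : R) (x : R -> R) :=
  exists y : R -> R, [/\ forall s, derivable y s 1,
    continuous (derive1 y) & {in `[u, v], x =1 y}].

Definition piecewise_C1 gamma :=
  exists2 s : seq R, itv_partition 0 1 s &
    forall k, (k < size s)%N ->
      let u := nth 0 (0 :: s) k in let v := nth 0 s k in
      C1_on u v (@complex.Re R \o gamma) /\ C1_on u v (@complex.Im R \o gamma).

Definition simple_closed_path gamma :=
  [/\ piecewise_C1 gamma, gamma 0 = gamma 1 & {in `[0, 1[ &, injective gamma}].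

Definition contour_integral gamma F : R[i] :=
  cintegral `[0, 1] (fun s => F (gamma s) * path_derive gamma s).

Definition two_pi_i : R[i] := 0 +i* (2 * pi).

Definition winding_number gamma (z : R[i]) : R[i] :=
  two_pi_i^-1 * contour_integral gamma (fun w => (w - z)^-1).

(* The bounded part of the complement of the path (Jordan curve theorem). *)
Definition path_interior gamma : set R[i] :=
  let U := ~` (gamma @` `[0, 1]) in
  [set z | U z /\
     exists M : R, forall w, @connected_component R[i]^o U z w -> `|w| <= M%:C].

Definition positively_oriented gamma :=
  forall z, path_interior gamma z -> winding_number gamma z = 1.

Definition encloses_spectrum gamma p (A : 'M[R[i]]_p) :=
  forall z, eigenvalue A z -> path_interior gamma z.

Definition admissible_path gamma p (A : 'M[R[i]]_p) :=
  [/\ simple_closed_path gamma, positively_oriented gamma &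
      encloses_spectrum gamma A].

(* 1 / (2 i pi) times the integral of f(w) (w I - A)^-1 along gamma, entrywise. *)
Definition mxfun gamma (f : R[i] -> R[i]) p (A : 'M[R[i]]_p) : 'M[R[i]]_p :=
  \matrix_(i, j) (two_pi_i^-1 *
    contour_integral gamma (fun w => f w * invmx (w%:M - A) i j)).

End ContourIntegral.

Section TimeChange.
Context {R : realType}.

(* Derivative of a function considered on [0, +oo[ only; it is one-sided at 0. *)
Definition Rplus_quotient (f : R -> R) (t h : R) : R := h^-1 * (f (t + h) - f t).
Definition Rplus_derivable (f : R -> R) (t : R) : Prop :=
  cvg (Rplus_quotient f t h @[h --> within [set h | 0 <= t + h] 0^']).
Definition Rplus_derive (f : R -> R) (t : R) : R :=
  lim (Rplus_quotient f t h @[h --> within [set h | 0 <= t + h] 0^']).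

(* g and ginv are functions from [0, +oo[ to [0, +oo[; their values at negative
   arguments are irrelevant. *)
Record is_time_change (g ginv : R -> R) : Prop := {
  tc_g_ge0 : forall t, 0 <= t -> 0 <= g t;
  tc_ginv_ge0 : forall t, 0 <= t -> 0 <= ginv t;
  tc_gK : forall t, 0 <= t -> ginv (g t) = t;
  tc_ginvK : forall t, 0 <= t -> g (ginv t) = t;
  tc_g_increasing : forall s t, 0 <= s -> s < t -> g s < g t;
  tc_g0 : g 0 = 0;
  tc_derivable : forall t, 0 <= t -> Rplus_derivable ginv t;
  tc_integral : forall t, 0 <= t ->
    (\int[lebesgue_measure]_(u in `[0%R, t]) (Rplus_derive ginv u)%:E
       = (ginv t)%:E)%E
}.

End TimeChange.

Section Probability.
Context d (T : measurableType d) {R : realType} (P : probability T R).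

(* Y is a version of the conditional expectation E[X | G]. *)
Definition is_condexp (G : set (set T)) (X Y : T -> R) : Prop :=
  [/\ P.-integrable [set: T] (EFin \o X),
      P.-integrable [set: T] (EFin \o Y),
      forall B : set R, measurable B -> G (Y @^-1` B) &
      forall A, G A -> \int[P]_(w in A) X w = \int[P]_(w in A) Y w].

Definition natural_filtration p (X : R -> T -> 'rV[R]_p) (t : R) : set (set T) :=
  <<s [set A | exists u k (B : set R),
        [/\ 0 <= u <= t, measurable B & A = (fun w => X u w 0 k) @^-1` B]] >>.

Definition indicator_process p (Z : R -> T -> 'I_p) (t : R) (w : T) : 'rV[R]_p :=
  delta_mx 0 (Z t w).

End Probability.

Section MarkovJumpProcess.
Context {R : realType}.

Definition is_intensity_matrix p (L : 'M[R]_p) : Prop :=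
  (forall i j, i != j -> 0 <= L i j) /\ (forall i, \sum_j L i j = 0).

Definition expmx p (A : 'M[R]_p) : 'M[R]_p :=
  \matrix_(i, j) limn (series (fun k : nat => (k`!%:R)^-1 * (A ^+ k) i j)).

(* In the finite discrete state space, right continuity and existence of left
   limits mean that the path is locally constant on either side of each time. *)
Definition jump_path p (z : R -> 'I_p) : Prop :=
  (forall t, 0 <= t -> \forall u \near t^'+, z u = z t) /\
  (forall t, 0 < t -> exists k, \forall u \near t^'-, z u = k).

Definition is_markov_jump_process d (T : measurableType d)
    (P : probability T R) p (L : 'M[R]_p) (Z : R -> T -> 'I_p) : Prop :=
  [/\ forall t k, 0 <= t -> measurable [set w | Z t w = k],
      forall w, jump_path (Z ^~ w) &
      forall s t j, 0 <= s <= t ->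
        is_condexp P (natural_filtration (indicator_process (R := R) Z) s)
          (fun w => (Z t w == j)%:R)
          (fun w => expmx ((t - s) *: L) (Z s w) j)].

End MarkovJumpProcess.

Section Payments.
Context {R : realType}.

Definition jump_times p (x : R -> 'rV[R]_p) (i j : 'I_p) : set R :=
  [set s : R | 0 < s /\ x u @[u --> s^'-] --> (delta_mx 0 i : 'rV[R]_p) /\ x s = delta_mx 0 j].

Definition jump_count p (x : R -> 'rV[R]_p) (i j : 'I_p) (t : R) : R :=
  fine (counting (jump_times x i j `&` `]0, t])).

(* Lebesgue-Stieltjes integral of h against dF over D, where F is a nondecreasing
   right-continuous function (and 0 when it is not). *)
Definition stieltjes_integral (F : R -> R) (D : set R) (h : R -> R) : R :=
  if pselect (exists G : cumulative R R, (G : R -> R) = F) is left e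
  then \int[lebesgue_stieltjes_measure (sval (cid e))]_(s in D) h s
  else 0.

Definition discount (r : R -> R) (t s : R) : R :=
  expR (- \int[lebesgue_measure]_(y in `[t, s]) r y).

(* The integral over ]t, n] of discount r t against dB, for a path x of the
   state process. *)
Definition discounted_payments p (a c : 'cV[R]_p) (B : 'M[R]_p) (r : R -> R)
    (t n : R) (x : R -> 'rV[R]_p) : R :=
  \int[lebesgue_measure]_(s in `]t, n])
     (discount r t s *
      \sum_i (x s == delta_mx 0 i)%:R * (a i 0 - c i 0)) +
  \sum_i \sum_(j | j != i)
     B i j * stieltjes_integral (jump_count x i j) `]t, n] (discount r t).

Definition f1 (r ginv : R -> R) (t n : R) (w : R[i]) : R[i] :=
  cintegral `[t, n] (fun u =>
    (discount r t u)%:C * cexp (w * (ginv u - ginv t)%:C)).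

Definition f2 (r ginv : R -> R) (t n : R) (w : R[i]) : R[i] :=
  cintegral `[t, n] (fun u =>
    (discount r t u)%:C * cexp (w * (ginv u - ginv t)%:C)
      * (Rplus_derive ginv u)%:C).

End Payments.

Definition mxC {R : realType} m n (A : 'M[R]_(m, n)) : 'M[R[i]]_(m, n) :=
  map_mx (real_complex R) A.

(* Main.v *)
(* On a path, the sum of the lump sums discounted at the jump times is the limit
   of the sums of D(a) b(X_a, X_b) over the cells ]a, b] of refining grids.  By
   the Markov property and exp(hL) = I + hL + O(h^2), the expectations of the
   latter on an event A of F_t are Riemann-Stieltjes sums of the integrals of
   D(u) P(A, X_u = i) L_ij lambda(u) du; Fatou's lemma for the number of jumps
   provides the domination.  With Fubini's theorem for the annuities, the expected
   payments on A are the sum over m of v(m) P(A, X_t = m), where v(m) is expressed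
   with the entries of exp((g^-1(u) - g^-1(t)) L), so v(X_t) is the reserve.

   The functional calculus needs no general Cauchy theorem.  The integral of
   (w - z)^-1 along the path is known for each eigenvalue z, that of a function
   with a primitive is 0, and partial fractions give those of the products of
   the (w - z)^-1.  Expanding the resolvent along the characteristic polynomial
   turns w^k into A^k, and the Taylor sums of exp, which converge uniformly on the
   path, turn w |-> exp(xw) into exp(xA). *)
Require Import Defs.
From HB Require Import structures.
From mathcomp Require Import all_boot all_order all_algebra.
From mathcomp Require Import finmap.
From mathcomp Require Import all_classical all_reals all_analysis.
From mathcomp Require Import measurable_realfun complex ring lra.
Import Order.TTheory GRing.Theory Num.Theory.
Import numFieldNormedType.Exports.
Local Open Scope classical_set_scope.
Local Open Scope ring_scope.
Local Open Scope complex_scope.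

Set Implicit Arguments.
Unset Strict Implicit.
Unset Printing Implicit Defensive.

(** The functional calculus rests on the value 1 of the winding number at the enclosed eigenvalues,
    so every contour integral is brought either to a primitive along the path or to (w - z)^-1 with
    z an eigenvalue. Roots of the characteristic polynomial are taken with multiplicity and no
    diagonalisation occurs, hence repeated eigenvalues are no exception.

    The rate lambda is only known to be integrable. Sums over grids are therefore not compared with
    Riemann sums in u but with increments of g^-1: their squares add up to at most the largest
    increment times g^-1(n) - g^-1(t), which vanishes under refinement by uniform continuity of
    g^-1.

    Several notions are total functions with default values: the limit of a series, the Stieltjes
    integral, the left limit of a path. Existence is proved before each of them is computed. The
    derivative of the path at its knots is left unspecified, since finitely many points do not
    affect the integrals. *)

Section RealIntegrable.
Context d (T : measurableType d) {R : realType} (mu : {measure set T -> \bar R}).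
Implicit Types (D : set T) (f h : T -> R).

Lemma eq_Rintegrable D f h : measurable D -> (forall x, D x -> f x = h x) ->
  mu.-integrable D (EFin \o f) -> mu.-integrable D (EFin \o h).
Proof.
by move=> mD fh; apply: eq_integrable => // x /set_mem Dx /=; rewrite fh.
Qed.

Lemma RintegrableD D f h : measurable D -> mu.-integrable D (EFin \o f) ->
  mu.-integrable D (EFin \o h) -> mu.-integrable D (EFin \o (fun x => f x + h x)).
Proof. by move=> mD fi hi; exact: (eq_integrable mD _ _ _ (integrableD mD fi hi)). Qed.

Lemma RintegrableB D f h : measurable D -> mu.-integrable D (EFin \o f) ->
  mu.-integrable D (EFin \o h) -> mu.-integrable D (EFin \o (fun x => f x - h x)).
Proof. by move=> mD fi hi; exact: (eq_integrable mD _ _ _ (integrableB mD fi hi)). Qed.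

Lemma RintegrableZ D (a : R) f : measurable D -> mu.-integrable D (EFin \o f) ->
  mu.-integrable D (EFin \o (fun x => a * f x)).
Proof. by move=> mD fi; exact: (eq_integrable mD _ _ _ (integrableZl mD a fi)). Qed.

Lemma integrable_mul_bounded D f h (M : R) : measurable D ->
  measurable_fun D f -> (forall s, D s -> `|f s| <= M) ->
  mu.-integrable D (EFin \o h) -> mu.-integrable D (EFin \o (fun s => f s * h s)).
Proof.
move=> mD mf fM hi.
have mh : measurable_fun D h by move/integrableP: hi => [/measurable_EFinP].
apply: (le_integrable mD _ _ (RintegrableZ M mD (integrable_norm hi))).
  by apply/measurable_EFinP; apply: measurable_funM.
move=> s Ds /=; rewrite lee_fin normrM [leRHS]ger0_norm; last first.
  by rewrite mulr_ge0// (le_trans _ (fM _ Ds)).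
by rewrite ler_wpM2r// fM.
Qed.

End RealIntegrable.
Arguments eq_Rintegrable {d} T {R mu D f h}.
Arguments RintegrableD {d} T {R mu D f h}.
Arguments RintegrableB {d} T {R mu D f h}.
Arguments RintegrableZ {d} T {R mu D} a {f}.
Arguments integrable_mul_bounded {d} T {R mu D f h} M.

(** * Complex-valued integrals and derivatives *)

Section ComplexIntegral.
Context {R : realType}.
Notation mu := (@lebesgue_measure R).
Local Notation mT := (measurableTypeR R).
Notation Re := (@complex.Re R).
Notation Im := (@complex.Im R).
Implicit Types (f h : R -> R[i]) (D : set mT).

Lemma cReD (x y : R[i]) : Re (x + y) = Re x + Re y. Proof. by case: x y => ? ? []. Qed.
Lemma cImD (x y : R[i]) : Im (x + y) = Im x + Im y. Proof. by case: x y => ? ? []. Qed.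
Lemma cReM (x y : R[i]) : Re (x * y) = Re x * Re y - Im x * Im y.
Proof. by case: x y => ? ? []. Qed.
Lemma cImM (x y : R[i]) : Im (x * y) = Re x * Im y + Im x * Re y.
Proof. by case: x y => ? ? []. Qed.
Lemma cReV (x : R[i]) : Re x^-1 = Re x / (Re x ^+ 2 + Im x ^+ 2).
Proof. by case: x. Qed.
Lemma cImV (x : R[i]) : Im x^-1 = - (Im x / (Re x ^+ 2 + Im x ^+ 2)).
Proof. by case: x. Qed.
Lemma eqReIm (x y : R[i]) : Re x = Re y -> Im x = Im y -> x = y.
Proof. by case: x y => ? ? [] ? ? /= -> ->. Qed.
Lemma ReIm_gt0 (x : R[i]) : x != 0 -> 0 < Re x ^+ 2 + Im x ^+ 2.
Proof.
case: x => x y; rewrite eq_complex /= negb_and => /orP[] x0.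
  by rewrite ltr_pwDl ?sqr_ge0// exprn_even_gt0.
by rewrite ltr_wpDl ?sqr_ge0// exprn_even_gt0.
Qed.

Definition cintegrable D f :=
  mu.-integrable D (EFin \o (Re \o f)) /\ mu.-integrable D (EFin \o (Im \o f)).

Lemma cintegrableD D f h : measurable D -> cintegrable D f -> cintegrable D h ->
  cintegrable D (fun s => f s + h s).
Proof.
move=> mD [f1 f2] [h1 h2]; split.
  by apply: (eq_Rintegrable mT mD _ (RintegrableD mT mD f1 h1)) => x _; rewrite /= cReD.
by apply: (eq_Rintegrable mT mD _ (RintegrableD mT mD f2 h2)) => x _; rewrite /= cImD.
Qed.

Lemma cintegralD D f h : measurable D -> cintegrable D f -> cintegrable D h ->
  cintegral D (fun s => f s + h s) = cintegral D f + cintegral D h.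
Proof.
move=> mD [f1 f2] [h1 h2]; apply: eqReIm; rewrite ?cReD ?cImD.
  rewrite -[RHS](@RintegralD _ mT _ _ _ _ _ mD f1 h1); apply: eq_Rintegral => s _.
  by rewrite cReD.
rewrite -[RHS](@RintegralD _ mT _ _ _ _ _ mD f2 h2); apply: eq_Rintegral => s _.
by rewrite cImD.
Qed.

Lemma cintegrableZ D (a : R[i]) f : measurable D -> cintegrable D f ->
  cintegrable D (fun s => a * f s).
Proof.
move=> mD [f1 f2]; split.
  apply: (eq_Rintegrable mT mD _ (RintegrableB mT mD (RintegrableZ mT (Re a) mD f1)
    (RintegrableZ mT (Im a) mD f2))) => x _; by rewrite /= cReM.
apply: (eq_Rintegrable mT mD _ (RintegrableD mT mD (RintegrableZ mT (Re a) mD f2)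
    (RintegrableZ mT (Im a) mD f1))) => x _; by rewrite /= cImM.
Qed.

Lemma cintegralZ D (a : R[i]) f : measurable D -> cintegrable D f ->
  cintegral D (fun s => a * f s) = a * cintegral D f.
Proof.
move=> mD [f1 f2]; apply: eqReIm; rewrite ?cReM ?cImM.
  rewrite -!RintegralZl// -RintegralB//; try exact: (RintegrableZ mT).
  by apply: eq_Rintegral => s _; rewrite cReM.
rewrite -!RintegralZl// -RintegralD//; try exact: (RintegrableZ mT).
by apply: eq_Rintegral => s _; rewrite cImM.
Qed.

Lemma cintegral0 D : cintegral D (fun _ : R => 0 : R[i]) = 0.
Proof. by apply: eqReIm => /=; rewrite /Rintegral integral0. Qed.

Lemma cintegrable0 D : cintegrable D (fun _ : R => 0 : R[i]).
Proof. by split; exact: (@integrable0 _ mT). Qed.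

Lemma eq_cintegral D f h : {in D, f =1 h} -> cintegral D f = cintegral D h.
Proof.
by move=> fh; apply: eqReIm; apply: eq_Rintegral => x xD /=; rewrite fh.
Qed.

Lemma eq_cintegrable D f h : measurable D -> {in D, f =1 h} -> cintegrable D f -> cintegrable D h.
Proof.
move=> mD fh [f1 f2]; split.
  by apply: eq_integrable f1 => // x xD /=; rewrite fh.
by apply: eq_integrable f2 => // x xD /=; rewrite fh.
Qed.

Lemma cintegrable_sum (I : Type) (r : seq I) D (F : I -> R -> R[i]) : measurable D ->
  (forall i, cintegrable D (F i)) -> cintegrable D (fun s => \sum_(i <- r) F i s).
Proof.
move=> mD Fi; elim: r => [|i r IH].
  apply: eq_cintegrable (@cintegrable0 D) => // x _; by rewrite big_nil.
by apply: eq_cintegrable (cintegrableD mD (Fi i) IH) => // x _; rewrite big_cons.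
Qed.

Lemma cintegral_sum (I : Type) (r : seq I) D (F : I -> R -> R[i]) : measurable D ->
  (forall i, cintegrable D (F i)) ->
  cintegral D (fun s => \sum_(i <- r) F i s) = \sum_(i <- r) cintegral D (F i).
Proof.
move=> mD Fi; elim: r => [|i r IH].
  by rewrite big_nil -[RHS](cintegral0 D); apply: eq_cintegral => x _; rewrite big_nil.
rewrite big_cons -IH -cintegralD//; last exact: cintegrable_sum.
by apply: eq_cintegral => x _; rewrite big_cons.
Qed.

Definition cbounded D f :=
  [/\ measurable_fun D (Re \o f), measurable_fun D (Im \o f) &
  exists M : R, forall s, D s -> `|Re (f s)| <= M /\ `|Im (f s)| <= M].

Lemma cintegrableM D f h : measurable D -> cbounded D f -> cintegrable D h ->
  cintegrable D (fun s => f s * h s).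
Proof.
move=> mD [m1 m2 [M fM]] [h1 h2]; split.
- apply: (eq_Rintegrable mT (f := fun s => Re (f s) * Re (h s) - Im (f s) * Im (h s)) mD).
    by move=> x _ /=; rewrite cReM.
  by apply: (RintegrableB mT) => //; apply: (integrable_mul_bounded mT M) => // s /fM[].
- apply: (eq_Rintegrable mT (f := fun s => Re (f s) * Im (h s) + Im (f s) * Re (h s)) mD).
    by move=> x _ /=; rewrite cImM.
  by apply: (RintegrableD mT) => //; apply: (integrable_mul_bounded mT M) => // s /fM[].
Qed.

Definition ccont D f := {within D, continuous (Re \o f)} /\ {within D, continuous (Im \o f)}.

End ComplexIntegral.

(** * Continuity and differentiation of complex curves *)

Section ContinuityOnSets.
Context {R : realType}.
Notation mu := (@lebesgue_measure R).
Local Notation mT := (measurableTypeR R).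
Notation Re := (@complex.Re R).
Notation Im := (@complex.Im R).
Implicit Types (f h : R -> R[i]) (D : set mT).

Lemma ccont_cst D (c : R[i]) : ccont D (fun=> c).
Proof. by split => x; exact: cvg_cst. Qed.

Lemma ccontD D f h : ccont D f -> ccont D h -> ccont D (fun s => f s + h s).
Proof.
move=> [f1 f2] [h1 h2]; split.
  rewrite (_ : _ \o _ = (Re \o f) \+ (Re \o h)); last by apply/funext => x /=; rewrite cReD.
  by move=> x; apply: cvgD; [exact: f1|exact: h1].
rewrite (_ : _ \o _ = (Im \o f) \+ (Im \o h)); last by apply/funext => x /=; rewrite cImD.
by move=> x; apply: cvgD; [exact: f2|exact: h2].
Qed.

Lemma ccontM D f h : ccont D f -> ccont D h -> ccont D (fun s => f s * h s).
Proof.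
move=> [f1 f2] [h1 h2]; split.
  rewrite (_ : _ \o _ = (Re \o f) \* (Re \o h) \- (Im \o f) \* (Im \o h)); last first.
    by apply/funext => x /=; rewrite cReM.
  by move=> x; apply: cvgB; apply: cvgM; by [exact: f1|exact: f2|exact: h1|exact: h2].
rewrite (_ : _ \o _ = (Re \o f) \* (Im \o h) \+ (Im \o f) \* (Re \o h)); last first.
  by apply/funext => x /=; rewrite cImM.
by move=> x; apply: cvgD; apply: cvgM; by [exact: f1|exact: f2|exact: h1|exact: h2].
Qed.

Lemma ccontX D f k : ccont D f -> ccont D (fun s => f s ^+ k).
Proof.
move=> cf; elim: k => [|k IH]; first exact: ccont_cst.
rewrite (_ : (fun s => _) = (fun s => f s * f s ^+ k)); first exact: ccontM.
by apply/funext => s; rewrite exprS.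
Qed.

Lemma ccontV D f : (forall s, D s -> f s != 0) -> ccont D f -> ccont D (fun s => (f s)^-1).
Proof.
move=> f0 [f1 f2].
have cden : {within D, continuous (fun s => (Re (f s) ^+ 2 + Im (f s) ^+ 2)^-1)}.
  apply/subspace_continuousP => x Dx; apply: cvgV.
    by rewrite gt_eqF// ReIm_gt0// f0.
  move/subspace_continuousP: f1 => /(_ _ Dx) f1.
  move/subspace_continuousP: f2 => /(_ _ Dx) f2.
  by apply: cvgD; [exact: (cvgM f1 f1)|exact: (cvgM f2 f2)].
split.
  rewrite (_ : _ \o _ = (Re \o f) \* (fun s => (Re (f s) ^+ 2 + Im (f s) ^+ 2)^-1)); last first.
    by apply/funext => x /=; rewrite cReV.
  by move=> x; apply: cvgM; [exact: f1|exact: cden].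
rewrite (_ : _ \o _ = (fun x => - ((Im \o f) \* (fun s => (Re (f s) ^+ 2 + Im (f s) ^+ 2)^-1)) x)); last first.
  by apply/funext => x /=; rewrite cImV.
by move=> x; apply: cvgN; apply: cvgM; [exact: f2|exact: cden].
Qed.

Lemma ccont_prod (I : Type) (r : seq I) D (F : I -> R -> R[i]) :
  (forall i, ccont D (F i)) -> ccont D (fun s => \prod_(i <- r) F i s).
Proof.
move=> cF; elim: r => [|i r IH].
  rewrite (_ : (fun s => _) = (fun=> 1)); first exact: ccont_cst.
  by apply/funext => s; rewrite big_nil.
rewrite (_ : (fun s => _) = (fun s => F i s * \prod_(j <- r) F j s)); first exact: ccontM.
by apply/funext => s; rewrite big_cons.
Qed.

Lemma ccont_subset D D' f : D' `<=` D -> ccont D f -> ccont D' f.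
Proof. by move=> DD [f1 f2]; split; [exact: continuous_subspaceW f1|exact: continuous_subspaceW f2]. Qed.

Lemma ccont_itv_bounded (u v : R) f : ccont `[u, v] f -> cbounded `[u, v] f.
Proof.
move=> [f1 f2]; split; try exact: subspace_continuous_measurable_fun.
have /compact_bounded[M1 [_ H1]] := continuous_compact f1 (@segment_compact R u v).
have /compact_bounded[M2 [_ H2]] := continuous_compact f2 (@segment_compact R u v).
exists (Num.max M1 M2 + 1) => s Ds; split.
  by apply: H1; [rewrite ltr_pwDr// le_max lexx|exists s].
by apply: H2; [rewrite ltr_pwDr// le_max lexx orbT|exists s].
Qed.

Lemma ccont_itv_integrable (u v : R) f : ccont `[u, v] f -> cintegrable `[u, v] f.
Proof.
move=> [f1 f2]; split; apply: continuous_compact_integrable => //; exact: segment_compact.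
Qed.

(** Derivative in the real parameter, taken componentwise. Primitives are only differentiated along
    the path, so complex differentiability never enters. *)
Definition is_cderive (s : R) f (df : R[i]) :=
  is_derive s 1 (Re \o f : R -> R) (Re df) /\ is_derive s 1 (Im \o f : R -> R) (Im df).

Lemma is_cderive_cst (s : R) (c : R[i]) : is_cderive s (fun=> c) 0.
Proof. by split; exact: is_derive_cst. Qed.

Lemma is_cderiveM (s : R) f h df dh : is_cderive s f df -> is_cderive s h dh ->
  is_cderive s (fun s => f s * h s) (df * h s + f s * dh).
Proof.
move=> [f1 f2] [h1 h2]; split.
  rewrite (_ : _ \o _ = (Re \o f) * (Re \o h) - (Im \o f) * (Im \o h)); last first.
    by apply/funext => x /=; rewrite cReM.
  by apply: is_derive_eq; rewrite cReD !cReM /= /GRing.scale/=; ring.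
rewrite (_ : _ \o _ = (Re \o f) * (Im \o h) + (Im \o f) * (Re \o h)); last first.
  by apply/funext => x /=; rewrite cImM.
by apply: is_derive_eq; rewrite cImD !cImM /= /GRing.scale/=; ring.
Qed.

Lemma is_cderiveD (s : R) f h df dh : is_cderive s f df -> is_cderive s h dh ->
  is_cderive s (fun s => f s + h s) (df + dh).
Proof.
move=> [f1 f2] [h1 h2]; split.
  rewrite (_ : _ \o _ = (Re \o f) + (Re \o h)); last by apply/funext => x /=; rewrite cReD.
  by rewrite cReD; exact: is_deriveD.
rewrite (_ : _ \o _ = (Im \o f) + (Im \o h)); last by apply/funext => x /=; rewrite cImD.
by rewrite cImD; exact: is_deriveD.
Qed.

Lemma is_cderiveX (s : R) f df k : is_cderive s f df ->
  is_cderive s (fun s => f s ^+ k.+1) (k.+1%:R * f s ^+ k * df).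
Proof.
move=> Df; elim: k => [|k IH].
  rewrite (_ : (fun s => _) = f) ?expr0 ?mulr1 ?mul1r//.
have := is_cderiveM Df IH.
rewrite (_ : (fun s => _) = (fun s => f s ^+ k.+2)); last by apply/funext => x; rewrite [RHS]exprS.
by congr is_cderive; rewrite [k.+2%:R](mulrSr 1) exprS; ring.
Qed.

Lemma is_cderiveV (s : R) f df : f s != 0 -> is_cderive s f df ->
  is_cderive s (fun s => (f s)^-1) (- df / f s ^+ 2).
Proof.
move=> fs0 [f1 f2].
have n0 := ReIm_gt0 fs0; have n0' := lt0r_neq0 n0.
pose N := (Re \o f) ^+ 2 + (Im \o f) ^+ 2.
have Ns0 : N s != 0 by [].
have DN : is_derive s 1 (N : R -> R) (2 * Re (f s) * Re df + 2 * Im (f s) * Im df).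
  by apply: is_derive_eq; rewrite /= /GRing.scale/= !expr1; ring.
have DV := is_deriveV Ns0 DN.
split.
  rewrite (_ : _ \o _ = (Re \o f) * (fun s => (N s)^-1)); last first.
    by apply/funext => x /=; rewrite cReV.
  apply: (is_derive_eq (is_deriveM f1 DV)).
  rewrite expr2 !(cReM,cReV,cImV,cImM) /= /GRing.scale/= (_ : N s = Re (f s) ^+ 2 + Im (f s) ^+ 2)//.
  move: n0'; case: (f s) => x y /= n0'.
  by case: df {f1 f2 DN DV} => dx dy /=; field; rewrite n0' andbT (_ : _ + _ = (x ^+ 2 + y ^+ 2) ^+ 2) ?expf_neq0//; ring.
rewrite (_ : _ \o _ = - ((Im \o f) * (fun s => (N s)^-1))); last first.
  by apply/funext => x /=; rewrite cImV.
apply: (is_derive_eq (is_deriveN (is_deriveM f2 DV))).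
rewrite expr2 !(cReM,cReV,cImV,cImM) /= /GRing.scale/= (_ : N s = Re (f s) ^+ 2 + Im (f s) ^+ 2)//.
move: n0'; case: (f s) => x y /= n0'.
by case: df {f1 f2 DN DV} => dx dy /=; field; rewrite n0' andbT (_ : _ + _ = (x ^+ 2 + y ^+ 2) ^+ 2) ?expf_neq0//; ring.
Qed.

End ContinuityOnSets.

Section IntegrableSetU.
Context d (T : measurableType d) {R : realType} (mu : {measure set T -> \bar R}).

Lemma integrable_setU (A B : set T) (f : T -> \bar R) : measurable A -> measurable B ->
  mu.-integrable A f -> mu.-integrable B f -> mu.-integrable (A `|` B) f.
Proof.
move=> mA mB fA fB; have [mfA _] := integrableP _ _ _ fA; have [mfB _] := integrableP _ _ _ fB.
have mAB := measurableU _ _ mA mB.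
apply/integrableP; split; first exact/measurable_funU.
have -> : A `|` B = A `|` (B `\` A) by rewrite setUDr// setDv setD0.
have mBA := measurableD mB mA.
rewrite ge0_integral_setU//=; last 2 first.
- by rewrite setUDr setDv setD0; apply/measurableT_comp => //; exact/measurable_funU.
- by rewrite disj_set2E; apply/eqP; rewrite setDE setICA setICr setI0.
apply: lte_add_pinfty; first by have /integrableP[] := fA.
have /integrableP[_] := integrableS mB mBA (@subDsetl _ _ _) fB; exact.
Qed.

End IntegrableSetU.
Arguments integrable_setU {d} T {R mu A B f}.

(** * Contour integrals *)

Section PiecewiseC1.
Context {R : realType}.
Notation mu := (@lebesgue_measure R).
Local Notation mT := (measurableTypeR R).
Notation Re := (@complex.Re R).
Notation Im := (@complex.Im R).
Implicit Types (gamma : R -> R[i]) (h phi : R -> R[i]) (u v : R).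

(** [eta] is the derivative extended continuously to the closed piece. At a knot of the path the
    two-sided derivative may not exist, so [eta] is tied to it on the open interval only. *)
Definition smooth_piece gamma u v := exists eta : R -> R[i],
  [/\ ccont `[u, v] gamma, ccont `[u, v] eta &
      forall s, s \in `]u, v[ -> is_cderive s gamma (eta s)].

Lemma C1_on_smooth_piece gamma u v :
  C1_on u v (Re \o gamma) -> C1_on u v (Im \o gamma) -> smooth_piece gamma u v.
Proof.
move=> [x [dx cx ex]] [y [dy cy ey]].
have aux (f g : R -> R) : (forall s, derivable g s 1) -> {in `[u, v], f =1 g} ->
    {within `[u, v], continuous f} /\
    (forall s, s \in `]u, v[ -> is_derive s 1 f (derive1 g s)).
  move=> dg fg; split.
    apply: (@subspace_eq_continuous _ `[u, v] _ g).
      by move=> s; rewrite inE => sD; exact/esym/fg.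
    by apply: derivable_within_continuous => s _; exact: dg.
  move=> s suv; apply: (@near_eq_is_derive _ _ _ g).
    near=> z; rewrite fg//; apply: subset_itv_oo_cc; near: z; exact: near_in_itvoo.
  by rewrite derive1E; exact/derivableP.
exists (fun s => derive1 x s +i* derive1 y s).
have [cgx dgx] := aux _ _ dx ex; have [cgy dgy] := aux _ _ dy ey.
split; last by move=> s suv; split; [exact: dgx|exact: dgy].
  by split; [exact: cgx|exact: cgy].
by split; [exact: continuous_subspaceT cx|exact: continuous_subspaceT cy].
Unshelve. all: by end_near.
Qed.

Lemma smooth_piece_path_derive gamma u v eta :
  (forall s, s \in `]u, v[ -> is_cderive s gamma (eta s)) ->
  forall s, s \in `]u, v[ -> path_derive gamma s = eta s.
Proof.
move=> D s /D[[_ d1] [_ d2]]; rewrite /path_derive !derive1E d1 d2.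
by case: (eta s).
Qed.

(** The two end points form a null set, so unspecified values of [f] there harm neither
    measurability nor the integral. *)
Lemma eq_itvoo_integral u v (f g : R -> R) : (forall s, s \in `]u, v[ -> f s = g s) ->
  mu.-integrable `[u, v] (EFin \o g) -> 
  mu.-integrable `[u, v] (EFin \o f) /\
  \int[mu]_(s in `[u, v]) f s = \int[mu]_(s in `[u, v]) g s.
Proof.
move=> fg gi.
have mg : measurable_fun `[u, v] g by move/integrableP: gi => [/measurable_EFinP].
have mg' : measurable_fun `]u, v[ g.
  by apply: measurable_funS mg => //; exact: subset_itv_oo_cc.
have mf' : measurable_fun `]u, v[ f.
  by apply: eq_measurable_fun mg' => s; rewrite inE => /fg ->.
have mf : measurable_fun `[u, v] f := measurable_fun_itv_cc mf'.
(* Used with [id] for the integral itself and with [Num.norm] for integrability. *)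
have e (k : R -> R) : measurable_fun setT k ->
    (\int[mu]_(s in `[u, v]) (k (f s))%:E = \int[mu]_(s in `[u, v]) (k (g s))%:E)%E.
  move=> mk; rewrite [LHS]integral_itv_bndoo; last exact/measurable_EFinP/measurableT_comp.
  rewrite [RHS]integral_itv_bndoo; last exact/measurable_EFinP/measurableT_comp.
  by apply: eq_integral => s; rewrite inE => /fg ->.
split; last by rewrite /Rintegral (e id).
apply/integrableP; split; first exact/measurable_EFinP.
by move/integrableP: gi => [_]; rewrite /= (e Num.norm).
Qed.

Lemma eq_itvoo_cintegral u v h phi : (forall s, s \in `]u, v[ -> h s = phi s) ->
  cintegrable `[u, v] phi ->
  cintegrable `[u, v] h /\ cintegral `[u, v] h = cintegral `[u, v] phi.
Proof.
move=> e [i1 i2].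
have [j1 e1] := eq_itvoo_integral (fun s suv => congr1 Re (e s suv)) i1.
have [j2 e2] := eq_itvoo_integral (fun s suv => congr1 Im (e s suv)) i2.
by split => //; apply: eqReIm.
Qed.

Lemma cintegral_FTC u v h dh : u < v -> ccont `[u, v] h -> ccont `[u, v] dh ->
  (forall s, s \in `]u, v[ -> is_cderive s h (dh s)) ->
  cintegral `[u, v] dh = h v - h u.
Proof.
move=> uv [h1 h2] [d1 d2] D.
have aux (f g : R -> R) : {within `[u, v], continuous f} ->
   {within `[u, v], continuous g} ->
   (forall s, s \in `]u, v[ -> is_derive s 1 f (g s)) ->
   \int[mu]_(s in `[u, v]) g s = f v - f u.
  move=> cf cg fg; rewrite /Rintegral (@continuous_FTC2 _ g f)//.
    have /continuous_within_itvP[//|_ fu fv] := cf.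
    by split => // s /fg[].
  by move=> s /fg[_]; rewrite derive1E.
have e1 := aux _ _ h1 d1 (fun s suv => (D s suv).1).
have e2 := aux _ _ h2 d2 (fun s suv => (D s suv).2).
by apply: eqReIm; rewrite ?(cReD,cImD) [LHS](e1,e2) /=; case: (h u).
Qed.

Lemma itv_partition_glue (Q : R -> R -> Prop) a b (s : seq R) :
  (forall u, Q u u) ->
  (forall u v w, u <= v -> v <= w -> Q u v -> Q v w -> Q u w) ->
  itv_partition a b s ->
  (forall k, (k < size s)%N ->
    let u := nth 0 (a :: s) k in let v := nth 0 s k in u < v -> Q u v) ->
  Q a b.
Proof.
move=> Q0 QD; elim: s a => [a /itv_partition_nil ->//|x s IH a pas H].
have := itv_partition_cons pas => pxs.
have ax : a < x by case: pas => /= /andP[].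
apply: (QD _ x); [exact: ltW|exact: itv_partition_le pxs|exact: (H 0)|].
by apply: IH => // k ks; exact: (H k.+1).
Qed.

End PiecewiseC1.

(** * Primitives along a path and partial fractions *)

Section ContourIntegrals.
Context {R : realType}.
Notation mu := (@lebesgue_measure R).
Local Notation mT := (measurableTypeR R).
Notation Re := (@complex.Re R).
Notation Im := (@complex.Im R).
Variable gamma : R -> R[i].
Hypothesis gammaC1 : piecewise_C1 gamma.
Implicit Types (F G : R[i] -> R[i]).

(** Induction along the pieces of the path. Continuity of the path, integrability of its derivative
    and the fundamental theorem of calculus are all additive over adjacent intervals, hence
    instances. *)
Lemma piecewise_C1_ind (Q : R -> R -> Prop) :
  (forall u, Q u u) ->
  (forall u v w, u <= v -> v <= w -> Q u v -> Q v w -> Q u w) ->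
  (forall u v, u < v -> smooth_piece gamma u v -> Q u v) -> Q 0 1.
Proof.
move=> Q0 QD Qp; have [s ps H] := gammaC1.
apply: itv_partition_glue ps _ => // k ks u v uv; apply: Qp => //.
by have [? ?] := H k ks; exact: C1_on_smooth_piece.
Qed.

Lemma itvcc_setU (u v w : R) : u <= v -> v <= w -> `[u, w]%classic = `[u, v] `|` `[v, w].
Proof.
move=> uv vw; apply/seteqP; split=> x /=; rewrite !in_itv/=.
  by move=> /andP[ux xw]; case: (leP x v) => xv; [left|right]; rewrite ?ux ?xv ?xw ?(ltW xv).
by move=> [] /andP[a b]; rewrite ?a ?b ?andbT /=; [exact: le_trans vw|exact: le_trans uv a].
Qed.

Lemma piecewise_C1_ccont : ccont `[0, 1] gamma.
Proof.
apply: (piecewise_C1_ind (Q := fun u v => ccont `[u, v] gamma)).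
- by move=> u; rewrite set_itv1; split; exact: continuous_subspace1.
- move=> u v w uv vw [a b] [c d]; rewrite (itvcc_setU uv vw).
  by split; apply: withinU_continuous => //; exact: itv_closed.
- by move=> u v uv [eta []].
Qed.

Lemma path_derive_integrable : cintegrable `[0, 1] (path_derive gamma).
Proof.
apply: (piecewise_C1_ind (Q := fun u v => cintegrable `[u, v] (path_derive gamma))).
- by move=> u; apply: ccont_itv_integrable; rewrite set_itv1; split; exact: continuous_subspace1.
- move=> u v w uv vw [a b] [c d]; rewrite (itvcc_setU uv vw).
  by split; apply: (integrable_setU mT).
- move=> u v uv [eta [_ ceta Deta]].
  by have [] := eq_itvoo_cintegral (smooth_piece_path_derive Deta) (ccont_itv_integrable ceta).
Qed.

Lemma contour_integrable (phi : R -> R[i]) : ccont `[0, 1] phi ->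
  cintegrable `[0, 1] (fun s => phi s * path_derive gamma s).
Proof.
move=> cphi; apply: cintegrableM => //; last exact: path_derive_integrable.
exact: ccont_itv_bounded.
Qed.

Lemma cintegral_itvU (f : R -> R[i]) (u v w : R) : u <= v -> v <= w ->
  cintegrable `[u, w] f ->
  cintegral `[u, w] f = cintegral `[u, v] f + cintegral `[v, w] f.
Proof.
move=> uv vw [f1 f2].
have aux (g : R -> R) : mu.-integrable `[u, w] (EFin \o g) ->
  \int[mu]_(x in `[u, w]) g x = \int[mu]_(x in `[u, v]) g x + \int[mu]_(x in `[v, w]) g x.
  move=> gi; have gi' : mu.-integrable `]v, w] (EFin \o g).
    by apply: (@integrableS _ mT) gi => //; apply: subset_itvr; rewrite bnd_simp.
  by rewrite -(Rintegral_itv_obnd_cbnd gi') -(Rintegral_itvB gi)// ?bnd_simp// addrC subrK.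
by apply: eqReIm; rewrite ?cReD ?cImD; exact: aux.
Qed.

(** The last hypothesis is the chain rule for a primitive composed with the path, asked only where
    the path is differentiable. Continuity of [h] lets the boundary terms at the knots cancel. *)
Lemma contour_FTC (h phi : R -> R[i]) :
  ccont `[0, 1] h -> ccont `[0, 1] phi ->
  (forall s deta, s \in `]0, 1[ -> is_cderive s gamma deta -> is_cderive s h (phi s * deta)) ->
  cintegral `[0, 1] (fun s => phi s * path_derive gamma s) = h 1 - h 0.
Proof.
move=> ch cphi D.
(* The bounds belong to [Q] because [h] and [phi] are controlled on [0, 1] only. *)
pose Q u v := 0 <= u -> v <= 1 ->
  cintegral `[u, v] (fun s => phi s * path_derive gamma s) = h v - h u.
apply: (piecewise_C1_ind (Q := Q)) => //.
- move=> u _ _; rewrite set_itv1 subrr.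
  by apply: eqReIm; rewrite /cintegral /= Rintegral_set1.
- move=> u v w uv vw Quv Qvw u0 w1; rewrite (cintegral_itvU uv vw); last first.
    have [i1 i2] := contour_integrable cphi.
    have sub : `[u, w]%classic `<=` `[0, 1]%classic by apply: subset_itvScc; rewrite bnd_simp.
    by split; [apply: (@integrableS _ mT) i1|apply: (@integrableS _ mT) i2].
  by rewrite Quv// ?Qvw//; [rewrite addrC subrKA|exact: le_trans uv|exact: le_trans vw _].
- move=> u v uv [eta [_ ceta Deta]] u0 v1.
  have sub : `[u, v]%classic `<=` `[0, 1]%classic by apply: subset_itvScc; rewrite bnd_simp.
  have suboo s : s \in `]u, v[ -> s \in `]0, 1[.
    by rewrite !in_itv/= => /andP[us sv]; rewrite (le_lt_trans u0)// (lt_le_trans sv).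
  have cpe : ccont `[u, v] (fun s => phi s * eta s).
    by apply: ccontM => //; exact: ccont_subset cphi.
  have [|_ ->] := @eq_itvoo_cintegral _ u v (fun s => phi s * path_derive gamma s) _ _
      (ccont_itv_integrable cpe).
    by move=> s suv; rewrite (smooth_piece_path_derive Deta).
  apply: cintegral_FTC => //; first exact: ccont_subset ch.
  by move=> s suv; apply: D; [exact: suboo|exact: Deta].
Qed.

Definition contour_cont F := ccont `[0, 1] (F \o gamma).

Lemma contour_integralD F G : contour_cont F -> contour_cont G ->
  contour_integral gamma (fun w => F w + G w) =
  contour_integral gamma F + contour_integral gamma G.
Proof.
move=> cF cG; rewrite /contour_integral -cintegralD//; try exact: contour_integrable.
by apply: eq_cintegral => s _; rewrite mulrDl.
Qed.

Lemma contour_integralZ F a : contour_cont F ->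
  contour_integral gamma (fun w => a * F w) = a * contour_integral gamma F.
Proof.
move=> cF; rewrite /contour_integral -cintegralZ//; last exact: contour_integrable.
by apply: eq_cintegral => s _; rewrite mulrA.
Qed.

Lemma contour_integral_sum (I : Type) (r : seq I) (F : I -> R[i] -> R[i]) :
  (forall i, contour_cont (F i)) ->
  contour_integral gamma (fun w => \sum_(i <- r) F i w) =
  \sum_(i <- r) contour_integral gamma (F i).
Proof.
move=> cF; rewrite /contour_integral.
rewrite -(@cintegral_sum _ _ _ _ (fun i s => F i (gamma s) * path_derive gamma s))//.
  by apply: eq_cintegral => s _; rewrite mulr_suml.
by move=> i; apply: contour_integrable; exact: cF.
Qed.

Lemma eq_contour_integral F G : (forall s, s \in `[0, 1] -> F (gamma s) = G (gamma s)) ->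
  contour_integral gamma F = contour_integral gamma G.
Proof. by move=> FG; apply: eq_cintegral => s; rewrite inE => /FG ->. Qed.

Hypothesis gamma_closed : gamma 0 = gamma 1.

Lemma is_cderive_eq s (f : R -> R[i]) df df' : is_cderive s f df -> df = df' -> is_cderive s f df'.
Proof. by move=> ? <-. Qed.

Lemma contour_integralX k : contour_integral gamma (fun w => w ^+ k) = 0.
Proof.
have k0 : k.+1%:R != 0 :> R[i] by rewrite pnatr_eq0.
pose h (s : R) := k.+1%:R^-1 * gamma s ^+ k.+1.
rewrite /contour_integral (@contour_FTC h).
- by rewrite /h gamma_closed subrr.
- apply: ccontM; [exact: ccont_cst|apply: ccontX; exact: piecewise_C1_ccont].
- apply: ccontX; exact: piecewise_C1_ccont.
- move=> s deta _ D.
  apply: (is_cderive_eq (is_cderiveM (is_cderive_cst s k.+1%:R^-1) (is_cderiveX k D))).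
  by rewrite mul0r add0r !mulrA mulVf// mul1r.
Qed.

Lemma path_subr_neq0 z : (~` (gamma @` `[0, 1])) z ->
  forall s, `[0, 1]%classic s -> gamma s - z != 0.
Proof.
move=> nz s s01; apply/negP => /eqP/subr0_eq gz.
by apply: nz; exists s.
Qed.

Lemma contour_cont_subV z : (~` (gamma @` `[0, 1])) z -> contour_cont (fun w => (w - z)^-1).
Proof.
move=> nz; apply: ccontV; first exact: path_subr_neq0.
by apply: ccontD; [exact: piecewise_C1_ccont|exact: ccont_cst].
Qed.

Lemma contour_integral_subVX z k : (~` (gamma @` `[0, 1])) z ->
  contour_integral gamma (fun w => (w - z)^-1 ^+ k.+2) = 0.
Proof.
move=> nz.
have k0 : k.+1%:R != 0 :> R[i] by rewrite pnatr_eq0.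
pose h (s : R) := (- k.+1%:R^-1) * (gamma s - z)^-1 ^+ k.+1.
rewrite /contour_integral (@contour_FTC h).
- by rewrite /h gamma_closed subrr.
- by apply: ccontM; [exact: ccont_cst|apply: ccontX; exact: contour_cont_subV].
- by apply: ccontX; exact: contour_cont_subV.
- move=> s deta s01 D.
  have gz : gamma s - z != 0.
    by apply: (path_subr_neq0 nz); apply: subset_itv_oo_cc.
  apply: (is_cderive_eq (is_cderiveM (is_cderive_cst s (- k.+1%:R^-1))
    (is_cderiveX k (is_cderiveV gz (is_cderiveD D (is_cderive_cst s (- z))))))).
  rewrite mul0r add0r addr0 -exprVn !exprS.
  move: k.+1%:R k0 (gamma s - z)^-1 => c c0 V.
  by field.
Qed.

Definition subV_prod (s : seq R[i]) (w : R[i]) := \prod_(z <- s) (w - z)^-1.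

Lemma contour_cont_subV_prod (s : seq R[i]) :
  (forall z, z \in s -> (~` (gamma @` `[0, 1])) z) -> contour_cont (subV_prod s).
Proof.
elim: s => [|z s IH] H.
  rewrite (_ : subV_prod _ = fun=> 1); first exact: ccont_cst.
  by apply/funext => w; rewrite /subV_prod big_nil.
rewrite /contour_cont (_ : _ \o _ = fun s' => (gamma s' - z)^-1 * subV_prod s (gamma s')).
  apply: ccontM; first by apply: contour_cont_subV; apply: H; rewrite mem_head.
  by apply: IH => z' zs; apply: H; rewrite inE zs orbT.
by apply/funext => w; rewrite /= /subV_prod big_cons.
Qed.

Lemma two_pi_i_neq0 : @two_pi_i R != 0.
Proof. by rewrite eq_complex /= mulf_eq0 pnatr_eq0 (gt_eqF (pi_gt0 R)) andbF. Qed.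

Lemma contour_integral_subV z : winding_number gamma z = 1 ->
  contour_integral gamma (subV_prod [:: z]) = two_pi_i.
Proof.
move=> W; rewrite (@eq_contour_integral _ (fun w => (w - z)^-1)); last first.
  by move=> s _; rewrite /subV_prod big_seq1.
by apply: (mulfI (invr_neq0 two_pi_i_neq0)); rewrite mulVf ?two_pi_i_neq0.
Qed.

Lemma contour_integral_partial_fraction a b (s : seq R[i]) : a != b ->
  (forall z, z \in [:: a, b & s] -> (~` (gamma @` `[0, 1])) z) ->
  contour_integral gamma (subV_prod [:: a, b & s]) = (a - b)^-1 *
    (contour_integral gamma (subV_prod (a :: s)) - contour_integral gamma (subV_prod (b :: s))).
Proof.
rewrite -subr_eq0 => ab H.
have ca : contour_cont (subV_prod (a :: s)).
  apply: contour_cont_subV_prod => z zas; apply: H.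
  by move: zas; rewrite !inE => /orP[->//|->]; rewrite !orbT.
have cb : contour_cont (fun w => (-1) * subV_prod (b :: s) w).
  apply: ccontM; first exact: ccont_cst.
  by apply: contour_cont_subV_prod => z zbs; apply: H; rewrite inE zbs orbT.
rewrite -[X in _ * (_ + X)]mulN1r -contour_integralZ; last first.
  by apply: contour_cont_subV_prod => z zbs; apply: H; rewrite inE zbs orbT.
rewrite -contour_integralD// -contour_integralZ; last exact: ccontD ca cb.
apply: eq_contour_integral => u u01; rewrite /subV_prod !big_cons.
set p := \prod_(_ <- _) _.
have ga : gamma u - a != 0 by apply: path_subr_neq0 u01; apply: H; rewrite mem_head.
have gb : gamma u - b != 0 by apply: path_subr_neq0 u01; apply: H; rewrite !inE eqxx orbT.
by field; rewrite ga gb ab.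
Qed.

Lemma contour_integral_subV_prod1 a (s : seq R[i]) : {in s, forall z, pred1 a z} ->
  (0 < size s)%N -> (~` (gamma @` `[0, 1])) a ->
  contour_integral gamma (subV_prod (a :: s)) = 0.
Proof.
move=> sa s0 na; rewrite -[RHS](contour_integral_subVX (size s).-1 na) (prednK s0).
apply: eq_contour_integral => u _; rewrite /subV_prod big_cons big_seq.
rewrite (eq_bigr (fun=> (gamma u - a)^-1)) => [|z /sa/eqP ->//].
by rewrite -big_seq big_const_seq count_predT iter_mulr_1 -exprS.
Qed.

(* With two distinct points, partial fractions reduce to fewer points; with a
   single repeated point the integrand has a primitive. *)
Lemma contour_integral_subV_prod k (s : seq R[i]) : size s = k.+2 ->
  (forall z, z \in s -> (~` (gamma @` `[0, 1])) z) ->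
  (forall z, z \in s -> winding_number gamma z = 1) ->
  contour_integral gamma (subV_prod s) = 0.
Proof.
elim: k s => [|k IH] [|a s] // [ss] H W;
  have [/allP eqa|/allPn[b bs ba]] := boolP (all (pred1 a) s).
1,3: by apply: contour_integral_subV_prod1; [exact: eqa|case: ss => ->|apply: H; rewrite mem_head].
all: have ps : perm_eq (a :: s) [:: a, b & rem b s] by rewrite perm_cons perm_to_rem.
all: have ss' : size (rem b s) = (size s).-1 by rewrite size_rem.
all: have -> : subV_prod (a :: s) = subV_prod [:: a, b & rem b s]
  by apply/funext => w; exact: perm_big.
all: have {}H z : z \in [:: a, b & rem b s] -> (~` (gamma @` `[0, 1])) z
  by rewrite -(perm_mem ps); exact: H.
all: have {}W z : z \in [:: a, b & rem b s] -> winding_number gamma z = 1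
  by rewrite -(perm_mem ps); exact: W.
all: have Ha z : z \in a :: rem b s -> z \in [:: a, b & rem b s]
  by rewrite !inE => /orP[->//|->]; rewrite !orbT.
all: have Hb z : z \in b :: rem b s -> z \in [:: a, b & rem b s]
  by move=> zb; rewrite inE zb orbT.
all: rewrite contour_integral_partial_fraction ?(eq_sym a)//.
  (* For two distinct points both remaining integrals equal [two_pi_i] and cancel; this is where
     equality of the winding numbers matters. *)
  rewrite (size0nil (etrans ss' (congr1 _ ss))).
  by rewrite !contour_integral_subV ?subrr ?mulr0//; apply: W; rewrite !inE eqxx ?orbT.
rewrite !IH ?subrr ?mulr0//=; rewrite ?ss' ?ss//.
- by move=> z /Hb /H.
- by move=> z /Hb /W.
- by move=> z /Ha /H.
- by move=> z /Ha /W.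
Qed.

End ContourIntegrals.

(** * Contour integrals of the resolvent *)

Section Norm1.
Context {R : realType}.
Notation mu := (@lebesgue_measure R).
Local Notation mT := (measurableTypeR R).
Notation Re := (@complex.Re R).
Notation Im := (@complex.Im R).

(* The l^1 norm of R[i] = R^2: submultiplicative, and real-valued. *)
Definition cnorm1 (z : R[i]) : R := `|Re z| + `|Im z|.

Lemma cnorm1_ge0 z : 0 <= cnorm1 z. Proof. by rewrite addr_ge0. Qed.

Lemma cnorm1D x y : cnorm1 (x + y) <= cnorm1 x + cnorm1 y.
Proof. by rewrite /cnorm1 cReD cImD addrACA lerD// ler_normD. Qed.

Lemma cnorm1M x y : cnorm1 (x * y) <= cnorm1 x * cnorm1 y.
Proof.
rewrite /cnorm1 cReM cImM mulrDl !mulrDr -!normrM.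
apply: le_trans (lerD (ler_normB _ _) (ler_normD _ _)) _.
lra.
Qed.

Lemma cnorm1_cintegral (D : set mT) (f : R -> R[i]) : measurable D -> cintegrable D f ->
  cnorm1 (cintegral D f) <= \int[mu]_(s in D) cnorm1 (f s).
Proof.
move=> mD [f1 f2]; rewrite /cnorm1.
have n1 := integrable_norm f1; have n2 := integrable_norm f2.
apply: (le_trans (lerD (le_normr_Rintegral mD f1) (le_normr_Rintegral mD f2))).
by rewrite -RintegralD.
Qed.

Lemma cintegrable_cnorm1 (D : set mT) (f : R -> R[i]) : measurable D -> cintegrable D f ->
  mu.-integrable D (EFin \o (fun s => cnorm1 (f s))).
Proof.
by move=> mD [f1 f2]; exact: (RintegrableD mT mD (integrable_norm f1) (integrable_norm f2)).
Qed.

Lemma cnorm1_eq0 z : cnorm1 z = 0 -> z = 0.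
Proof.
move=> /eqP; rewrite paddr_eq0// !normr_eq0 => /andP[/eqP r0 /eqP i0].
by case: z r0 i0 => x y /= -> ->.
Qed.

Lemma cReB (x y : R[i]) : Re (x - y) = Re x - Re y. Proof. by case: x y => ? ? []. Qed.
Lemma cImB (x y : R[i]) : Im (x - y) = Im x - Im y. Proof. by case: x y => ? ? []. Qed.

Lemma cvg_of_bound (u e : R^nat) (l : R) : e @ \oo --> 0 ->
  (forall N, `|l - u N| <= e N) -> u @ \oo --> l.
Proof.
move=> e0 H; apply/cvgrPdist_le => eps eps0.
move/cvgrPdist_le: e0 => /(_ _ eps0); apply: filterS => N; rewrite sub0r normrN => eN.
by apply: le_trans (H N) (le_trans (ler_norm _) eN).
Qed.

Lemma cnorm1_lim0 z (C : R) (e : R^nat) : (forall N, cnorm1 z <= C * e N) ->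
  e @ \oo --> 0 -> z = 0.
Proof.
move=> zC e0; apply: cnorm1_eq0; apply/eqP; rewrite eq_le cnorm1_ge0 andbT.
have Ce : (fun N => C * e N) @ \oo --> 0 by rewrite -[X in _ --> X](mulr0 C); exact: cvgMr.
apply: (ler_cvg_to (cvg_cst (cnorm1 z)) Ce).
by near=> N; exact: zC.
Unshelve. all: by end_near.
Qed.

End Norm1.

Section Resolvent.
Context {R : realType}.
Notation mu := (@lebesgue_measure R).
Local Notation mT := (measurableTypeR R).
Notation Re := (@complex.Re R).
Notation Im := (@complex.Im R).
Variables (p : nat) (A : 'M[R[i]]_p.+1) (gamma : R -> R[i]).
Hypothesis adm : admissible_path gamma A.

Let gC1 : piecewise_C1 gamma. Proof. by case: adm => -[]. Qed.
Let gclosed : gamma 0 = gamma 1. Proof. by case: adm => -[]. Qed.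

Definition resolvent (w : R[i]) := invmx (w%:M - A).

Lemma eigenvalue_off_path z : eigenvalue A z -> (~` (gamma @` `[0, 1])) z.
Proof. by case: adm => _ _ /[apply] -[]. Qed.

Lemma eigenvalue_winding z : eigenvalue A z -> winding_number gamma z = 1.
Proof. by case: adm => _ ori enc /enc; exact: ori. Qed.

(** The determinant is the characteristic polynomial at a point of the path; a zero would be an
    eigenvalue, and eigenvalues lie off the path. *)
Lemma path_unitmx s : `[0, 1]%classic s -> (gamma s)%:M - A \in unitmx.
Proof.
move=> s01; rewrite unitmxE unitfE; apply/negP => /eqP d0.
have : eigenvalue A (gamma s).
  rewrite eigenvalue_root_char rootE /char_poly -horner_evalE -det_map_mx.
  rewrite (_ : map_mx _ _ = (gamma s)%:M - A) ?d0//.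
  apply/matrixP => i j; rewrite !mxE /= horner_evalE hornerD hornerN hornerC.
  by case: (i == j); rewrite ?mulr1n ?mulr0n ?hornerX ?horner0.
by move/eigenvalue_off_path; apply; exists s.
Qed.

Lemma ccont_sum (I : Type) (r : seq I) (D : set mT) (F : I -> R -> R[i]) :
  (forall i, ccont D (F i)) -> ccont D (fun s => \sum_(i <- r) F i s).
Proof.
move=> cF; elim: r => [|i r IH].
  rewrite (_ : (fun s => _) = (fun=> 0)); first exact: ccont_cst.
  by apply/funext => s; rewrite big_nil.
rewrite (_ : (fun s => _) = (fun s => F i s + \sum_(j <- r) F j s)); first exact: ccontD.
by apply/funext => s; rewrite big_cons.
Qed.

Lemma ccont_det n (D : set mT) (M : R -> 'M[R[i]]_n) :
  (forall i j, ccont D (fun s => M s i j)) -> ccont D (fun s => \det (M s)).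
Proof.
move=> cM; apply: ccont_sum => s; apply: ccontM; first exact: ccont_cst.
by apply: ccont_prod => i; exact: cM.
Qed.

(** Cramer's rule: on the path the entry is a cofactor over a nonvanishing determinant, both
    polynomial in the point of the path. *)
Lemma ccont_resolvent i j : contour_cont gamma (fun w => resolvent w i j).
Proof.
have cM k l : ccont `[0, 1] (fun s => ((gamma s)%:M - A) k l).
  rewrite (_ : (fun s => _) = (fun s => (if k == l then gamma s else 0) - A k l)); last first.
    by apply/funext => s; rewrite !mxE; case: (k == l).
  apply: ccontD; last exact: ccont_cst.
  by case: (k == l); [exact: piecewise_C1_ccont|exact: ccont_cst].
pose f s := (\det ((gamma s)%:M - A))^-1 * \adj ((gamma s)%:M - A) i j.
have cf : ccont `[0, 1] f.
  apply: ccontM.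
    apply: ccontV; first by move=> s /path_unitmx; rewrite unitmxE unitfE.
    exact: ccont_det.
  rewrite (_ : (fun s => _) = (fun s => (-1) ^+ (j + i) *
      \det (row' j (col' i ((gamma s)%:M - A))))); last first.
    by apply/funext => s; rewrite mxE.
  apply: ccontM; first exact: ccont_cst.
  apply: ccont_det => k l.
  by rewrite (_ : (fun s => _) = (fun s => ((gamma s)%:M - A) (lift j k) (lift i l)));
    [exact: cM|apply/funext => s; rewrite !mxE].
have fE s : `[0, 1]%classic s -> resolvent (gamma s) i j = f s.
  by move=> s01; rewrite /resolvent /invmx path_unitmx// mxE.
case: cf => c1 c2; split.
  by apply: subspace_eq_continuous c1 => s; rewrite inE => s01; exact: (congr1 Re (esym (fE s s01))).
by apply: subspace_eq_continuous c2 => s; rewrite inE => s01; exact: (congr1 Im (esym (fE s s01))).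
Qed.

(** Split w - z as (w - A) + (A - z) and multiply by the resolvent. *)
Lemma resolventE z s : `[0, 1]%classic s ->
  (gamma s - z) *: resolvent (gamma s) = 1%:M + (A - z%:M) *m resolvent (gamma s).
Proof.
move=> /path_unitmx U.
have := mulmxV U; rewrite -/(resolvent _) mulmxBl mul_scalar_mx => E.
by rewrite scalerBl mulmxBl mul_scalar_mx -E addrA addrNK.
Qed.

Definition resolvent_integral (phi : R[i] -> R[i]) : 'M[R[i]]_p.+1 :=
  \matrix_(i, j) contour_integral gamma (fun w => phi w * resolvent w i j).

Lemma contour_cont_resolvent phi i j : contour_cont gamma phi ->
  contour_cont gamma (fun w => phi w * resolvent w i j).
Proof. by move=> cphi; apply: ccontM => //; exact: ccont_resolvent. Qed.

(** The previous identity integrated against [psi]. It serves twice: with [psi] a product of (w -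
    z)^-1 it adds a factor, with z = 0 and [psi] a power of w it raises the degree. *)
Lemma resolvent_integralE phi psi z : contour_cont gamma phi -> contour_cont gamma psi ->
  (forall s, `[0, 1]%classic s -> phi (gamma s) = psi (gamma s) * (gamma s - z)) ->
  resolvent_integral phi = (contour_integral gamma psi)%:M +
    (A - z%:M) *m resolvent_integral psi.
Proof.
move=> cphi cpsi e; have := resolventE z; move: (A - z%:M) => B RE.
apply/matrixP => i j; rewrite !mxE.
pose F k w := B i k * (psi w * resolvent w k j).
have cF k : contour_cont gamma (F k).
  by apply: ccontM; [exact: ccont_cst|exact: contour_cont_resolvent].
rewrite (@eq_contour_integral _ _ _ (fun w => (i == j)%:R * psi w + \sum_k F k w)); last first.
  move=> s s01; rewrite e// -mulrA.
  have /matrixP/(_ i j) := RE s s01; rewrite !mxE => ->.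
  rewrite mulrDr mulr_natr mulr_natl; congr (_ + _).
  by rewrite mulr_sumr; apply: eq_bigr => k _; rewrite mulrCA.
rewrite contour_integralD//; last 2 first.
- by apply: ccontM => //; exact: ccont_cst.
- exact: ccont_sum.
rewrite contour_integralZ// contour_integral_sum// mulr_natl; congr (_ + _).
apply: eq_bigr => k _; rewrite mxE -contour_integralZ//.
exact: contour_cont_resolvent.
Qed.

Lemma scalar_mx_eq0 (x : R[i]) : x = 0 -> x%:M = 0 :> 'M[R[i]]_p.+1.
Proof. by move=> ->; apply/matrixP => i j; rewrite !mxE mul0rn. Qed.

(** Each root z moved into the product costs a factor A - z and a scalar term. Since [t] is not
    empty, that term is the integral of a product of at least two factors, which is 0. *)
Lemma resolvent_integral_subV_prod (s t : seq R[i]) :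
  (forall z, z \in s -> eigenvalue A z) -> (forall z, z \in t -> eigenvalue A z) ->
  (0 < size t)%N ->
  resolvent_integral (subV_prod t) =
  (\prod_(z <- s) (A - z%:M)) *m resolvent_integral (subV_prod (rev s ++ t)).
Proof.
elim: s t => [|z s IH] t sA tA t0; first by rewrite big_nil mul1mx.
have zA : eigenvalue A z by apply: sA; rewrite mem_head.
have ztA w : w \in z :: t -> eigenvalue A w by rewrite inE => /predU1P[->//|/tA].
have off w : w \in z :: t -> (~` (gamma @` `[0, 1])) w by move=> /ztA/eigenvalue_off_path.
rewrite (@resolvent_integralE _ (subV_prod (z :: t)) z).
- have I0 : contour_integral gamma (subV_prod (z :: t)) = 0.
    apply: (contour_integral_subV_prod gC1 gclosed (k := (size t).-1)).
    - by rewrite /= prednK.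
    - exact: off.
    - by move=> w /ztA/eigenvalue_winding.
  rewrite (scalar_mx_eq0 I0) add0r (IH (z :: t)); last 3 first.
  + by move=> w ws; apply: sA; rewrite inE ws orbT.
  + exact: ztA.
  + by [].
  by rewrite big_cons [LHS]mulmxA rev_cons cat_rcons.
- by apply: contour_cont_subV_prod => // w wt; apply: off; rewrite inE wt orbT.
- exact: contour_cont_subV_prod.
- move=> u u01; rewrite /subV_prod big_cons mulrAC mulVf ?mul1r//.
  by apply: path_subr_neq0 u01; exact: eigenvalue_off_path.
Qed.

(* Expanding R(w) = (w - z)^-1 (1 + (A - z) R(w)) along the roots z of the
   characteristic polynomial, the remainder vanishes by Cayley-Hamilton. *)
Lemma resolvent_integral1 : resolvent_integral (fun=> 1) = (two_pi_i)%:M.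
Proof.
have [zs] := closed_field_poly_normal (char_poly A).
rewrite (monicP (char_poly_monic A)) scale1r => cA.
have zsA z : z \in zs -> eigenvalue A z.
  by move=> zzs; rewrite eigenvalue_root_char cA root_prod_XsubC.
case: zs cA zsA => [|z zs] cA zsA.
  by have := size_char_poly A; rewrite cA big_nil size_poly1.
have zA : eigenvalue A z by apply: zsA; rewrite mem_head.
have zoff : forall w, w \in [:: z] -> (~` (gamma @` `[0, 1])) w.
  by move=> w; rewrite inE => /eqP ->; exact: eigenvalue_off_path.
rewrite (@resolvent_integralE _ (subV_prod [:: z]) z); first last.
- move=> u u01; rewrite /subV_prod big_seq1 mulVf//.
  by apply: path_subr_neq0 u01; exact: eigenvalue_off_path.
- exact: contour_cont_subV_prod.
- exact: ccont_cst.
(* The only scalar term that survives: with one factor the integral is [two_pi_i], with more factors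
   it is 0. *)
rewrite contour_integral_subV ?eigenvalue_winding//.
rewrite (@resolvent_integral_subV_prod zs [:: z]); last 3 first.
- by move=> w wz; apply: zsA; rewrite inE wz orbT.
- by move=> w; rewrite inE => /eqP ->.
- by [].
suff AC : (A - z%:M) *m (\prod_(w <- zs) (A - w%:M)) = 0.
  by rewrite mulmxA AC mul0mx addr0.
rewrite -[RHS](Cayley_Hamilton A) cA rmorph_prod big_cons.
by congr (_ *m _); [|apply: eq_bigr => w _]; rewrite rmorphB /= horner_mx_X horner_mx_C.
Qed.

Lemma resolvent_integralX k : resolvent_integral (fun w => w ^+ k) = two_pi_i *: A ^+ k.
Proof.
have cX m : contour_cont gamma (fun w => w ^+ m).
  by apply: ccontX; exact: piecewise_C1_ccont.
elim: k => [|k IH].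
  have -> : two_pi_i *: A ^+ 0 = (two_pi_i)%:M by rewrite expr0 -scalemx1.
  by rewrite -resolvent_integral1.
(* With z = 0 the scalar term is the integral of w^k along a closed path, which is 0, and the matrix
   factor is A. *)
rewrite (@resolvent_integralE _ (fun w => w ^+ k) 0)//; last first.
  by move=> s _; rewrite subr0 exprSr.
rewrite (scalar_mx_eq0 (contour_integralX gC1 gclosed k)) add0r IH (scalar_mx_eq0 (erefl 0)) subr0 -scalemxAr.
by rewrite exprS.
Qed.

(** The same coefficients approximate [f] on the path and the entry [v], with one rate [e]. For
    polynomials the two sides agree by the formula for powers, so both errors bound the
    difference. *)
Lemma mxfun_approx f i j v (c : nat -> R[i]) (e : R^nat) : e @ \oo --> 0 ->
  (forall N s, `[0, 1]%classic s ->
    cnorm1 (f (gamma s) - \sum_(k < N) c k * gamma s ^+ k) <= e N) ->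
  (forall N, cnorm1 (\sum_(k < N) c k * (A ^+ k) i j - v) <= e N) ->
  mxfun gamma f A i j = v.
Proof.
move=> e0 fe ve.
pose S N (w : R[i]) := \sum_(k < N) c k * w ^+ k.
have cS N : contour_cont gamma (S N).
  apply: ccont_sum => k; apply: ccontM; first exact: ccont_cst.
  by apply: ccontX; exact: piecewise_C1_ccont.
have bS N : cbounded `[0, 1] (S N \o gamma) := ccont_itv_bounded (cS N).
have cvgS s : `[0, 1]%classic s -> (fun N => Re (S N (gamma s))) @ \oo --> Re (f (gamma s)) /\
    (fun N => Im (S N (gamma s))) @ \oo --> Im (f (gamma s)).
  move=> s01; split.
    apply: (cvg_of_bound e0) => N; apply: le_trans (fe N s s01).
    by rewrite -cReB /cnorm1 lerDl.
  apply: (cvg_of_bound e0) => N; apply: le_trans (fe N s s01).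
  by rewrite -cImB /cnorm1 lerDr.
have bf : cbounded `[0, 1] (f \o gamma).
  have [b1 b2 [M HM]] := bS 0%N.
  split.
  - apply: (@measurable_fun_cvg _ mT _ _ (fun N => Re \o S N \o gamma)).
      by move=> N; have [] := bS N.
    by move=> s /cvgS[].
  - apply: (@measurable_fun_cvg _ mT _ _ (fun N => Im \o S N \o gamma)).
      by move=> N; have [] := bS N.
    by move=> s /cvgS[].
  (* With N = 0 the sum is empty, so the error bound is a bound on [f] itself. *)
  - exists (e 0%N) => s s01; have := fe 0%N s s01; rewrite big_ord0 subr0 => H.
    by split; apply: le_trans H; rewrite /cnorm1 ?lerDl ?lerDr.
have cR : ccont `[0, 1] (fun s => resolvent (gamma s) i j) := ccont_resolvent i j.
pose rg s := resolvent (gamma s) i j * path_derive gamma s.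
have irg : cintegrable `[0, 1] rg := contour_integrable gC1 cR.
pose C := \int[mu]_(s in `[0, 1]) cnorm1 (rg s).
have C0 : 0 <= C by apply: Rintegral_ge0 => s _; exact: cnorm1_ge0.
apply/eqP; rewrite -subr_eq0; apply/eqP.
(* The constant collects two errors: that of [f] on the path, weighted by the integral [C] of the
   norm of the resolvent, and that of the entry, with weight 1. *)
apply: (@cnorm1_lim0 _ _ (cnorm1 (two_pi_i^-1 : R[i]) * C + 1) e) => // N.
have iS : cintegrable `[0, 1] (fun s => S N (gamma s) * rg s).
  by apply: cintegrableM; [exact: measurable_itv|exact: bS|].
have if_ : cintegrable `[0, 1] (fun s => f (gamma s) * rg s).
  by apply: cintegrableM; [exact: measurable_itv|exact: bf|].
have idiff : cintegrable `[0, 1] (fun s => (f (gamma s) - S N (gamma s)) * rg s).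
  apply: eq_cintegrable (cintegrableD _ if_ (cintegrableZ (-1) _ iS)) => // s _.
  by rewrite mulN1r mulrBl.
have split_int : contour_integral gamma (fun w => f w * resolvent w i j) =
    cintegral `[0, 1] (fun s => (f (gamma s) - S N (gamma s)) * rg s) +
    two_pi_i * \sum_(k < N) c k * (A ^+ k) i j.
  have -> : two_pi_i * \sum_(k < N) c k * (A ^+ k) i j =
      cintegral `[0, 1] (fun s => S N (gamma s) * rg s).
    transitivity (contour_integral gamma (fun w => \sum_(k < N) c k * (w ^+ k * resolvent w i j))).
      have cXr k : contour_cont gamma (fun w => w ^+ k * resolvent w i j).
        by apply: contour_cont_resolvent; apply: ccontX; exact: piecewise_C1_ccont.
      rewrite contour_integral_sum//; last by move=> k; exact: (ccontM (ccont_cst _ (c k)) (cXr k)).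
      rewrite mulr_sumr; apply: eq_bigr => k _; rewrite (contour_integralZ gC1 _ (cXr k)).
      have /matrixP/(_ i j) := resolvent_integralX k; rewrite !mxE => ->.
      by rewrite mulrCA.
    apply: eq_cintegral => s _; rewrite mulrA; congr (_ * _).
    by rewrite /S mulr_suml; apply: eq_bigr => k _; rewrite mulrA.
  rewrite -cintegralD//; apply: eq_cintegral => s _.
  by rewrite -mulrDl subrK mulrA.
rewrite mxE split_int mulrDr mulrA mulVf ?two_pi_i_neq0// mul1r -addrA.
apply: le_trans (cnorm1D _ _) _; rewrite mulrDl mul1r; apply: lerD => //.
apply: le_trans (cnorm1M _ _) _; rewrite -mulrA ler_wpM2l ?cnorm1_ge0//.
apply: le_trans (cnorm1_cintegral _ idiff) _ => //.
rewrite mulrC -RintegralZl//; last exact: cintegrable_cnorm1.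
apply: le_Rintegral => //; first exact: cintegrable_cnorm1.
  by apply: (RintegrableZ mT) => //; exact: cintegrable_cnorm1.
move=> s s01; apply: le_trans (cnorm1M _ _) _.
by rewrite ler_wpM2r ?cnorm1_ge0//; exact: fe.
Qed.

End Resolvent.

(** * Exponentials *)

Section ExponentialBounds.
Context {R : realType}.
Notation Re := (@complex.Re R).
Notation Im := (@complex.Im R).

Lemma le_of_derive_le (f g df dg : R -> R) :
  (forall s : R, is_derive s 1 f (df s)) -> (forall s : R, is_derive s 1 g (dg s)) ->
  (forall s, 0 <= s <= 1 -> df s <= dg s) -> f 0 = g 0 ->
  forall s, 0 <= s <= 1 -> f s <= g s.
Proof.
move=> Df Dg le_d e0 s /andP[s0 s1].
have D (u : R) : is_derive u 1 (g - f) (dg u - df u) by apply: is_deriveB.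
have cD : {within `[0, s], continuous (g - f)}.
  by apply: derivable_within_continuous => u _; have [] := D u.
have := @ger0_derive1_ndecr R (g - f) 0 s _ _ cD 0 s (lexx 0) s0 (lexx s).
rewrite !fctE e0 subrr subr_ge0; apply.
- by move=> u _; have [] := D u.
- move=> u; rewrite in_itv/= => /andP[u0 us].
  rewrite derive1E; have [_ ->] := D u; rewrite subr_ge0 le_d// ltW//=.
  by rewrite (le_trans (ltW us)).
Qed.

Lemma normr_le_of_derive_le (f g df dg : R -> R) :
  (forall s : R, is_derive s 1 f (df s)) -> (forall s : R, is_derive s 1 g (dg s)) ->
  (forall s, 0 <= s <= 1 -> `|df s| <= dg s) -> f 0 = 0 -> g 0 = 0 ->
  forall s, 0 <= s <= 1 -> `|f s| <= g s.
Proof.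
move=> Df Dg le_d f0 g0 s s0; rewrite ler_norml; apply/andP; split.
  have Dg' (u : R) : is_derive u 1 (- g) (- dg u) by apply: is_deriveN.
  apply: (le_of_derive_le Dg' Df _ _ s0); last by rewrite !fctE f0 g0 oppr0.
  by move=> u u0; move: (le_d u u0); rewrite ler_norml => /andP[].
apply: (le_of_derive_le Df Dg _ _ s0); last by rewrite f0 g0.
by move=> u u0; move: (le_d u u0); rewrite ler_norml => /andP[].
Qed.

Definition cexp_sum (N : nat) (z : R[i]) : R[i] := \sum_(k < N) (k`!%:R)^-1 * z ^+ k.

Lemma is_cderive_scale (z : R[i]) (s : R) : is_cderive s (fun s : R => s%:C * z) z.
Proof.
case: z => x y; split.
  rewrite (_ : _ \o _ = (fun s => s * x)); last by apply/funext => u /=; rewrite mul0r subr0.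
  by apply: is_derive_eq; rewrite /GRing.scale/= mulr1 mulr0 add0r.
rewrite (_ : _ \o _ = (fun s => s * y)); last by apply/funext => u /=; rewrite mul0r addr0.
by apply: is_derive_eq; rewrite /GRing.scale/= mulr1 mulr0 add0r.
Qed.

Lemma is_cderive_cexp (z : R[i]) (s : R) :
  is_cderive s (fun s : R => cexp (s%:C * z)) (z * cexp (s%:C * z)).
Proof.
case: z => x y.
have De : is_derive s 1 (fun u => expR (u * x)) (x * expR (s * x)).
  by apply: is_derive_eq; rewrite /GRing.scale/= mulr0 add0r mulr1 mulrC.
have Dc : is_derive s 1 (fun u => cos (u * y)) (- (y * sin (s * y))).
  by apply: is_derive_eq; rewrite /GRing.scale/= mulr0 add0r mulr1 mulNr mulrC.
have Ds : is_derive s 1 (fun u => sin (u * y)) (y * cos (s * y)).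
  by apply: is_derive_eq; rewrite /GRing.scale/= mulr0 add0r mulr1 mulrC.
split.
  rewrite (_ : _ \o _ = (fun u => expR (u * x)) * (fun u => cos (u * y))); last first.
    by apply/funext => u /=; rewrite !mul0r subr0 addr0.
  apply: (is_derive_eq (is_deriveM De Dc)).
  by rewrite /= !mul0r subr0 addr0 /GRing.scale/=; ring.
rewrite (_ : _ \o _ = (fun u => expR (u * x)) * (fun u => sin (u * y))); last first.
  by apply/funext => u /=; rewrite !mul0r subr0 addr0.
apply: (is_derive_eq (is_deriveM De Ds)).
by rewrite /= !mul0r subr0 addr0 /GRing.scale/=; ring.
Qed.

Lemma is_cderive_cexp_sum (z : R[i]) N (s : R) :
  is_cderive s (fun s : R => cexp_sum N.+1 (s%:C * z)) (z * cexp_sum N (s%:C * z)).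
Proof.
elim: N => [|N IH].
  rewrite (_ : (fun s => _) = fun=> 1); last first.
    by apply/funext => u; rewrite /cexp_sum big_ord1 expr0 mulr1 fact0 invr1.
  by rewrite /cexp_sum big_ord0 mulr0; exact: is_cderive_cst.
rewrite (_ : (fun s => _) = (fun s : R => cexp_sum N.+1 (s%:C * z) +
    (N.+1`!%:R)^-1 * (s%:C * z) ^+ N.+1)); last first.
  by apply/funext => u; rewrite /cexp_sum big_ord_recr.
apply: (is_cderive_eq (is_cderiveD IH (is_cderiveM (is_cderive_cst s (N.+1`!%:R)^-1)
   (is_cderiveX N (is_cderive_scale z s))))).
rewrite /cexp_sum [in RHS]big_ord_recr mulrDr mul0r add0r/=; congr (_ + _).
have n0 : N.+1%:R != 0 :> R[i] by rewrite pnatr_eq0.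
have f0 : (N`!)%:R != 0 :> R[i] by rewrite pnatr_eq0 -lt0n fact_gt0.
rewrite factS natrM; move: (N.+1%:R) (N`!%:R) (s%:C * z) n0 f0 => a b w a0 b0.
by field; rewrite a0 b0.
Qed.

Lemma cexp0 : cexp (0 : R[i]) = 1.
Proof. by apply: eqReIm; rewrite /cexp /= expR0 ?cos0 ?sin0 ?mulr1 ?mulr0. Qed.

Lemma cexp_sum0 N : cexp_sum N.+1 0 = 1.
Proof.
rewrite /cexp_sum big_ord_recl /= expr0 mulr1 fact0 invr1 big1 ?addr0// => k _.
by rewrite /bump /= add1n expr0n /= mulr0.
Qed.

Lemma is_derive_exp_coeff (M K : R) N (s : R) :
  is_derive s 1 (fun s => M * exp_coeff (s * K) N.+1) (M * (K * exp_coeff (s * K) N)).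
Proof.
rewrite (_ : (fun s => _) = cst (M / (N.+1)`!%:R) * (fun s => s * K) ^+ N.+1); last first.
  by apply/funext => u; rewrite /exp_coeff !fctE /= [RHS]mulrAC mulrA.
have DK : is_derive s 1 (fun s : R => s * K) K.
  by apply: is_derive_eq; rewrite /GRing.scale/= mulr0 add0r mulr1.
have DX := is_deriveX N.+1 DK.
apply: (is_derive_eq (is_deriveM (is_derive_cst (M / (N.+1)`!%:R) s 1) DX)).
rewrite /= !scaler0 addr0 /GRing.scale/= /exp_coeff /=.
have n0 : N.+1%:R != 0 :> R by rewrite pnatr_eq0.
have f0 : (N`!)%:R != 0 :> R by rewrite pnatr_eq0 -lt0n fact_gt0.
rewrite factS natrM; move: (N.+1%:R) (N`!%:R) n0 f0 => a b a0 b0.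
by field; rewrite a0 b0.
Qed.

(** Induction on N: the derivative in s of the remainder of order N + 1 is z times that of order N,
    and integrating the bound for the latter gives the next term of the exponential series.
    Multiplication by z mixes real and imaginary parts, whence the l^1 norm. *)
Lemma cexp_taylor_aux (z : R[i]) N (s : R) : 0 <= s <= 1 ->
  let rem := cexp (s%:C * z) - cexp_sum N (s%:C * z) in
  `|Re rem| <= expR (cnorm1 z) * exp_coeff (s * cnorm1 z) N /\
  `|Im rem| <= expR (cnorm1 z) * exp_coeff (s * cnorm1 z) N.
Proof.
elim: N s => [|N IH] s s01 /=.
  rewrite /cexp_sum big_ord0 subr0 /exp_coeff /= expr0 fact0 divr1 mulr1 !normrM.
  rewrite ger0_norm ?expR_ge0//.
  have le_e : expR (Re (s%:C * z)) <= expR (cnorm1 z).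
    have /andP[s0 s1] := s01.
    rewrite ler_expR; case: z => x y /=; rewrite mul0r subr0 /cnorm1/=.
    apply: (@le_trans _ _ `|x|); last by rewrite lerDl.
    apply: (le_trans (ler_norm _)); rewrite normrM ger0_norm//.
    by rewrite ler_piMl.
  by split; (apply: le_trans le_e; rewrite ler_piMr ?expR_ge0 ?cos_max ?sin_max).
have D (u : R) : is_cderive u (fun s : R => cexp (s%:C * z) - cexp_sum N.+1 (s%:C * z))
    (z * (cexp (u%:C * z) - cexp_sum N (u%:C * z))).
  have := is_cderiveD (is_cderive_cexp z u)
    (is_cderiveM (is_cderive_cst u (-1)) (is_cderive_cexp_sum z N u)).
  rewrite mul0r add0r mulN1r -mulrN -mulrDr.
  by rewrite (_ : (fun s => _) = (fun s : R => cexp (s%:C * z) - cexp_sum N.+1 (s%:C * z)))//;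
    apply/funext => v; rewrite mulN1r.
have D0 : cexp ((0 : R)%:C * z) - cexp_sum N.+1 ((0 : R)%:C * z) = 0.
  by rewrite mul0r cexp0 cexp_sum0 subrr.
have g0 : expR (cnorm1 z) * exp_coeff (0 * cnorm1 z) N.+1 = 0.
  by rewrite mul0r /exp_coeff /= expr0n /= mul0r mulr0.
have K0 := cnorm1_ge0 z.
have bnd (x y a b M : R) : `|a| <= M -> `|b| <= M -> `|x * a| + `|y * b| <= M * (`|x| + `|y|).
  by move=> aM bM; rewrite !normrM mulrDr mulrC lerD// ?ler_wpM2r// mulrC ler_wpM2r.
split.
- apply: (normr_le_of_derive_le (fun u => (D u).1) (is_derive_exp_coeff _ _ _) _ _ g0 s01).
    move=> u /IH[]; set r := _ - _ => r1 r2; rewrite cReM [leRHS]mulrCA mulrC.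
    by apply: le_trans (ler_normB _ _) _; rewrite mulrC [leRHS]mulrC; exact: bnd.
  by rewrite /= D0.
- apply: (normr_le_of_derive_le (fun u => (D u).2) (is_derive_exp_coeff _ _ _) _ _ g0 s01).
    move=> u /IH[]; set r := _ - _ => r1 r2; rewrite cImM [leRHS]mulrCA mulrC.
    by apply: le_trans (ler_normD _ _) _; rewrite [leRHS]mulrC [Im r * _]mulrC; exact: bnd.
  by rewrite /= D0.
Qed.

(** The factor 2 comes from adding the separate bounds on the real and imaginary parts. *)
Lemma cexp_taylor (z : R[i]) N :
  cnorm1 (cexp z - cexp_sum N z) <= 2 * expR (cnorm1 z) * exp_coeff (cnorm1 z) N.
Proof.
have := @cexp_taylor_aux z N 1; rewrite ler01 lexx => /(_ erefl); rewrite !mul1r => -[r1 r2].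
by rewrite -mulrA mulr_natl mulr2n /cnorm1 lerD.
Qed.

End ExponentialBounds.

(** * The matrix exponential and its Taylor bounds *)

Section MatrixExponential.
Context {R : realType} (p : nat).
Variable L : 'M[R]_p.+1.

(** A crude matrix norm, chosen because its powers dominate every entry of the powers of [L]. *)
Definition entry_norm : R := \sum_i \sum_j `|L i j|.

Lemma entry_norm_ge0 : 0 <= entry_norm.
Proof. by apply: sumr_ge0 => i _; apply: sumr_ge0. Qed.

Lemma mxexp_entry_le k i j : `|(L ^+ k) i j| <= entry_norm ^+ k.
Proof.
elim: k i j => [|k IH] i j.
  by rewrite !expr0 mxE; case: (_ == _); rewrite ?normr1 ?normr0.
rewrite !exprS mxE; apply: le_trans (ler_norm_sum _ _ _) _.
apply: (@le_trans _ _ (\sum_l `|L i l| * entry_norm ^+ k)).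
  by apply: ler_sum => l _; rewrite normrM ler_wpM2l.
rewrite -mulr_suml ler_wpM2r ?exprn_ge0 ?entry_norm_ge0//.
rewrite /entry_norm [leRHS](bigD1 i)//= lerDl; apply: sumr_ge0 => l _; exact: sumr_ge0.
Qed.

Definition expmx_sum N (x : R) i j := \sum_(k < N) (k`!%:R)^-1 * x ^+ k * (L ^+ k) i j.

(** N! k! divides (N + k)!, the quotient being a binomial coefficient, at least 1. *)
Lemma exp_coeff_add (y : R) N k : 0 <= y -> exp_coeff y (N + k) <= exp_coeff y N * exp_coeff y k.
Proof.
move=> y0; rewrite /exp_coeff /= mulrACA -exprD -invfM ler_wpM2l ?exprn_ge0//.
rewrite lef_pV2 ?posrE ?mulr_gt0 ?ltr0n ?fact_gt0//.
rewrite -natrM ler_nat -(bin_fact (leq_addl N k)) addnK.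
by rewrite [X in (X <= _)%N]mulnC leq_pmull// bin_gt0 leq_addl.
Qed.

(** Factoring out the leading term leaves a partial sum of the exponential series. *)
Lemma exp_coeff_tail (y : R) N M : 0 <= y ->
  \sum_(N <= k < N + M) exp_coeff y k <= expR y * exp_coeff y N.
Proof.
move=> y0; rewrite -{1}[N]add0n big_addn addKn.
apply: (@le_trans _ _ (\sum_(0 <= i < M) exp_coeff y N * exp_coeff y i)).
  by apply: ler_sum => i _; rewrite addnC; exact: exp_coeff_add.
rewrite -mulr_sumr mulrC ler_wpM2r ?exp_coeff_ge0//.
apply: (@nondecreasing_cvgn_le _ (series (exp_coeff y))).
  apply/nondecreasing_seqP => n; rewrite !seriesEnat /= big_nat_recr//= lerDl.
  exact: exp_coeff_ge0.
exact: is_cvg_series_exp_coeff.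
Qed.

Lemma expmx_taylor (x : R) N i j :
  `|expmx (x *: L) i j - expmx_sum N x i j| <=
    expR (`|x| * entry_norm) * exp_coeff (`|x| * entry_norm) N.
Proof.
set y := `|x| * entry_norm; have y0 : 0 <= y by rewrite mulr_ge0// entry_norm_ge0.
pose u k := (k`!%:R)^-1 * ((x *: L) ^+ k) i j.
have uE k : u k = (k`!%:R)^-1 * x ^+ k * (L ^+ k) i j by rewrite /u exprZn mxE mulrA.
have u_le k : `|u k| <= exp_coeff y k.
  rewrite uE !normrM ger0_norm ?invr_ge0// normrX /exp_coeff /= exprMn -mulrA mulrC.
  rewrite ler_wpM2r ?invr_ge0// ler_wpM2l ?exprn_ge0//.
  exact: mxexp_entry_le.
(* [limn] has a meaning only for a convergent series; comparison with the scalar exponential series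
   provides it. *)
have cu : cvgn (series u).
  apply: normed_cvg; apply: (@series_le_cvg _ _ (exp_coeff y)) => //=.
  - by move=> k; exact: exp_coeff_ge0.
  - exact: is_cvg_series_exp_coeff.
have -> : expmx (x *: L) i j = limn (series u) by rewrite mxE.
have -> : expmx_sum N x i j = series u N.
  by rewrite seriesEord /=; apply: eq_bigr => k _; rewrite uE.
have cd : (fun M => `|series u M - series u N|) @ \oo --> `|limn (series u) - series u N|.
  by apply: cvg_norm; apply: cvgB => //; exact: cvg_cst.
apply: (ler_cvg_to cd (cvg_cst _)); near=> M.
have NM : (N <= M)%N by near: M; exact: nbhs_infty_ge.
rewrite sub_series NM; apply: le_trans (ler_norm_sum _ _ _) _.
apply: le_trans (ler_sum _ (fun k _ => u_le k)) _.
by rewrite -(subnKC NM); exact: exp_coeff_tail.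
Unshelve. all: by end_near.
Qed.

Lemma expmx_sum_continuous N i j : continuous (fun x => expmx_sum N x i j).
Proof.
elim: N => [|N IH] x.
  by under eq_fun do rewrite /expmx_sum big_ord0; exact: cvg_cst.
under eq_fun do rewrite /expmx_sum big_ord_recr /=.
apply: cvgD; first exact: IH.
by apply: cvgMl; apply: cvgMr; exact: exprn_continuous.
Qed.

(** The Taylor polynomials converge uniformly for |z| at most |x| + 1; a polynomial of fixed order
    gives the usual three-term estimate. *)
Lemma expmx_continuous i j : continuous (fun x : R => expmx (x *: L) i j).
Proof.
move=> x; apply/cvgrPdist_le => eps eps0.
pose y := (`|x| + 1) * entry_norm.
have y0 : 0 <= y by rewrite mulr_ge0 ?entry_norm_ge0.
have /cvgrPdist_le/(_ (eps / 3)) : (fun N => expR y * exp_coeff y N) @ \oo --> 0.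
  by rewrite -[X in _ --> X](mulr0 (expR y)); apply: cvgMr; exact: cvg_exp_coeff.
rewrite divr_gt0// => /(_ isT) [N _ /(_ N (leqnn N))]; rewrite sub0r normrN /= => HN.
have approx z : `|z| <= `|x| + 1 -> `|expmx (z *: L) i j - expmx_sum N z i j| <= eps / 3.
  move=> zx; apply: le_trans (expmx_taylor z N i j) _.
  have zy : `|z| * entry_norm <= y by rewrite ler_wpM2r ?entry_norm_ge0.
  apply: le_trans _ (le_trans (ler_norm _) HN).
  apply: ler_pM; rewrite ?expR_ge0 ?exp_coeff_ge0 ?ler_expR ?mulr_ge0 ?entry_norm_ge0//.
  by rewrite /exp_coeff /= ler_wpM2r ?invr_ge0// lerXn2r ?nnegrE ?mulr_ge0 ?entry_norm_ge0.
have /cvgrPdist_le/(_ (eps / 3)) := @expmx_sum_continuous N i j x; rewrite divr_gt0// => /(_ isT) nearS.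
have near1 : \forall z \near x, `|x - z| < 1 by apply/nbhs_ballP; exists 1 => //=; exact: ltr01.
apply: filterS2 near1 nearS => z zx1 zS.
have zx : `|z| <= `|x| + 1.
  by rewrite -lerBlDl; apply: (le_trans (lerB_dist _ _)); rewrite distrC ltW.
have -> : expmx (x *: L) i j - expmx (z *: L) i j =
  (expmx (x *: L) i j - expmx_sum N x i j) + (expmx_sum N x i j - expmx_sum N z i j)
   - (expmx (z *: L) i j - expmx_sum N z i j) by ring.
rewrite (_ : eps = eps / 3 + eps / 3 + eps / 3); last by field.
apply: le_trans (ler_normB _ _) _; apply: lerD; last exact: approx.
apply: le_trans (ler_normD _ _) _; apply: lerD; first by apply: approx; rewrite lerDl.
exact: zS.
Qed.

(** The Taylor bound of order 2, without its factor 1/2. *)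
Lemma expmx_first_order (x : R) i j :
  `|expmx (x *: L) i j - (i == j)%:R - x * L i j| <=
    expR (`|x| * entry_norm) * (`|x| * entry_norm) ^+ 2.
Proof.
have := expmx_taylor x 2 i j.
have -> : expmx_sum 2 x i j = (i == j)%:R + x * L i j.
  by rewrite /expmx_sum !big_ord_recl big_ord0 addr0 /= expr0 invr1 !mul1r mxE expr1.
rewrite opprD addrA => /le_trans; apply.
rewrite ler_wpM2l ?expR_ge0// /exp_coeff /= ler_pdivrMr// ler_peMr ?exprn_ge0 ?mulr_ge0 ?entry_norm_ge0//.
by rewrite ler1n.
Qed.

End MatrixExponential.

(** * Functional calculus of integrals of exponentials *)

Section MxfunExpIntegral.
Context {R : realType}.
Notation mu := (@lebesgue_measure R).
Local Notation mT := (measurableTypeR R).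
Notation Re := (@complex.Re R).
Notation Im := (@complex.Im R).

Lemma continuous_comp_within (D : set R) (h k : R -> R) : continuous h ->
  {within D, continuous k} -> {within D, continuous (h \o k)}.
Proof.
move=> ch /subspace_continuousP ck; apply/subspace_continuousP => x Dx.
by apply: (cvg_comp _ _ (ck x Dx)); exact: ch.
Qed.

Lemma ccont_cexp (D : set mT) (f : R -> R[i]) : ccont D f -> ccont D (fun u => cexp (f u)).
Proof.
move=> [f1 f2].
have ce := continuous_comp_within (@continuous_expR R) f1.
have cc := continuous_comp_within (@continuous_cos R) f2.
have cs := continuous_comp_within (@continuous_sin R) f2.
by split => x; apply: cvgM; [exact: ce|exact: cc|exact: ce|exact: cs].
Qed.

Lemma ccont_real (D : set mT) (f : R -> R) : {within D, continuous f} ->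
  ccont D (fun u => (f u)%:C).
Proof. by move=> cf; split => // x; exact: cvg_cst. Qed.

Lemma cintegrable_real (D : set mT) (f : R -> R) : measurable D ->
  mu.-integrable D (EFin \o f) -> cintegrable D (fun u => (f u)%:C).
Proof. by move=> mD fi; split => //; exact: (@integrable0 _ mT). Qed.

Lemma cintegral_real (D : set mT) (f : R -> R) :
  cintegral D (fun u => (f u)%:C) = (\int[mu]_(u in D) f u)%:C.
Proof. by apply: eqReIm => //=; rewrite /Rintegral integral0. Qed.

Lemma cnorm1_real (x : R) : cnorm1 x%:C = `|x|.
Proof. by rewrite /cnorm1 /= normr0 addr0. Qed.

Lemma exp_coeff_le (x y : R) N : 0 <= x -> x <= y -> exp_coeff x N <= exp_coeff y N.
Proof.
move=> x0 xy; rewrite /exp_coeff /= ler_wpM2r ?invr_ge0// lerXn2r ?nnegrE//.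
exact: le_trans xy.
Qed.

Lemma map_mxX p (A : 'M[R]_p.+1) k i j : ((mxC A) ^+ k) i j = ((A ^+ k) i j)%:C.
Proof. by rewrite /mxC -rmorphXn mxE. Qed.

Variables (p : nat) (L : 'M[R]_p.+1) (gamma : R -> R[i]).
Hypothesis adm : admissible_path gamma (mxC L).
Variables (om tau : R -> R) (t n : R).
Hypothesis iom : mu.-integrable `[t, n] (EFin \o om).
Hypothesis ctau : {within `[t, n], continuous tau}.

Let cw w : ccont `[t, n] (fun u => w * (tau u)%:C).
Proof. by apply: ccontM; [exact: ccont_cst|exact: ccont_real]. Qed.

Let iomc : cintegrable `[t, n] (fun u => (om u)%:C).
Proof. exact: cintegrable_real. Qed.

Let iom_mul (h : R -> R) : {within `[t, n], continuous h} ->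
  mu.-integrable `[t, n] (EFin \o (fun u => h u * om u)).
Proof.
move=> ch.
have /compact_bounded[M [_ HM]] := continuous_compact ch (@segment_compact R t n).
apply: (integrable_mul_bounded mT (M + 1)) => //.
  exact: subspace_continuous_measurable_fun.
by move=> s s01; apply: HM; [rewrite ltrDl|exists s].
Qed.

Let ctauX k : {within `[t, n], continuous (fun u => tau u ^+ k)}.
Proof. exact: (continuous_comp_within (@exprn_continuous _ k) ctau). Qed.

(** Both [f1] and [f2] have this shape: [tau] is the elapsed clock time and [om] the discount
    factor, multiplied by lambda for [f2]. The Taylor coefficients are the moments of [tau] against
    [om]; being the same for w and for the matrix, they feed [mxfun_approx], and no exchange of the
    contour integral with the time integral is needed. *)
Lemma mxfun_exp_integral i j :
  mxfun gamma (fun w => cintegral `[t, n] (fun u => (om u)%:C * cexp (w * (tau u)%:C)))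
    (mxC L) i j =
  (\int[mu]_(u in `[t, n]) (om u * expmx (tau u *: L) i j))%:C.
Proof.
have /compact_bounded[S0 [_ HS]] := continuous_compact ctau (@segment_compact R t n).
pose S := S0 + 1; have tauS u : `[t, n]%classic u -> `|tau u| <= S.
  by move=> u01; apply: HS; [rewrite ltrDl|exists u].
have [[gC1 _ _] _ _] := adm.
have [_ _ [M0 HM]] := ccont_itv_bounded (piecewise_C1_ccont gC1).
pose M := M0 + M0; have gM s : `[0, 1]%classic s -> cnorm1 (gamma s) <= M.
  by move=> /HM[m1 m2]; exact: lerD.
(* One radius for both exponentials, bounding |w tau| on the path and |tau| times the norm of [L].
   The maxima with 0 keep the factors nonnegative. *)
pose y := Num.max 0 M * Num.max 0 S + Num.max 0 S * entry_norm L.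
have y1 s u : `[0, 1]%classic s -> `[t, n]%classic u ->
    cnorm1 (gamma s * (tau u)%:C) <= y.
  move=> s01 u01; apply: le_trans (cnorm1M _ _) _; rewrite cnorm1_real.
  apply: (@le_trans _ _ (Num.max 0 M * Num.max 0 S)).
    by apply: ler_pM; rewrite ?cnorm1_ge0// le_max ?gM ?tauS// orbT.
  by rewrite lerDl mulr_ge0 ?entry_norm_ge0// le_max lexx.
have y2 u : `[t, n]%classic u -> `|tau u| * entry_norm L <= y.
  move=> u01; apply: (@le_trans _ _ (Num.max 0 S * entry_norm L)).
    by rewrite ler_wpM2r ?entry_norm_ge0// le_max tauS// orbT.
  by rewrite lerDr mulr_ge0// le_max lexx.
have W0 : 0 <= \int[mu]_(u in `[t, n]) `|om u| by exact: Rintegral_ge0.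
set W := \int[mu]_(u in `[t, n]) `|om u| in W0.
(* The complex Taylor bound at radius [y], integrated against |om|; its factor 2 is slack for the
   matrix. *)
pose e N := W * (2 * expR y * exp_coeff y N).
pose c k : R := (k`!%:R)^-1 * \int[mu]_(u in `[t, n]) (tau u ^+ k * om u).
apply: (@mxfun_approx _ _ _ _ adm _ _ _ _ (fun k => (c k)%:C) e).
- rewrite -[X in _ --> X](mulr0 W); apply: cvgMr.
  rewrite -[X in _ --> X](mulr0 (2 * expR y)); apply: cvgMr; exact: cvg_exp_coeff.
- move=> N s s01; set w := gamma s.
  have i1 : cintegrable `[t, n] (fun u => cexp (w * (tau u)%:C) * (om u)%:C).
    by apply: cintegrableM; [exact: measurable_itv|exact: ccont_itv_bounded (ccont_cexp (cw w))|].
  have i2 k : cintegrable `[t, n] (fun u => ((tau u ^+ k) * om u)%:C).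
    by apply: cintegrable_real => //; exact: iom_mul.
  have eS : \sum_(k < N) (c k)%:C * w ^+ k =
      cintegral `[t, n] (fun u => cexp_sum N (w * (tau u)%:C) * (om u)%:C).
    transitivity (cintegral `[t, n] (fun u => \sum_(k < N)
      ((k`!%:R)^-1 * w ^+ k) * (tau u ^+ k * om u)%:C)).
      rewrite cintegral_sum//; last by move=> k; exact: cintegrableZ.
      apply: eq_bigr => k _; rewrite cintegralZ// cintegral_real /c rmorphM fmorphV rmorph_nat.
      by rewrite mulrAC.
    apply: eq_cintegral => u _; rewrite /cexp_sum mulr_suml; apply: eq_bigr => k _.
    by rewrite exprMn rmorphM rmorphXn !mulrA.
  have i3 : cintegrable `[t, n] (fun u => cexp_sum N (w * (tau u)%:C) * (om u)%:C).
    apply: cintegrableM; [exact: measurable_itv| |exact: iomc].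
    apply: ccont_itv_bounded; apply: ccont_sum => k.
    by apply: ccontM; [exact: ccont_cst|exact: ccontX].
  have i4 : cintegrable `[t, n] (fun u => (cexp (w * (tau u)%:C) - cexp_sum N (w * (tau u)%:C)) * (om u)%:C).
    apply: eq_cintegrable (cintegrableD _ i1 (cintegrableZ (-1) _ i3)) => // u _.
    by rewrite mulN1r mulrBl.
  have -> : cintegral `[t, n] (fun u => (om u)%:C * cexp (w * (tau u)%:C)) -
      \sum_(k < N) (c k)%:C * w ^+ k =
    cintegral `[t, n] (fun u => (cexp (w * (tau u)%:C) - cexp_sum N (w * (tau u)%:C)) * (om u)%:C).
    rewrite eS -mulN1r -cintegralZ// -cintegralD//; last 2 first.
    + by apply: eq_cintegrable i1 => // u _; rewrite mulrC.
    + exact: cintegrableZ.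
    by apply: eq_cintegral => u _; rewrite mulN1r mulrBl [(om u)%:C * _]mulrC.
  apply: le_trans (cnorm1_cintegral _ i4) _ => //.
  rewrite /e /W mulrC -RintegralZl//; last exact: integrable_norm iom.
  apply: le_Rintegral => //; first exact: cintegrable_cnorm1.
    by apply: (RintegrableZ mT) => //; exact: integrable_norm iom.
  move=> u u01; apply: le_trans (cnorm1M _ _) _; rewrite cnorm1_real ler_wpM2r//.
  apply: le_trans (cexp_taylor _ _) _; have yy := y1 s u s01 u01.
  apply: ler_pM.
  + by rewrite mulr_ge0 ?expR_ge0.
  + by rewrite exp_coeff_ge0 ?cnorm1_ge0.
  + by rewrite ler_wpM2l ?ler_expR.
  + by rewrite exp_coeff_le ?cnorm1_ge0.
- move=> N.
  have -> : \sum_(k < N) (c k)%:C * (mxC L ^+ k) i j =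
      (\int[mu]_(u in `[t, n]) (expmx_sum L N (tau u) i j * om u))%:C.
    have i2 k : cintegrable `[t, n] (fun u => ((tau u ^+ k) * om u)%:C).
      by apply: cintegrable_real => //; exact: iom_mul.
    rewrite -cintegral_real; transitivity (cintegral `[t, n] (fun u => \sum_(k < N)
      ((k`!%:R)^-1 * (L ^+ k) i j)%:C * (tau u ^+ k * om u)%:C)); last first.
      apply: eq_cintegral => u _; rewrite /expmx_sum mulr_suml rmorph_sum.
      by apply: eq_bigr => k _; rewrite -rmorphM; congr _%:C; ring.
    rewrite cintegral_sum//; last by move=> k; exact: cintegrableZ.
    apply: eq_bigr => k _; rewrite cintegralZ// cintegral_real map_mxX -!rmorphM.
    by congr _%:C; rewrite /c; ring.
  have iE : mu.-integrable `[t, n] (EFin \o (fun u => expmx (tau u *: L) i j * om u)).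
    by apply: iom_mul; exact: (continuous_comp_within (@expmx_continuous _ _ L i j) ctau).
  have iS : mu.-integrable `[t, n] (EFin \o (fun u => expmx_sum L N (tau u) i j * om u)).
    by apply: iom_mul; exact: (continuous_comp_within (@expmx_sum_continuous _ _ L N i j) ctau).
  have -> : \int[mu]_(u in `[t, n]) (om u * expmx (tau u *: L) i j) =
      \int[mu]_(u in `[t, n]) (expmx (tau u *: L) i j * om u).
    by apply: eq_Rintegral => u _; rewrite mulrC.
  rewrite -rmorphB cnorm1_real -RintegralB//.
  have iB : mu.-integrable `[t, n] (EFin \o (fun u => expmx_sum L N (tau u) i j * om u -
      expmx (tau u *: L) i j * om u)) by exact: (RintegrableB mT).
  have mI : measurable (`[t, n]%classic : set mT) by exact: measurable_itv.
  apply: le_trans (le_normr_Rintegral mI iB) _.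
  rewrite /e /W mulrC -RintegralZl//; last exact: integrable_norm iom.
  apply: le_Rintegral => //; first exact: integrable_norm iB.
    by apply: (RintegrableZ mT) => //; exact: integrable_norm iom.
  move=> u u01; rewrite -mulrBl normrM ler_wpM2r// distrC.
  apply: le_trans (expmx_taylor _ _ _ _ _) _; have yy := y2 u u01.
  apply: (@le_trans _ _ (expR y * exp_coeff y N)).
    by apply: ler_pM; rewrite ?expR_ge0 ?exp_coeff_ge0 ?ler_expR ?exp_coeff_le ?mulr_ge0 ?entry_norm_ge0.
  rewrite ler_wpM2r ?exp_coeff_ge0//; last by rewrite ler_peMl ?expR_ge0// ler1n.
  by apply: le_trans yy; rewrite mulr_ge0 ?entry_norm_ge0.
Qed.

End MxfunExpIntegral.

(** * Time change and discounting *)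

Section TimeChangeFacts.
Context {R : realType}.
Notation mu := (@lebesgue_measure R).
Local Notation mT := (measurableTypeR R).
Variables g ginv : R -> R.
Hypothesis tc : is_time_change g ginv.

Lemma ginv_lt s t : 0 <= s -> s < t -> ginv s < ginv t.
Proof.
move=> s0 st; have t0 := le_trans s0 (ltW st); rewrite ltNge; apply/negP.
rewrite le_eqVlt => /predU1P[e|lt_ts].
  by move: st; rewrite -(tc_ginvK tc s0) -(tc_ginvK tc t0) e ltxx.
have := tc_g_increasing tc (tc_ginv_ge0 tc t0) lt_ts.
by rewrite !(tc_ginvK tc)// => /(lt_trans st); rewrite ltxx.
Qed.

Lemma ginv_le s t : 0 <= s -> s <= t -> ginv s <= ginv t.
Proof. by move=> s0; rewrite le_eqVlt => /predU1P[->//|/(ginv_lt s0)/ltW]. Qed.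

Lemma ginv_le_mono s t : 0 <= s -> 0 <= t -> (ginv s <= ginv t) = (s <= t).
Proof.
move=> s0 t0; apply/idP/idP => [|/ginv_le]; last exact.
by rewrite leNgt; case: (ltP t s) => // ts /negP[]; exact: ginv_lt.
Qed.

(** An increasing function is continuous once it attains all intermediate values, and [g] supplies a
    preimage of each. *)
Lemma ginv_continuous a b : 0 <= a -> a <= b -> {within `[a, b], continuous ginv}.
Proof.
move=> a0 ab; apply: segment_inc_surj_continuous.
  move=> x y; rewrite !in_itv/= => /andP[ax _] /andP[ay _].
  by apply: ginv_le_mono; [exact: le_trans ax|exact: le_trans ay].
move=> y /=; rewrite in_itv/= => /andP[ay yb].
have y0 : 0 <= y := le_trans (tc_ginv_ge0 tc a0) ay.
have b0 := le_trans a0 ab.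
exists (g y); last exact: tc_gK tc _ y0.
have gy0 := tc_g_ge0 tc y0.
rewrite /= in_itv/=; apply/andP; split.
  by rewrite -(ginv_le_mono a0 gy0) (tc_gK tc).
by rewrite -(ginv_le_mono gy0 b0) (tc_gK tc).
Qed.

Let invS (m : nat) : R := (m.+1%:R)^-1.

(** The steps 1/(m + 1) are positive, hence admissible at 0 as well. Sign and measurability of the
    derivative are read off this sequence of quotients. *)
Lemma ginv_quotient_cvg u : 0 <= u ->
  (fun m => Rplus_quotient ginv u (invS m)) @ \oo --> Rplus_derive ginv u.
Proof.
move=> u0; have := tc_derivable tc u0; rewrite /Rplus_derivable => H.
apply: (cvg_comp invS _ _ H) => P /=.
move=> /nbhs_ballP[e /= e0 eP].
have /cvgrPdist_lt/(_ e e0) := @cvg_harmonic R.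
apply: filterS => m; rewrite /= sub0r normrN => me.
apply: eP => /=; rewrite /invS /=.
- by rewrite /ball /= sub0r normrN.
- by rewrite invr_neq0.
- by rewrite addr_ge0 ?invr_ge0.
Qed.

Lemma Rplus_derive_ge0 u : 0 <= u -> 0 <= Rplus_derive ginv u.
Proof.
move=> u0; have := ginv_quotient_cvg u0 => H.
apply: (ler_cvg_to (cvg_cst 0) H); near=> m.
rewrite /Rplus_quotient mulr_ge0 ?invr_ge0//= subr_ge0 ginv_le// lerDl.
by rewrite /invS invr_ge0.
Unshelve. all: by end_near.
Qed.

Lemma measurable_Rplus_derive b : measurable_fun (`[0, b]%classic : set mT) (Rplus_derive ginv).
Proof.
have [b0|b0] := leP 0 b; last by rewrite set_itv_ge ?bnd_simp -?ltNge//; exact: measurable_fun_set0.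
apply: (@measurable_fun_cvg _ mT _ _ (fun m u => Rplus_quotient ginv u (invS m))); last first.
  by move=> u /=; rewrite in_itv/= => /andP[u0 _]; exact: ginv_quotient_cvg.
move=> m; apply: measurable_funM => //; apply: measurable_funB; last first.
  by apply: subspace_continuous_measurable_fun => //; exact: ginv_continuous.
have m0 : 0 <= invS m by rewrite invr_ge0.
(* The shifted argument leaves [0, b], so continuity is taken on an interval longer by the step. *)
apply: (@measurable_comp _ _ _ mT mT mT `[0, b + invS m] ginv _ (fun u => u + invS m)).
- exact: measurable_itv.
- move=> y [x xI <-] /=; move: xI => /=; rewrite !in_itv/= => /andP[x0 xb].
  by rewrite addr_ge0//= lerD2r.
- apply: subspace_continuous_measurable_fun; first exact: measurable_itv.
  by apply: ginv_continuous => //; rewrite addr_ge0.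
- by apply: measurable_funD.
Qed.

(** The derivative is nonnegative, so the finite value of its extended-real integral already gives
    integrability. *)
Lemma Rplus_derive_integrable b : 0 <= b ->
  mu.-integrable `[0, b] (EFin \o Rplus_derive ginv).
Proof.
move=> b0; apply/integrableP; split.
  by apply/measurable_EFinP; exact: measurable_Rplus_derive.
have e := tc_integral tc b0.
have -> : (\int[mu]_(x in `[0%R, b]) `|(EFin \o Rplus_derive ginv) x| =
  \int[mu]_(x in `[0%R, b]) (Rplus_derive ginv x)%:E)%E.
  apply: eq_integral => x; rewrite inE /= in_itv/= => /andP[x0 _].
  by rewrite ger0_norm// Rplus_derive_ge0.
by rewrite e ltry.
Qed.

Lemma Rplus_derive_integral u v : 0 <= u -> u <= v ->
  mu.-integrable `[u, v] (EFin \o Rplus_derive ginv) /\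
  \int[mu]_(x in `[u, v]) Rplus_derive ginv x = ginv v - ginv u.
Proof.
move=> u0 uv; have v0 := le_trans u0 uv.
have iv := Rplus_derive_integrable v0.
have sub : `[u, v]%classic `<=` `[0, v]%classic by apply: subset_itvScc; rewrite bnd_simp.
split; first by apply: (@integrableS _ mT) iv.
have iuv : mu.-integrable `]u, v] (EFin \o Rplus_derive ginv).
  by apply: (@integrableS _ mT) iv => //; apply: subset_itvr; rewrite bnd_simp.
have RE x : 0 <= x -> \int[mu]_(y in `[0, x]) Rplus_derive ginv y = ginv x.
  by move=> x0; rewrite /Rintegral (tc_integral tc x0).
by rewrite -(Rintegral_itv_obnd_cbnd iuv) -(Rintegral_itvB iv)// ?bnd_simp// !RE.
Qed.

End TimeChangeFacts.

Section Discount.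
Context {R : realType}.
Notation mu := (@lebesgue_measure R).
Variables (r : R -> R) (t n : R).
Hypothesis tn : t <= n.
Hypothesis ir : mu.-integrable `[t, n] (EFin \o r).

Lemma discount_continuous : {within `[t, n], continuous (discount r t)}.
Proof.
have := parameterized_integral_continuous tn ir => /subspace_continuousP c.
apply/subspace_continuousP => x /c {}c.
apply: (cvg_comp (fun s => - \int[mu]_(y in `[t, s]) r y) expR); last exact: continuous_expR.
by apply: cvgN.
Qed.

End Discount.

Section Filtrations.
Context d (T : measurableType d) {R : realType} (p : nat).

(** The generators coincide because [ginv] maps [0, t] onto [0, ginv t]. This transfers the Markov
    property of [Z] to the filtration of the time-changed process. *)
Lemma natural_filtration_time_change (g ginv : R -> R) (Z : R -> T -> 'I_p) (t : R) :
  is_time_change g ginv -> 0 <= t ->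
  natural_filtration (fun s w => indicator_process Z (ginv s) w : 'rV[R]_p) t =
  natural_filtration (indicator_process (R := R) Z) (ginv t).
Proof.
move=> tc t0; rewrite /natural_filtration; congr (<<s _ >>).
apply/seteqP; split => A [u [k [B [/andP[u0 ut] mB ->]]]].
  exists (ginv u), k, B; split => //.
  by rewrite (tc_ginv_ge0 tc)// (ginv_le tc).
exists (g u), k, B; split => //; last by rewrite (tc_gK tc).
by rewrite (tc_g_ge0 tc)//= -(ginv_le_mono tc)// ?(tc_g_ge0 tc)// (tc_gK tc).
Qed.

End Filtrations.

(** * Jumps of paths *)

Section StepPaths.
Context {R : realType} (p : nat).
Implicit Types (x : R -> 'I_p) (s t n : R).

(** [jump_path] with explicit radii in place of filters. *)
Definition step_path x :=
  (forall s, 0 <= s -> exists2 e : R, 0 < e & forall u, s <= u < s + e -> x u = x s) /\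
  (forall s, 0 < s -> exists2 e : R, 0 < e &
     exists k, forall u, s - e < u < s -> x u = k).

Lemma jump_path_step x : jump_path x -> step_path x.
Proof.
move=> [xr xl]; split=> s s0.
  have /nbhs_ballP[e /= e0 H] := xr s s0; exists e => // u /andP[].
  rewrite le_eqVlt => /predU1P[->//|su] ue; apply: H => //=.
  by rewrite /ball /= ltr0_norm ?subr_lt0// opprB ltrBlDl.
have [k /nbhs_ballP[e /= e0 H]] := xl s s0; exists e => //; exists k => u /andP[eu us].
apply: H => //=.
by rewrite /ball /= gtr0_norm ?subr_gt0// ltrBlDr -ltrBlDl.
Qed.

Lemma step_path_comp (g ginv : R -> R) x : is_time_change g ginv -> step_path x ->
  step_path (x \o ginv).
Proof.
move=> tc [xr xl].
have cont a b s : 0 <= a -> a <= b -> a <= s <= b -> forall e, 0 < e -> exists2 d : R, 0 < d &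
    forall u, a <= u <= b -> `|s - u| < d -> `|ginv s - ginv u| < e.
  move=> a0 ab sab e e0; have /subspace_continuousP/(_ s sab) := ginv_continuous tc a0 ab.
  move=> /cvgrPdist_lt/(_ e e0)/nbhs_ballP[d /= d0 H]; exists d => // u uab su.
  exact: H.
split=> s s0.
  have [e e0 H] := xr (ginv s) (tc_ginv_ge0 tc s0).
  (* Continuity of [ginv] is available on segments of nonnegative times, so [s, s + 1] serves on the
     right and [0, s] on the left. *)
  have s1 : s <= s + 1 by rewrite lerDl ler01.
  have ss1 : s <= s <= s + 1 by rewrite lexx.
  have [d d0 Hd] := cont s (s + 1) s s0 s1 ss1 e e0.
  exists (Num.min d 1); first by rewrite lt_min d0 ltr01.
  move=> u /andP[su]; rewrite -ltrBlDl lt_min => /andP[ud u1] /=; apply: H.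
  rewrite (ginv_le tc)//= -ltrBlDl.
  have := Hd u _ _; rewrite su/= -lerBlDl (ltW u1) ler0_norm ?subr_le0// opprB => /(_ isT ud).
  by rewrite ler0_norm ?subr_le0 ?(ginv_le tc)// opprB.
have gs0 : 0 < ginv s.
  by rewrite (le_lt_trans (tc_ginv_ge0 tc (lexx 0)))// (ginv_lt tc).
have [e e0 [k H]] := xl (ginv s) gs0.
have ss1 : 0 <= s <= s by rewrite (ltW s0) lexx.
have [d d0 Hd] := cont 0 s s (lexx 0) (ltW s0) ss1 e e0.
exists (Num.min d s); first by rewrite lt_min d0.
exists k => u /andP[]; rewrite ltrBlDl -ltrBlDr lt_min => /andP[ud us0] us /=; apply: H.
have u0 : 0 <= u by move: us0; rewrite ltrBlDl ltrDr => /ltW.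
rewrite (ginv_lt tc)// andbT ltrBlDl -ltrBlDr.
have := Hd u _ _; rewrite u0 (ltW us)/= gtr0_norm ?subr_gt0// => /(_ isT ud).
by rewrite gtr0_norm ?subr_gt0 ?(ginv_lt tc).
Qed.

(** The left limit x(s-). The default [x s] means that no jump is recorded where there is no left
    limit. *)
Definition left_state x s : 'I_p :=
  if pselect (exists k, exists2 e : R, 0 < e & forall u, s - e < u < s -> x u = k) is left h
  then sval (cid h) else x s.

Lemma left_stateP x s : step_path x -> 0 < s ->
  exists2 e : R, 0 < e & forall u, s - e < u < s -> x u = left_state x s.
Proof.
move=> [_ xl] s0; rewrite /left_state; case: pselect => [h|nh]; first by case: cid.
by exfalso; apply: nh; have [e e0 [k H]] := xl s s0; exists k, e.
Qed.

Lemma left_stateE x s k (e : R) : step_path x -> 0 < s -> 0 < e ->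
  (forall u, s - e < u < s -> x u = k) -> left_state x s = k.
Proof.
move=> xs s0 e0 H; have [e' e'0 H'] := left_stateP xs s0.
pose m := Num.min e e' / 2; have m0 : 0 < m by rewrite divr_gt0// lt_min e0.
have [me me'] : m < e /\ m < e'.
  have : m < Num.min e e' by rewrite ltr_pdivrMr// mulrDr mulr1 ltrDl lt_min e0.
  by rewrite lt_min => /andP[].
rewrite -(H' (s - m)) ?(H (s - m))//.
  by rewrite ltrD2l ltrN2 me gtrDl oppr_lt0.
by rewrite ltrD2l ltrN2 me' gtrDl oppr_lt0.
Qed.

Definition jumps x t n : set R := [set s | t < s <= n /\ left_state x s != x s].

(** Bolzano-Weierstrass: infinitely many jumps would accumulate at some l, but the path is constant
    just before and just after l, so no other time near l is a jump. *)
Lemma jumps_finite x t n : step_path x -> 0 <= t -> finite_set (jumps x t n).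
Proof.
move=> xs t0; apply: contrapT => inf.
have bnd : bounded_set (jumps x t n).
  exists (Num.max `|t| `|n|); split; first exact: num_real.
  move=> M HM s [/andP[ts sn] _]; apply: le_trans (ltW HM).
  rewrite ger0_norm; last exact: (le_trans t0 (ltW ts)).
  by rewrite le_max (le_trans sn (ler_norm n)) orbT.
have [l Hl] := infinite_bounded_limit_point_nonempty inf bnd.
have near_l (e : R) : 0 < e -> exists2 s, jumps x t n s & s != l /\ `|l - s| < e.
  move=> e0; have [|s [sl Js ls]] := Hl (ball l e); first exact: nbhsx_ballx.
  by exists s.
have tl : t <= l.
  rewrite leNgt; apply/negP => lt; have [|s [/andP[ts _] _] [_ ls]] := near_l (t - l).
    by rewrite subr_gt0.
  by move: ls; rewrite distrC gtr0_norm ?subr_gt0 ?(lt_trans lt)// ltrD2r ltNge (ltW ts).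
have l0 : 0 <= l := le_trans t0 tl.
have [e1 e10 H1] := xs.1 l l0.
(* At l = 0 there is no left limit to use; jumps are positive times, so the right side suffices. *)
have [l_eq0|l_gt0] := eqVneq l 0; last first.
  have lp : 0 < l by rewrite lt_neqAle eq_sym l_gt0.
  have [e2 e20 H2] := left_stateP xs lp.
  have [|s [/andP[ts sn] /eqP Js] [sl ls]] := near_l (Num.min e1 e2).
    by rewrite lt_min e10.
  move: ls; rewrite lt_min => /andP[ls1 ls2].
  have s0 : 0 < s := le_lt_trans t0 ts.
  case: (ltgtP s l) sl => // sl _; apply: Js.
    have ls2' : l - e2 < s by move: ls2; rewrite gtr0_norm ?subr_gt0// ltrBlDl -ltrBlDr.
    have d0 : 0 < s - (l - e2) by rewrite subr_gt0.
    rewrite (H2 s) ?ls2'//; apply: (left_stateE xs s0 d0) => u.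
    by rewrite opprB addrC subrK => /andP[u1 u2]; apply: H2; rewrite u1 (lt_trans u2).
  have ls1' : s < l + e1 by move: ls1; rewrite ltr0_norm ?subr_lt0// opprB ltrBlDl.
  have d0 : 0 < s - l by rewrite subr_gt0.
  rewrite (H1 s) ?ls1' ?(ltW sl)//; apply: (left_stateE xs s0 d0) => u.
  rewrite opprB addrC subrK => /andP[u1 u2]; apply: H1.
  by rewrite (ltW u1) (lt_trans u2).
have [s [/andP[ts sn] /eqP Js] [_ ls]] := near_l e1 e10.
have s0 : 0 < s := le_lt_trans t0 ts.
move: ls; rewrite l_eq0 sub0r normrN gtr0_norm// => se; apply: Js.
rewrite l_eq0 add0r in H1.
rewrite (H1 s) ?(ltW s0)//; apply: (left_stateE xs s0 s0) => u.
by rewrite subrr => /andP[u1 u2]; apply: H1; rewrite (ltW u1) (lt_trans u2).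
Qed.

(** Without jumps the indicator of the initial state is continuous along the path. It takes only the
    values 0 and 1, so by the intermediate value theorem it cannot drop. *)
Lemma no_jump_constant x a b : step_path x -> 0 <= a -> a <= b ->
  (forall s, ~ jumps x a b s) -> x b = x a.
Proof.
move=> xs a0 ab nj; apply: contrapT => /eqP xba.
pose f (u : R) : R := (x u == x a)%:R.
have ab' : a < b by rewrite lt_neqAle ab andbT; apply: contra xba => /eqP ->.
have fr s : a <= s -> f @ s^'+ --> f s.
  move=> sa; have [e e0 H] := xs.1 s (le_trans a0 sa).
  apply: cvg_near_cst; apply/nbhs_ballP; exists e => //= u su us.
  rewrite /f (H u)// (ltW us)/=.
  by move: su; rewrite /ball /= ltr0_norm ?subr_lt0// opprB ltrBlDl.
have fl s : a < s -> s <= b -> f @ s^'- --> f s.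
  move=> sa sb; have s0 : 0 < s := le_lt_trans a0 sa.
  have [e e0 H] := left_stateP xs s0.
  apply: cvg_near_cst; apply/nbhs_ballP; exists e => //= u su us.
  have -> : f u = (left_state x s == x a)%:R.
    rewrite /f (H u)// us andbT ltrBlDl -ltrBlDr.
    by move: su; rewrite /ball /= gtr0_norm ?subr_gt0.
  rewrite /f (_ : left_state x s = x s)//; apply: contrapT => /eqP js.
  by apply: (nj s); split => //; rewrite sa.
have cf : {within `[a, b], continuous f}.
  apply/(continuous_within_itvP _ ab'); split; [|exact: fr|exact: fl].
  move=> s; rewrite in_itv/= => /andP[sa sb]; apply/left_right_continuousP.
  by split; [apply: fl => //; exact: ltW|apply: fr; exact: ltW].
have [|u _] := IVT (v := 1 / 2) ab cf.
  rewrite /f eqxx (negbTE xba)/= ge_min le_max; apply/andP; split; apply/orP; [right|left]; lra.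
by rewrite /f; case: (_ == _) => /= /eqP; [rewrite eq_sym|]; apply/negP; rewrite -subr_eq0; apply/eqP; lra.
Qed.

End StepPaths.

(** * Sums over the cells of a grid *)

Section GridSums.
Context {R : realType}.
Variables (t n : R).
Hypothesis tn : t < n.

Definition grid (m k : nat) : R := t + k%:R * ((n - t) / m.+1%:R).
(** Cells are half-open like ]t, n] itself, so each time belongs to exactly one cell and a jump at n
    is counted. *)
Definition in_cell (s : R) m k := (grid m k < s <= grid m k.+1).
Definition grid_sum (F : R -> R -> R) m := \sum_(k < m.+1) F (grid m k) (grid m k.+1).

Let h_gt0 m : 0 < (n - t) / m.+1%:R. Proof. by rewrite divr_gt0// subr_gt0. Qed.

Lemma grid0 m : grid m 0 = t. Proof. by rewrite /grid mul0r addr0. Qed.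

Lemma gridn m : grid m m.+1 = n.
Proof. by rewrite /grid mulrC divfK ?pnatr_eq0// addrC subrK. Qed.

Lemma grid_step m k : grid m k.+1 - grid m k = (n - t) / m.+1%:R.
Proof. by rewrite /grid -natr1; ring. Qed.

Lemma grid_le m j k : (j <= k)%N -> grid m j <= grid m k.
Proof. by move=> jk; rewrite lerD2l ler_wpM2r ?(ltW (h_gt0 m))// ler_nat. Qed.

Lemma grid_ge m k : t <= grid m k. Proof. by rewrite -[leLHS](grid0 m) grid_le. Qed.

Lemma grid_len m k : (k <= m.+1)%N -> grid m k <= n.
Proof. by move=> km; rewrite -[leRHS](gridn m); exact: grid_le. Qed.

Lemma in_cell_exists s m : t < s <= n -> exists2 k, (k < m.+1)%N & in_cell s m k.
Proof.
move=> /andP[ts sn].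
have ex : exists k, s <= grid m k by exists m.+1; rewrite gridn.
have [k sk mink] := ex_minnP ex.
have km : (k <= m.+1)%N by apply: mink; rewrite gridn.
case: k sk mink km => [|k] sk mink km; first by move: sk; rewrite grid0 leNgt ts.
exists k => //; rewrite /in_cell sk andbT ltNge; apply/negP => /mink.
by rewrite ltnn.
Qed.

Lemma in_cell_uniq s m j k : in_cell s m j -> in_cell s m k -> j = k.
Proof.
move=> /andP[j1 j2] /andP[k1 k2]; case: (ltngtP j k) => // jk.
  by have := le_lt_trans (le_trans j2 (grid_le m jk)) k1; rewrite ltxx.
by have := le_lt_trans (le_trans k2 (grid_le m jk)) j1; rewrite ltxx.
Qed.

Lemma sum_in_cell s m k (F : nat -> R) : (k < m.+1)%N -> in_cell s m k ->
  \sum_(j < m.+1) (in_cell s m j)%:R * F j = F k.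
Proof.
move=> km sk; rewrite (bigD1 (Ordinal km))//= sk mul1r big1 ?addr0// => j jk.
rewrite (_ : in_cell s m j = false) ?mul0r//; apply/negP => sj.
by move/eqP: jk; apply; apply/val_inj => /=; exact: in_cell_uniq sj sk.
Qed.

(** Every cell with a nonzero term contains a point of [J]; charge the term to that point, each
    point lying in a single cell. *)
Lemma grid_sum_le (F : R -> R -> R) (J : seq R) (C : R) m : 0 <= C ->
  (forall s, s \in J -> t < s <= n) ->
  (forall a b, t <= a -> a <= b -> b <= n -> (forall s, s \in J -> ~~ (a < s <= b)) -> F a b = 0) ->
  (forall a b, t <= a -> a <= b -> b <= n -> `|F a b| <= C) ->
  `|grid_sum F m| <= C * (size J)%:R.
Proof.
move=> C0 HJ F0 FC; apply: le_trans (ler_norm_sum _ _ _) _.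
apply: (@le_trans _ _ (\sum_(k < m.+1) \sum_(s <- J) (in_cell s m k)%:R * C)).
  apply: ler_sum => k _; have [/hasP[s sJ sk]|/hasPn nk] := boolP (has (fun s => in_cell s m k) J).
    apply: (@le_trans _ _ C); first by apply: FC; rewrite ?grid_ge ?grid_le ?grid_len.
    rewrite (big_rem s)//= sk mul1r lerDl; apply: sumr_ge0 => u _; exact: mulr_ge0.
  rewrite F0 ?normr0 ?grid_ge ?grid_le ?grid_len//.
  by apply: sumr_ge0 => u _; exact: mulr_ge0.
rewrite exchange_big /=; apply: (@le_trans _ _ (\sum_(s <- J) C)).
  rewrite big_seq [leRHS]big_seq; apply: ler_sum => s sJ.
  have [k km sk] := in_cell_exists m (HJ s sJ).
  by rewrite (@sum_in_cell s m k (fun=> C)).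
by rewrite big_const_seq count_predT iter_addr_0 mulr_natr.
Qed.

Lemma common_radius (J : seq R) (Q : R -> R -> Prop) :
  (forall s d d', d' <= d -> Q s d -> Q s d') ->
  (forall s, s \in J -> exists2 d : R, 0 < d & Q s d) ->
  exists2 d : R, 0 < d & forall s, s \in J -> Q s d.
Proof.
move=> Qle; elim: J => [|s J IH] H; first by exists 1.
have [d1 d10 Q1] := H s (mem_head _ _).
have [|d2 d20 Q2] := IH; first by move=> u uJ; apply: H; rewrite inE uJ orbT.
exists (Num.min d1 d2); first by rewrite lt_min d10.
move=> u; rewrite inE => /predU1P[->|/Q2].
  by apply: Qle Q1; rewrite ge_min lexx.
by apply: Qle; rewrite ge_min lexx orbT.
Qed.

Lemma near_grid_step (d : R) : 0 < d -> \forall m \near \oo, (n - t) / m.+1%:R < d.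
Proof.
move=> d0; have : (fun m => (n - t) * harmonic m) @ \oo --> 0.
  by rewrite -[X in _ --> X](mulr0 (n - t)); apply: cvgMr; exact: cvg_harmonic.
move=> /cvgrPdist_lt/(_ d d0); apply: filterS => m; rewrite sub0r normrN.
by rewrite gtr0_norm// /harmonic /= h_gt0.
Qed.

(** Once the mesh is below the smallest gap in [J], each cell contains at most one point, and the
    sum over cells becomes a sum over [J]. *)
Lemma grid_sum_cvg (F : R -> R -> R) (G : R -> R) (J : seq R) : uniq J ->
  (forall s, s \in J -> t < s <= n) ->
  (forall a b, t <= a -> a <= b -> b <= n -> (forall s, s \in J -> ~~ (a < s <= b)) -> F a b = 0) ->
  (forall s, s \in J -> forall eps, 0 < eps -> exists2 d : R, 0 < d &
    forall a b, t <= a -> a < s <= b -> b <= n -> b - a < d -> `|G s - F a b| <= eps) ->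
  grid_sum F @ \oo --> \sum_(s <- J) G s.
Proof.
move=> uJ HJ F0 FG; apply/cvgrPdist_le => eps eps0.
(* The error is shared among the points of [J]; the successor covers an empty [J]. *)
pose e := eps / (size J).+1%:R; have e0 : 0 < e by rewrite divr_gt0.
have [d1 d10 H1] : exists2 d : R, 0 < d & forall s, s \in J ->
    forall a b, t <= a -> a < s <= b -> b <= n -> b - a < d -> `|G s - F a b| <= e.
  apply: common_radius => [s d d' dd H a b ta asb bn bad|s sJ]; last exact: FG.
  by apply: H => //; exact: lt_le_trans dd.
have [d2 d20 H2] : exists2 d : R, 0 < d & forall s, s \in J ->
    forall u, u \in J -> u != s -> d <= `|u - s|.
  apply: common_radius => [s d d' dd H u uJ' us|s sJ]; first by apply: le_trans dd _; exact: H.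
  apply: (common_radius (Q := fun u d => u != s -> d <= `|u - s|)) => [u d d' dd H us|u uJ'].
    by apply: le_trans dd _; exact: H.
  have [->|us] := eqVneq u s; first by exists 1.
  by exists `|u - s| => //; rewrite normr_gt0 subr_eq0.
near=> m.
have s1 : (n - t) / m.+1%:R < d1 by near: m; exact: near_grid_step.
have s2 : (n - t) / m.+1%:R < d2 by near: m; exact: near_grid_step.
have -> : grid_sum F m = \sum_(s <- J) \sum_(k < m.+1) (in_cell s m k)%:R * F (grid m k) (grid m k.+1).
  rewrite exchange_big /=; apply: eq_bigr => k _.
  have [/hasP[s sJ sk]|/hasPn nk] := boolP (has (fun s => in_cell s m k) J); last first.
    rewrite F0 ?grid_ge ?grid_le ?grid_len//.
    by rewrite big1// => u _; rewrite mulr0.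
  rewrite (big_rem s)//= sk mul1r big_seq big1 ?addr0// => u us.
  have uJ' := mem_rem us.
  have us' : u != s by apply: contraTneq us => ->; rewrite mem_rem_uniqF.
  rewrite (_ : in_cell u m k = false) ?mul0r//; apply/negP => uk.
  have := H2 s sJ u uJ' us'; rewrite leNgt => /negP; apply.
  apply: lt_trans s2; rewrite -(grid_step m k).
  move: sk uk => /andP[k1 k2] /andP[k3 k4].
  by rewrite ltr_norml; apply/andP; split; lra.
rewrite -sumrB; apply: le_trans (ler_norm_sum _ _ _) _.
apply: (@le_trans _ _ (\sum_(s <- J) e)); last first.
  rewrite big_const_seq count_predT iter_addr_0 -[e *+ _]mulr_natr /e mulrAC.
  by rewrite ler_pdivrMr// ler_wpM2l ?(ltW eps0)// ler_nat.
rewrite big_seq [leRHS]big_seq; apply: ler_sum => s sJ.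
have [k km sk] := in_cell_exists m (HJ s sJ).
rewrite (@sum_in_cell s m k (fun k => F (grid m k) (grid m k.+1)))//.
by apply: H1 => //; rewrite ?grid_ge ?grid_len ?grid_step.
Unshelve. all: by end_near.
Qed.

End GridSums.

(** * Stieltjes integrals against step functions *)

Section StieltjesStep.
Context {R : realType}.
Variables (G : cumulative R R) (t n : R) (J : seq R) (h : R -> R).
Local Notation mT := (measurableTypeR R).
Local Notation mu := (lebesgue_stieltjes_measure G).
Hypotheses (uJ : uniq J) (HJ : forall s, s \in J -> t < s <= n).
Hypothesis GJ : forall a b, t <= a -> a <= b -> b <= n ->
  G b - G a = \sum_(s <- J) (a < s <= b)%R%:R.
Hypothesis tn : t <= n.

Lemma stieltjes_itvoc a b : a <= b -> mu `]a, b]%classic = (G b - G a)%:E.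
Proof.
move=> ab; rewrite /lebesgue_stieltjes_measure /measure_extension measurable_mu_extE/=.
  by rewrite wlength_itv_bnd.
exact: is_ocitv.
Qed.

(** The point s is the intersection of the intervals ]s - 1/(k + 1), s], which eventually contain no
    other point of [J] and then have measure 1. *)
Lemma stieltjes_set1 s : s \in J -> mu [set s] = 1%E.
Proof.
move=> sJ; have /andP[ts sn] := HJ sJ.
have [d d0 Hd] : exists2 d : R, 0 < d & forall u, u \in J -> ~~ (s - d < u < s).
  apply: (common_radius (Q := fun u d => ~~ (s - d < u < s))) => [u d d' dd|u uJ'].
    apply: contra => /andP[u1 ->]; rewrite andbT; apply: le_lt_trans u1.
    by rewrite lerD2l lerN2.
  have [us|us] := ltP u s; last by exists 1; [exact: ltr01|rewrite andbF].
  by exists (s - u); [rewrite subr_gt0|rewrite opprB addrC subrK ltxx].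
have m0 : 0 < Num.min d (s - t) by rewrite lt_min d0 subr_gt0.
have F1 : \forall k \near \oo, mu `]s - k.+1%:R^-1, s]%classic = 1%E.
  have /cvgrPdist_lt/(_ _ m0) := @cvg_harmonic R; apply: filterS => k.
  rewrite sub0r normrN ger0_norm ?invr_ge0// /harmonic /= => km.
  have k0 : 0 < k.+1%:R^-1 :> R by rewrite invr_gt0.
  move: km; rewrite lt_min => /andP[kd kt].
  rewrite stieltjes_itvoc; last by rewrite gerBl ltW.
  rewrite GJ//; last 2 first.
  - by rewrite lerBrDr -lerBrDl ltW.
  - by rewrite gerBl ltW.
  congr EFin; rewrite (bigD1_seq s)//= lexx andbT ltrBlDr ltrDl k0 big_seq_cond big1 ?addr0//.
  move=> u /andP[uJ' us]; have := Hd u uJ'.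
  move: us; rewrite neq_lt => /orP[us|us]; last by rewrite [u <= s]leNgt us andbF.
  rewrite us andbT -leNgt => le_u; rewrite [_ < u]ltNge (le_trans le_u)//.
  by rewrite lerD2l lerN2 ltW.
have cm : (mu \o (fun k => `]s - k.+1%:R^-1, s]%classic)) @ \oo --> mu (\bigcap_k `]s - k.+1%:R^-1, s]%classic).
  apply: nonincreasing_cvg_mu.
  - by rewrite /= stieltjes_itvoc ?ltry// gerBl invr_ge0.
  - by move=> k; exact: measurable_itv.
  - by apply: bigcapT_measurable => k; exact: measurable_itv.
  - move=> k l kl; apply/subsetPset; apply: subset_itvr; rewrite bnd_simp lerD2l lerN2.
    by rewrite lef_pV2 ?posrE// ler_nat.
rewrite set1_bigcap_oc; apply: (cvg_unique _ cm) => //.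
by apply: cvg_near_cst.
Qed.

Hypotheses (mh : measurable_fun (`]t, n]%classic : set mT) h)
  (h0 : forall s, `]t, n]%classic s -> 0 <= h s).

(** The points of [J], of mass 1 each, exhaust the mass of ]t, n], so the rest of the interval is
    null. *)
Lemma stieltjes_step : \int[mu]_(s in `]t, n]) h s = \sum_(s <- J) h s.
Proof.
pose E : set mT := \big[setU/set0]_(s <- J) [set s].
have ms (s : mT) : measurable [set s] by exact: measurable_set1.
have mE : measurable E by apply: bigsetU_measurable => s _; exact: ms.
have EI : E `<=` `]t, n]%classic.
  by move=> s; rewrite /E -bigcup_seq => -[u /= uJ' ->]; rewrite /= in_itv/=; exact: HJ.
have mI : measurable (`]t, n]%classic : set mT) by exact: measurable_itv.
have trE : trivIset [set` J] (fun s : mT => [set s]).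
  by move=> a b _ _ [x [-> ->]].
have intE (f : R -> R) : measurable_fun E f -> (forall s, E s -> 0 <= f s) ->
   (\int[mu]_(s in E) (f s)%:E = (\sum_(s <- J) f s)%:E)%E.
  move=> mf f0; rewrite ge0_integral_bigsetU//=; last exact/measurable_EFinP.
  rewrite -sumEFin big_seq [RHS]big_seq; apply: eq_bigr => s sJ.
  rewrite (eq_integral (cst (f s)%:E)); last by move=> u; rewrite inE => ->.
  by rewrite integral_cst//= stieltjes_set1// mule1.
have muE : mu E = (size J)%:R%:E.
  have <- : (\int[mu]_(s in E) cst 1%:E s = mu E)%E by rewrite integral_cst// mul1e.
  rewrite [LHS](intE (cst 1)) => [|//|_ _ /=]; last exact: ler01.
  by rewrite big_const_seq count_predT iter_addr_0.
have muI : mu `]t, n]%classic = (size J)%:R%:E.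
  rewrite stieltjes_itvoc// GJ// big_seq (eq_bigr (fun=> 1)) => [|s /HJ ->//].
  by rewrite -big_seq big_const_seq count_predT iter_addr_0.
have mIE := measurableD mI mE.
have muIE : mu (`]t, n]%classic `\` E) = 0%E.
  have fI : (mu `]t, n]%classic < +oo)%E by rewrite muI ltry.
  rewrite [LHS](measureD mI mE fI) [X in (_ - X)%E](_ : _ = (size J)%:R%:E); last first.
    by rewrite -muE setIidr.
  by rewrite [X in (X - _)%E](_ : _ = (size J)%:R%:E) ?subee.
rewrite /Rintegral -(setDUK EI) ge0_integral_setU//=.
- rewrite intE//; last first.
  + by move=> s /EI; exact: h0.
  + by apply: measurable_funS mh.
  rewrite null_set_integral ?adde0//.
  by apply/measurable_EFinP; apply: measurable_funS mh => //; exact: subDsetl.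
- by rewrite setDUK//; exact/measurable_EFinP.
- by move=> s [/EI sI|[sI _]]; rewrite lee_fin; exact: h0.
- by rewrite disj_set2E; apply/eqP; rewrite setDE setICA setICr setI0.
Qed.

End StieltjesStep.

(** * Payments along a path *)

Section PathPayments.
Context {R : realType} (p : nat).
Notation mu := (@lebesgue_measure R).
Local Notation mT := (measurableTypeR R).
Implicit Types (x : R -> 'I_p).

Definition jump_seq x (t n : R) : seq R := fset_set (jumps x t n).

Lemma jump_seq_uniq x t n : uniq (jump_seq x t n).
Proof. exact: fset_uniq. Qed.

Lemma jump_seqP x t n s : step_path x -> 0 <= t ->
  (s \in jump_seq x t n) = (t < s <= n) && (left_state x s != x s).
Proof.
move=> xs t0; rewrite /jump_seq in_fset_set; last exact: jumps_finite.
by apply/idP/andP => [/set_mem[]//|[? ?]]; apply/mem_set.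
Qed.

Section GridLimit.
Variables (x : R -> 'I_p) (t n : R) (D : R -> R) (phi : 'I_p -> 'I_p -> R).
Hypotheses (xs : step_path x) (t0 : 0 <= t) (tn : t < n).
Hypothesis phi0 : forall i, phi i i = 0.

(** [D] is sampled at the left end of the cell, where the Markov property is later applied. *)
Let F (a b : R) := D a * phi (x a) (x b).

Let F0 a b : t <= a -> a <= b -> b <= n ->
  (forall s, s \in jump_seq x t n -> ~~ (a < s <= b)) -> F a b = 0.
Proof.
move=> ta ab bn nj; rewrite /F (@no_jump_constant _ _ x a b) ?phi0 ?mulr0//.
  exact: le_trans ta.
move=> s [/andP[as_ sb] ls]; have := nj s; rewrite jump_seqP// as_ sb ls andbT.
by rewrite (le_lt_trans ta)// (le_trans sb)// => /(_ isT).
Qed.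

Let inJ s : s \in jump_seq x t n -> t < s <= n.
Proof. by rewrite jump_seqP// => /andP[]. Qed.

Lemma path_grid_sum_le C m : 0 <= C ->
  (forall a i j, t <= a -> a <= n -> `|D a * phi i j| <= C) ->
  `|grid_sum t n F m| <= C * (size (jump_seq x t n))%:R.
Proof.
move=> C0 DC; apply: grid_sum_le => // a b ta ab bn.
by apply: DC => //; exact: le_trans bn.
Qed.

(** In a short cell around a jump s the end states are already x(s-) and x(s), so the only error is
    that of [D]. *)
Lemma path_grid_sum_cvg : {within `[t, n], continuous D} ->
  grid_sum t n F @ \oo --> \sum_(s <- jump_seq x t n) D s * phi (left_state x s) (x s).
Proof.
move=> cD; apply: grid_sum_cvg => //; first exact: jump_seq_uniq.
move=> s /inJ/andP[ts sn] eps eps0.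
have s0 : 0 < s := le_lt_trans t0 ts.
pose c := phi (left_state x s) (x s).
have sI : `[t, n]%classic s by rewrite /= in_itv/= (ltW ts).
have e1 : 0 < eps / (`|c| + 1) by rewrite divr_gt0// ltr_wpDl.
have /subspace_continuousP/(_ s sI)/cvgrPdist_lt/(_ _ e1) := cD.
move=> /nbhs_ballP[d1 /= d10 H1].
have [d2 d20 H2] := left_stateP xs s0.
have [d3 d30 H3] := xs.1 s (ltW s0).
exists (Num.min d1 (Num.min d2 d3)); first by rewrite !lt_min d10 d20.
move=> a b ta /andP[as_ sb] bn; rewrite !lt_min => /and3P[b1 b2 b3].
have an : a <= n := le_trans (ltW as_) sn.
rewrite /F (H2 a); last by apply/andP; split => //; lra.
rewrite (H3 b); last by apply/andP; split => //; lra.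
rewrite -/c -mulrBl normrM.
have : `|D s - D a| < eps / (`|c| + 1).
  apply: H1; rewrite /= ?in_itv/= ?ta//.
  by rewrite /ball /= gtr0_norm ?subr_gt0//; lra.
move=> /ltW H; apply: (@le_trans _ _ (eps / (`|c| + 1) * `|c|)); first exact: ler_wpM2r.
rewrite mulrAC ler_pdivrMr ?ltr_wpDl// ler_wpM2l ?(ltW eps0)//.
by rewrite lerDl.
Qed.

End GridLimit.

Section JumpCount.
Variables (x : R -> 'I_p) (i j : 'I_p).
Hypotheses (xs : step_path x) (ij : j != i).

Let X (s : R) : 'rV[R]_p := delta_mx 0 (x s).

Lemma delta_row_inj (k l : 'I_p) : (delta_mx 0 k : 'rV[R]_p) = delta_mx 0 l -> k = l.
Proof.
move=> /matrixP/(_ 0 k); rewrite !mxE !eqxx /=; case: eqP => // _ /eqP.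
by rewrite oner_eq0.
Qed.

(** The i-th coordinate tends on the left both to 1, by the convergence of the unit vectors, and to
    the indicator that the left state is i. *)
Lemma jump_timesE s : jump_times X i j s <-> [/\ 0 < s, left_state x s = i & x s = j].
Proof.
split => [[s0 [lim /delta_row_inj xj]]|[s0 li xj]]; last first.
  split => //; split; last by rewrite /X xj.
  have [e e0 H] := left_stateP xs s0.
  apply: cvg_near_cst; apply/nbhs_ballP; exists e => //= u su us.
  rewrite /X (H u) ?li// us andbT ltrBlDl -ltrBlDr.
  by move: su; rewrite /ball /= gtr0_norm ?subr_gt0.
split => //; have [e e0 H] := left_stateP xs s0.
have c1 : (fun u => X u 0 i) @ s^'- --> (1 : R).
  have := cvg_comp X (fun M : 'rV[R]_p => M 0 i) lim (@coord_continuous R 1 p 0 i (delta_mx 0 i)).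
  by rewrite mxE !eqxx.
have c2 : (fun u => X u 0 i) @ s^'- --> ((i == left_state x s)%:R : R).
  apply: cvg_near_cst; apply/nbhs_ballP; exists e => //= u su us.
  rewrite /X (H u) ?mxE//= us andbT ltrBlDl -ltrBlDr.
  by move: su; rewrite /ball /= gtr0_norm ?subr_gt0.
have e1 : 1 = (i == left_state x s)%:R :> R.
  by apply: cvg_unique c1 c2; exact: Rhausdorff.
have [->//|ne] := eqVneq i (left_state x s).
by move/eqP: e1; rewrite (negbTE ne) oner_eq0.
Qed.

Let P s := (left_state x s == i) && (x s == j).

(** [n] is an auxiliary horizon: the count is a function on the whole line, 0 at negative times,
    while a finite list of jumps needs a bounded window. *)
Lemma jump_countE n u : u <= n ->
  jump_count X i j u = \sum_(s <- jump_seq x 0 n) ((s <= u)%R && P s)%:R.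
Proof.
move=> un; rewrite /jump_count.
have -> : jump_times X i j `&` `]0, u] = [set` [seq s <- jump_seq x 0 n | (s <= u)%R && P s]].
  apply/seteqP; split => s /=.
    rewrite in_itv/= => -[/jump_timesE[s0 li xj] /andP[_ su]].
    by rewrite mem_filter su /P li xj !eqxx jump_seqP//= s0 (le_trans su un) li xj eq_sym ij.
  rewrite mem_filter /P => /andP[/and3P[su /eqP li /eqP xj]].
  rewrite jump_seqP// => /andP[/andP[s0 _] _]; rewrite in_itv/= s0 su; split => //.
  by apply/jump_timesE.
rewrite /counting asboolT /=; last exact: finite_seq.
transitivity ((\sum_(s <- jump_seq x 0 n) nat_of_bool ((s <= u)%R && P s))%N%:R : R);
  last by rewrite natr_sum.
congr _%:R.
rewrite [in LHS](_ : fset_set _ = [fset s in [seq s <- jump_seq x 0 n | (s <= u)%R && P s]]%fset).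
  rewrite card_fseq undup_id ?filter_uniq ?jump_seq_uniq// size_filter -sum1_count.
  by rewrite big_mkcond; apply: eq_bigr => s _; case: (_ && _).
apply/fsetP => s; rewrite in_fset_set; last exact: finite_seq.
rewrite !inE /=.
by apply/idP/idP => [/set_mem//|?]; apply/mem_set.
Qed.

Lemma jump_countB n a b : a <= b -> b <= n ->
  jump_count X i j b - jump_count X i j a =
  \sum_(s <- jump_seq x 0 n) ((a < s <= b)%R && P s)%:R.
Proof.
move=> ab bn; rewrite (jump_countE bn) (jump_countE (le_trans ab bn)) -sumrB.
apply: eq_bigr => s _; case: (P s); rewrite ?andbT ?andbF ?subrr//.
case: (ltP a s) => [as_|sa]; first by rewrite subr0.
by rewrite (le_trans sa ab) subrr.
Qed.

(** This rules out the default value 0 of [stieltjes_integral]. Right continuity at u holds because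
    the finitely many jumps up to u + 1 leave a gap after u. *)
Lemma jump_count_cumulative : exists G : cumulative R R, (G : R -> R) = jump_count X i j.
Proof.
pose N := jump_count X i j.
have ndN : nondecreasing N.
  move=> a b ab; rewrite -subr_ge0 (jump_countB ab (lexx b)).
  by apply: sumr_ge0.
have rcN : right_continuous N.
  move=> u; have [d d0 Hd] : exists2 d : R, 0 < d &
      forall s, s \in jump_seq x 0 (u + 1) -> ~~ (u < s < u + d).
    apply: common_radius => [s d d' dd|s _].
      by apply: contra => /andP[-> /lt_le_trans]; apply; rewrite lerD2l.
    have [us|us] := ltP u s; last by exists 1; [exact: ltr01|].
    by exists (s - u); [rewrite subr_gt0|rewrite addrC subrK ltxx].
  apply: cvg_near_cst; apply/nbhs_ballP; exists (Num.min d 1) => /=.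
    by rewrite lt_min d0 ltr01.
  move=> v; rewrite /ball /= => uv lt_uv; move: uv.
  rewrite ltr0_norm ?subr_lt0// opprB lt_min => /andP[vd v1].
  apply/eqP; rewrite -subr_eq0 (@jump_countB (u + 1)) ?(ltW lt_uv)//; last by lra.
  apply/eqP; rewrite big_seq big1// => s sJ; case: (boolP (_ && _)) => //= /andP[/andP[us sv] _].
  have := Hd s sJ; rewrite us /= -leNgt => ds.
  by exfalso; move: vd; rewrite ltNge => /negP; apply; lra.
pose cN := isCumulative.Build R _ R N ndN rcN.
pose G : cumulative R R := HB.pack N cN.
by exists G.
Qed.

Lemma stieltjes_integral_jump_count t n (h : R -> R) : 0 <= t -> t <= n ->
  measurable_fun (`]t, n]%classic : set mT) h ->
  (forall s, `]t, n]%classic s -> 0 <= h s) ->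
  stieltjes_integral (jump_count X i j) `]t, n] h =
  \sum_(s <- jump_seq x t n) (P s)%:R * h s.
Proof.
move=> t0 tn mh h0; rewrite /stieltjes_integral; case: pselect; last first.
  by move/(_ jump_count_cumulative).
move=> e; case: cid => G /= GE.
rewrite (@stieltjes_step _ G t n [seq s <- jump_seq x t n | P s])//.
- rewrite big_filter big_mkcond; apply: eq_bigr => s _.
  by case: (P s); rewrite ?mul1r ?mul0r.
- by rewrite filter_uniq// jump_seq_uniq.
- by move=> s; rewrite mem_filter jump_seqP// => /and3P[].
- move=> a b ta ab bn; rewrite GE (jump_countB ab bn).
  (* Jumps are counted from time 0 but integrated from t; those up to t cannot lie in ]a, b]. *)
  have -> : \sum_(s <- jump_seq x 0 n) ((a < s <= b)%R && P s)%:R =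
      \sum_(s <- jump_seq x 0 n | t < s) ((a < s <= b)%R && P s)%:R :> R.
    rewrite [RHS]big_mkcond; apply: eq_bigr => s _; case: (ltP t s) => // st.
    by rewrite [a < s]ltNge (le_trans st ta).
  rewrite -big_filter [RHS]big_filter (perm_big (jump_seq x t n)).
    by rewrite [RHS]big_mkcond; apply: eq_bigr => s _; case: (P s); rewrite ?andbT ?andbF.
  apply: uniq_perm; rewrite ?filter_uniq ?jump_seq_uniq// => s.
  rewrite mem_filter !jump_seqP//; case: (ltP t s) => //= ts.
  by rewrite (le_lt_trans t0 ts).
Qed.

End JumpCount.

(** After exchanging the sums over pairs of states and over jumps, each jump s selects the single
    pair (x(s-), x(s)). *)
Lemma discounted_paymentsE x (a c : 'cV[R]_p) (B : 'M[R]_p) (r : R -> R) t n :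
  step_path x -> 0 <= t -> t <= n -> (forall i, B i i = 0) ->
  mu.-integrable `[t, n] (EFin \o r) ->
  discounted_payments a c B r t n (fun s => delta_mx 0 (x s)) =
  \int[mu]_(s in `]t, n]) (discount r t s * (a - c) (x s) 0) +
  \sum_(s <- jump_seq x t n) discount r t s * B (left_state x s) (x s).
Proof.
move=> xs t0 tn hB ir; rewrite /discounted_payments; congr (_ + _).
  apply: eq_Rintegral => s _; congr (_ * _); rewrite (bigD1 (x s))//= eqxx mul1r !mxE.
  rewrite big1 ?addr0// => k kx; case: eqP => [/delta_row_inj e|_]; last by rewrite mul0r.
  by rewrite e eqxx in kx.
have md : measurable_fun (`]t, n]%classic : set mT) (discount r t).
  have : measurable_fun (`[t, n]%classic : set mT) (discount r t).
    by apply: subspace_continuous_measurable_fun => //; exact: discount_continuous.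
  by apply: measurable_funS => //; exact: subset_itv_oc_cc.
under eq_bigr => i _.
  under eq_bigr => j ji.
    rewrite (stieltjes_integral_jump_count xs ji t0 tn md); last by move=> s _; exact: expR_ge0.
    rewrite mulr_sumr; over.
  rewrite exchange_big /=; over.
rewrite exchange_big /=; rewrite big_seq [RHS]big_seq; apply: eq_bigr => s.
rewrite jump_seqP// => /andP[_ ls].
rewrite (bigD1 (left_state x s))//= [X in _ + X]big1 ?addr0; last first.
  move=> i il; apply: big1 => j _; rewrite eq_sym (negbTE il) /= mul0r mulr0//.
rewrite (bigD1 (x s))/=; last by rewrite eq_sym.
rewrite [X in _ + X]big1 => [|j /andP[_ jx]].
  by rewrite addr0 !eqxx mul1r mulrC.
by rewrite [x s == j]eq_sym (negbTE jx) andbF mul0r mulr0.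
Qed.

End PathPayments.

(** * Expected payments *)

Section FilteredMarkov.
Context d (T : measurableType d) {R : realType} (P : probability T R) (p : nat).
Variables (L : 'M[R]_p.+1) (Z : R -> T -> 'I_p.+1).
Hypothesis hZ : is_markov_jump_process P L Z.
Local Notation filtration := (natural_filtration (indicator_process (R := R) Z)).

Definition state_set s i : set T := [set w | Z s w = i].

Lemma measurable_state s i : 0 <= s -> measurable (state_set s i).
Proof. by case: hZ => mZ _ _ s0; exact: mZ. Qed.

Lemma measurable_fun_state s (f : 'I_p.+1 -> R) : 0 <= s ->
  measurable_fun setT (fun w => f (Z s w)).
Proof.
move=> s0 _ Y mY; rewrite setTI.
rewrite (_ : _ @^-1` Y = \bigcup_(i in [set i | Y (f i)]) state_set s i).
  by apply: fin_bigcup_measurable => // i _; exact: measurable_state.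
apply/seteqP; split => [w Yw|w [i Yi e]]; first by exists (Z s w).
by rewrite /preimage /= (e : Z s w = i).
Qed.

Lemma filtration_measurable s A : 0 <= s -> filtration s A -> measurable A.
Proof.
move=> s0; apply: smallest_sub; first exact: sigma_algebra_measurable.
move=> _ [u [k [Y [/andP[u0 _] mY ->]]]].
rewrite -[X in measurable X]setTI.
rewrite (_ : (fun w => _) = (fun w => (delta_mx 0 (Z u w) : 'rV[R]_p.+1) 0 k))//.
exact: (@measurable_fun_state u (fun i => (delta_mx 0 i : 'rV[R]_p.+1) 0 k)).
Qed.

Lemma filtration_le s s' A : s <= s' -> filtration s A -> filtration s' A.
Proof.
move=> ss; apply: sub_sigma_algebra2 => _ [u [k [Y [/andP[u0 us] mY ->]]]].
by exists u, k, Y; split => //; rewrite u0 (le_trans us).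
Qed.

Lemma filtration_state s u i : 0 <= u -> u <= s -> filtration s (state_set u i).
Proof.
move=> u0 us; apply: sub_sigma_algebra; exists u, i, [set 1]; split => //.
  by rewrite u0.
apply/seteqP; split => w /=; rewrite /state_set /indicator_process /= mxE eqxx /=.
  by move=> <-; rewrite eqxx.
by case: eqP => [<-//|_ /eqP]; rewrite eq_sym oner_eq0.
Qed.

Lemma filtrationI s A A' : filtration s A -> filtration s A' -> filtration s (A `&` A').
Proof.
move=> fA fA'; rewrite -[A `&` A']setCK setCI; apply: sigma_algebraC.
rewrite -bigcup2E; apply: sigma_algebra_bigcup => -[|[|k]] /=.
- exact: sigma_algebraC.
- exact: sigma_algebraC.
- exact: sigma_algebra0.
Qed.

Lemma filtrationT s : filtration s setT.
Proof. by rewrite -setC0; apply: sigma_algebraC; exact: sigma_algebra0. Qed.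

(** A joint rather than a conditional probability, so that null events need no separate
    treatment. *)
Definition state_prob (A : set T) s i : R := fine (P (A `&` state_set s i)).

Lemma state_integrable A s (f : 'I_p.+1 -> R) : 0 <= s -> measurable A ->
  P.-integrable A (EFin \o (fun w => f (Z s w))).
Proof.
move=> s0 mA; apply: measurable_bounded_integrable => //.
- by rewrite (le_lt_trans (probability_le1 P mA))// ltry.
- by apply: measurable_funTS; exact: measurable_fun_state.
exists (\sum_i `|f i|); split; first exact: num_real.
move=> M HM w _ /=; apply: le_trans (ltW HM).
by rewrite (bigD1 (Z s w))//= lerDl sumr_ge0.
Qed.

Lemma Rintegral_state A s (f : 'I_p.+1 -> R) : 0 <= s -> measurable A ->
  \int[P]_(w in A) f (Z s w) = \sum_i f i * state_prob A s i.
Proof.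
move=> s0 mA.
have mAs i : measurable (A `&` state_set s i) by apply: measurableI => //; exact: measurable_state.
rewrite /Rintegral.
rewrite (eq_integral (fun w => \sum_i ((f i)%:E * (\1_(state_set s i) w)%:E))%E); last first.
  move=> w _; rewrite sumEFin (bigD1 (Z s w))//= indicE mem_set// mulr1 big1 ?addr0// => i iZ.
  by rewrite indicE memNset ?mulr0// => e; rewrite e eqxx in iZ.
have iE i : P.-integrable A (EFin \o \1_(state_set s i)).
  by apply: (@integrableS _ _ _ _ setT) => //; apply: integrable_indic; exact: measurable_state.
have iZ i := integrableZl mA (f i) (iE i).
rewrite integral_sum//= -sum_fine => [|i _]; last exact: integrable_fin_num.
apply: eq_bigr => i _; rewrite integralZl//; last exact: iE.
rewrite integral_indic//; last exact: measurable_state.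
by rewrite setIC fineM//= fin_num_measure.
Qed.

(** The Markov property integrated over [A]. *)
Lemma state_prob_markov A s u j : 0 <= s -> s <= u -> filtration s A ->
  state_prob A u j = \sum_i state_prob A s i * expmx ((u - s) *: L) i j.
Proof.
move=> s0 su fA; have mA := filtration_measurable s0 fA.
have u0 := le_trans s0 su.
case: hZ => _ _ /(_ s u j); rewrite s0 su => /(_ isT)[_ _ _ /(_ _ fA)].
rewrite (Rintegral_state (fun i => expmx ((u - s) *: L) i j))//.
rewrite (Rintegral_state (fun i => (i == j)%:R))// (bigD1 j)//= eqxx mul1r big1 ?addr0.
  by move=> ->; apply: eq_bigr => i _; rewrite mulrC.
by move=> i ij; rewrite (negbTE ij) mul0r.
Qed.

(** The previous lemma for the event intersected with the state i at time s: in the sum over states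
    only i is left. *)
Lemma state_prob_transition A s u i j : 0 <= s -> s <= u -> filtration s A ->
  state_prob (A `&` state_set s i) u j = state_prob A s i * expmx ((u - s) *: L) i j.
Proof.
move=> s0 su fA.
have fAi : filtration s (A `&` state_set s i).
  by apply: filtrationI => //; exact: filtration_state.
rewrite (state_prob_markov _ s0 su fAi) (bigD1 i)//= big1 ?addr0.
  by rewrite /state_prob -setIA setIid.
move=> k ki; rewrite /state_prob (_ : _ `&` _ = set0) ?measure0 ?mul0r//.
apply/seteqP; split => // w [[_ e1] e2] /=.
by move: ki; rewrite -(e1 : Z s w = i) -(e2 : Z s w = k) eqxx.
Qed.

End FilteredMarkov.

(** * Riemann-Stieltjes sums against the clock *)

Section RiemannSums.
Context {R : realType}.
Notation mu := (@lebesgue_measure R).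
Local Notation mT := (measurableTypeR R).

(** Heine's theorem, from the covering form of compactness with halved radii. *)
Lemma segment_uniform_continuous (f : R -> R) a b : {within `[a, b], continuous f} ->
  forall e, 0 < e -> exists2 d : R, 0 < d & forall x y, a <= x <= b -> a <= y <= b ->
    `|x - y| < d -> `|f x - f y| <= e.
Proof.
move=> /subspace_continuousP cf e e0.
pose P (d x : R) := a <= x <= b -> forall y, a <= y <= b -> `|x - y| < d -> `|f x - f y| <= e.
have := (compact_near_coveringP `[a, b]%classic).1 (@segment_compact R a b) R (0^'+) P _.
move=> /(_ _)[].
  move=> x xab; have /cvgrPdist_le/(_ (e / 2)) := cf x xab.
  rewrite divr_gt0// => /(_ isT)/nbhs_ballP[d /= d0 H].
  exists (ball x (d / 2), [set u | u < d / 2]) => /=.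
    split; first by apply: nbhsx_ballx; rewrite divr_gt0.
    by apply: nbhs_right_lt; rewrite divr_gt0.
  move=> [x' u] /= [xx' ud] x'ab y yab x'y.
  have h1 : `|f x - f x'| <= e / 2.
    apply: H => //; rewrite /ball /=; apply: lt_le_trans xx' _; lra.
  have h2 : `|f x - f y| <= e / 2.
    apply: H => //; rewrite /ball /=; move: xx'; rewrite /ball /= => xx'.
    by have := ler_distD x' x y; lra.
  have := ler_distD (f x) (f x') (f y); rewrite (distrC (f x') (f x)); lra.
move=> d /= d0 H; exists (d / 2); first by rewrite divr_gt0.
move=> x y xab yab xy; apply: (H (d / 2)) => //=.
- by rewrite /ball /= sub0r normrN gtr0_norm ?divr_gt0// ltr_pdivrMr// ltr_pMr// ltr1n.
- by rewrite divr_gt0.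
Qed.

Lemma grid_sum_telescope (t n : R) (H : R -> R) m : t < n ->
  grid_sum t n (fun a b => H b - H a) m = H n - H t.
Proof.
move=> tn; rewrite /grid_sum -(big_mkord predT (fun k => H (grid t n m k.+1) - H (grid t n m k))).
by rewrite telescope_sumr// gridn// grid0.
Qed.

Variables (g ginv : R -> R).
Hypothesis tc : is_time_change g ginv.
Variables (t n : R).
Hypotheses (t0 : 0 <= t) (tn : t < n).
Local Notation lam := (Rplus_derive ginv).

(** [e] stands for an off-diagonal entry of exp(xL), of slope [c] at 0. On a cell with clock
    increment D, the variation of [q] costs at most eta |c| D and the quadratic error at most Q K
    D^2, hence Q K eta D when D is at most eta. Both are multiples of D, and these add up to
    [tot]. *)
Lemma riemann_stieltjes_cvg (q e : R -> R) (c K : R) : 0 <= K ->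
  {within `[t, n], continuous q} ->
  (forall a b, t <= a -> a <= b -> b <= n ->
    `|e (ginv b - ginv a) - c * (ginv b - ginv a)| <= K * (ginv b - ginv a) ^+ 2) ->
  grid_sum t n (fun a b => q a * e (ginv b - ginv a)) @ \oo -->
  \int[mu]_(u in `[t, n]) (q u * (c * lam u)).
Proof.
move=> K0 cq eK; apply/cvgrPdist_le => eps eps0.
have t_le_n := ltW tn.
have /compact_bounded[Q0 [_ HQ]] := continuous_compact cq (@segment_compact R t n).
pose Q := `|Q0| + 1; have Q_ge0 : 0 <= Q by rewrite addr_ge0.
have qQ u : t <= u <= n -> `|q u| <= Q.
  by move=> tun; apply: HQ; [rewrite ltr_pwDr// ler_norm|exists u].
have cginv : {within `[t, n], continuous ginv} := ginv_continuous tc t0 t_le_n.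
pose tot := ginv n - ginv t; have tot0 : 0 <= tot by rewrite subr_ge0 (ginv_le tc).
pose W := `|c| + Q * K; have W0 : 0 <= W by rewrite addr_ge0 ?mulr_ge0.
pose eta := eps / (W * tot + 1).
have eta0 : 0 < eta by rewrite divr_gt0// ltr_wpDl ?mulr_ge0.
have [d1 d10 H1] := segment_uniform_continuous cq eta0.
have [d2 d20 H2] := segment_uniform_continuous cginv eta0.
have il a b : t <= a -> a <= b -> b <= n -> mu.-integrable `[a, b] (EFin \o (fun u => c * lam u)).
  move=> ta ab bn; have [i1 _] := Rplus_derive_integral tc (le_trans t0 ta) ab.
  by apply: (RintegrableZ mT).
have mq a b : t <= a -> b <= n -> measurable_fun (`[a, b]%classic : set mT) q.
  move=> ta bn; have mq : measurable_fun (`[t, n]%classic : set mT) q.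
    by apply: subspace_continuous_measurable_fun.
  by apply: measurable_funS mq => //; apply: subset_itvScc; rewrite bnd_simp.
have iql a b : t <= a -> a <= b -> b <= n ->
    mu.-integrable `[a, b] (EFin \o (fun u => q u * (c * lam u))).
  move=> ta ab bn; apply: (integrable_mul_bounded mT Q) => //; [exact: mq| |exact: il].
  by move=> u /=; rewrite in_itv/= => /andP[au ub]; apply: qQ; rewrite (le_trans ta) ?(le_trans ub).
(* A primitive turns the integral into a telescoping grid sum, comparable cell by cell. *)
pose H x := \int[mu]_(u in `[t, x]) (q u * (c * lam u)).
have HE a b : t <= a -> a <= b -> b <= n -> H b - H a = \int[mu]_(u in `[a, b]) (q u * (c * lam u)).
  move=> ta ab bn; have iab := iql a b ta ab bn.
  have iab' : mu.-integrable `]a, b] (EFin \o (fun u => q u * (c * lam u))).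
    by apply: (@integrableS _ mT) iab => //; apply: subset_itvr; rewrite bnd_simp.
  rewrite -(Rintegral_itv_obnd_cbnd iab') /H.
  by rewrite (Rintegral_itvB (iql t b (lexx t) (le_trans ta ab) bn))// bnd_simp.
have cell a b : t <= a -> a <= b -> b <= n -> b - a < d1 -> b - a < d2 ->
    `|H b - H a - q a * e (ginv b - ginv a)| <= eta * W * (ginv b - ginv a).
  move=> ta ab bn bd1 bd2; rewrite HE//.
  have a0 := le_trans t0 ta.
  have [iL eL] := Rplus_derive_integral tc a0 ab.
  pose D := ginv b - ginv a; have D0 : 0 <= D by rewrite subr_ge0 (ginv_le tc).
  have aI : t <= a <= n by rewrite ta (le_trans ab).
  have bI : t <= b <= n by rewrite bn (le_trans ta).
  have De : D <= eta.
    have := H2 b a bI aI; rewrite !ger0_norm ?subr_ge0// ?(ginv_le tc)//; exact.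
  have -> : \int[mu]_(u in `[a, b]) (q u * (c * lam u)) - q a * e D =
     \int[mu]_(u in `[a, b]) ((q u - q a) * (c * lam u)) - q a * (e D - c * D).
    have -> : \int[mu]_(u in `[a, b]) ((q u - q a) * (c * lam u)) =
        \int[mu]_(u in `[a, b]) (q u * (c * lam u)) - q a * (c * D).
      rewrite /D -eL -(RintegralZl c _ iL)// -(RintegralZl (q a) _ (il a b ta ab bn))//.
      rewrite -RintegralB//; [|exact: iql|by apply: (RintegrableZ mT) => //; exact: il].
      by apply: eq_Rintegral => u _; rewrite mulrBl.
    by rewrite mulrBr; ring.
  apply: le_trans (ler_normB _ _) _.
  have -> : eta * W * D = eta * (`|c| * D) + Q * (K * (eta * D)) by rewrite /W; ring.
  apply: lerD; last first.
    rewrite normrM; apply: ler_pM => //; first exact: qQ.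
    apply: le_trans (eK a b ta ab bn) _; rewrite -/D ler_wpM2l// expr2 ler_wpM2r//.
  have iqa : mu.-integrable `[a, b] (EFin \o (fun u => (q u - q a) * (c * lam u))).
    apply: (integrable_mul_bounded mT eta) => //; [|move=> u|exact: il].
      by apply: measurable_funB => //; exact: mq.
    rewrite /= in_itv/= => /andP[au ub]; apply: H1 => //.
      by rewrite (le_trans ta)// (le_trans ub).
    by rewrite ger0_norm ?subr_ge0//; apply: le_lt_trans bd1; rewrite lerD2r.
  have mab : measurable (`[a, b]%classic : set mT) by exact: measurable_itv.
  apply: le_trans (le_normr_Rintegral mab iqa) _.
  rewrite /D -eL -(RintegralZl `|c| mab iL).
  have icl : mu.-integrable `[a, b] (EFin \o (fun u => `|c| * lam u)) by apply: (RintegrableZ mT).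
  rewrite -(RintegralZl eta mab icl); apply: le_Rintegral => //.
  - exact: integrable_norm iqa.
  - by apply: (RintegrableZ mT).
  move=> u; rewrite /= in_itv/= => /andP[au ub]; rewrite normrM; apply: ler_pM => //.
    apply: H1 => //; first by rewrite (le_trans ta)// (le_trans ub).
    by rewrite ger0_norm ?subr_ge0//; apply: le_lt_trans bd1; rewrite lerD2r.
  by rewrite normrM (ger0_norm (_ : 0 <= lam u))// (Rplus_derive_ge0 tc)// (le_trans a0).
near=> m.
have s1 : (n - t) / m.+1%:R < d1 by near: m; exact: near_grid_step.
have s2 : (n - t) / m.+1%:R < d2 by near: m; exact: near_grid_step.
have -> : \int[mu]_(u in `[t, n]) (q u * (c * lam u)) = grid_sum t n (fun a b => H b - H a) m.
  by rewrite grid_sum_telescope// HE.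
rewrite /grid_sum -sumrB; apply: le_trans (ler_norm_sum _ _ _) _.
apply: (@le_trans _ _ (grid_sum t n (fun a b => eta * W * (ginv b - ginv a)) m)).
  apply: ler_sum => k _; apply: cell; rewrite ?grid_ge ?grid_le ?grid_len ?grid_step//.
rewrite /grid_sum -mulr_sumr.
have -> : \sum_(k < m.+1) (ginv (grid t n m k.+1) - ginv (grid t n m k)) = tot.
  exact: (grid_sum_telescope ginv m tn).
have -> : eta * W * tot = eps * (W * tot) / (W * tot + 1) by rewrite /eta; ring.
rewrite ler_pdivrMr; last by rewrite ltr_wpDl ?mulr_ge0.
by rewrite ler_wpM2l ?(ltW eps0)// lerDl.
Unshelve. all: by end_near.
Qed.

End RiemannSums.

Lemma cvg_sumr {R : realType} {U : Type} (F : set_system U) {FF : Filter F} (I : Type) (r : seq I)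
  (f : I -> U -> R) (l : I -> R) : (forall i, f i @ F --> l i) ->
  (fun x => \sum_(i <- r) f i x) @ F --> \sum_(i <- r) l i.
Proof.
move=> fl; elim: r => [|i r IH].
  by rewrite big_nil; under eq_fun do rewrite big_nil; exact: cvg_cst.
rewrite big_cons; under eq_fun do rewrite big_cons.
exact: cvgD.
Qed.

Section RintegralTools.
Context d (T : measurableType d) {R : realType} (mu : {measure set T -> \bar R}).
Variables (D : set T).
Hypothesis mD : measurable D.

Lemma Rintegral_sum (I : Type) (r : seq I) (F : I -> T -> R) :
  (forall i, mu.-integrable D (EFin \o F i)) ->
  mu.-integrable D (EFin \o (fun x => \sum_(i <- r) F i x)) /\
  \int[mu]_(x in D) (\sum_(i <- r) F i x) = \sum_(i <- r) \int[mu]_(x in D) F i x.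
Proof.
move=> Fi; elim: r => [|i r [IH1 IH2]].
  split; last by rewrite big_nil /Rintegral integral0_eq// => x _; rewrite big_nil.
  by apply: (eq_Rintegrable T mD _ (integrable0 mu D)) => x _; rewrite big_nil.
split.
  by apply: (eq_Rintegrable T mD _ (RintegrableD T mD (Fi i) IH1)) => x _; rewrite big_cons.
rewrite big_cons -IH2 -RintegralD//; apply: eq_Rintegral => x _; by rewrite big_cons.
Qed.

Lemma Rdominated_cvg (f_ : nat -> T -> R) (f g : T -> R) :
  (forall m, measurable_fun D (f_ m)) ->
  (forall x, D x -> f_ ^~ x @ \oo --> f x) ->
  mu.-integrable D (EFin \o g) ->
  (forall x m, D x -> `|f_ m x| <= g x) ->
  mu.-integrable D (EFin \o f) /\
  (fun m => \int[mu]_(x in D) f_ m x) @ \oo --> \int[mu]_(x in D) f x.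
Proof.
move=> mf_ f_f ig f_g.
have mf : measurable_fun D f by apply: measurable_fun_cvg f_f.
have [||||ifn _ cv] := @dominated_convergence _ T R mu D mD (fun m => EFin \o f_ m) (EFin \o f) (EFin \o g) _ _ _ ig.
- by move=> m; exact/measurable_EFinP.
- exact/measurable_EFinP.
- by apply: aeW => x Dx; apply: cvg_EFin; [exact: nearW|exact: f_f].
- by apply: aeW => x m Dx; rewrite /= lee_fin; exact: f_g.
split => //; apply: fine_cvg.
by rewrite fineK; [exact: cv|exact: integrable_fin_num].
Qed.

End RintegralTools.

(** * Expectation of sums over jumps *)

Section JumpSumExpectation.
Context d (T : measurableType d) {R : realType} (P : probability T R) (p : nat).
Notation mu := (@lebesgue_measure R).
Local Notation mT := (measurableTypeR R).
Variables (L : 'M[R]_p.+1) (Z : R -> T -> 'I_p.+1) (g ginv : R -> R) (t n : R).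
Hypothesis hZ : is_markov_jump_process P L Z.
Hypothesis tc : is_time_change g ginv.
Hypotheses (t0 : 0 <= t) (tn : t < n).
Local Notation filtration := (natural_filtration (indicator_process (R := R) Z)).
Local Notation lam := (Rplus_derive ginv).
Local Notation state_set := (state_set Z).
Local Notation prob := (state_prob P Z).

Definition clock (a : R) w := Z (ginv a) w.

Lemma pair_integral A s u (phi : 'I_p.+1 -> 'I_p.+1 -> R) : 0 <= s -> 0 <= u -> measurable A ->
  P.-integrable A (EFin \o (fun w => phi (Z s w) (Z u w))) /\
  \int[P]_(w in A) phi (Z s w) (Z u w) =
    \sum_i \sum_j phi i j * prob (A `&` state_set s i) u j.
Proof.
move=> s0 u0 mA.
pose F i w := (Z s w == i)%:R * phi i (Z u w).
have E w : phi (Z s w) (Z u w) = \sum_i F i w.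
  rewrite (bigD1 (Z s w))//= /F eqxx mul1r big1 ?addr0// => i iZ.
  by rewrite eq_sym (negbTE iZ) mul0r.
have Fi i : P.-integrable A (EFin \o F i).
  apply: (integrable_mul_bounded T 1) => //; last exact: (state_integrable hZ).
  - by apply: measurable_funTS; exact: (measurable_fun_state hZ (fun k => (k == i)%:R)).
  - by move=> w _; rewrite normr_nat; case: (_ == _).
have [i1 i2] := Rintegral_sum mA (index_enum _) Fi.
split; first by apply: (eq_Rintegrable T mA _ i1) => w _; rewrite E.
transitivity (\int[P]_(w in A) (\sum_i F i w)); first by apply: eq_Rintegral => w _; exact: E.
rewrite i2; apply: eq_bigr => i _.
have mAi : measurable (A `&` state_set s i).
  by apply: measurableI => //; exact: (measurable_state hZ).
rewrite -(Rintegral_state hZ (phi i) u0 mAi) Rintegral_mkcondr.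
apply: eq_Rintegral => w _; rewrite /F /patch; case: ifPn => wi.
  by move/set_mem: wi => /= wi; rewrite (wi : Z s w = i) eqxx mul1r.
case: eqP => [e|_]; last by rewrite mul0r.
by move/negP: wi; case; apply/mem_set.
Qed.

Let E i j (D : R) := expmx (D *: L) i j.

Lemma grid_expectation A (D : R -> R) (phi : 'I_p.+1 -> 'I_p.+1 -> R) m :
  filtration (ginv t) A ->
  P.-integrable A (EFin \o (fun w =>
    grid_sum t n (fun a b => D a * phi (clock a w) (clock b w)) m)) /\
  \int[P]_(w in A) grid_sum t n (fun a b => D a * phi (clock a w) (clock b w)) m =
  \sum_i \sum_j phi i j *
    grid_sum t n (fun a b => D a * prob A (ginv a) i * E i j (ginv b - ginv a)) m.
Proof.
move=> fA; have mA := filtration_measurable hZ (tc_ginv_ge0 tc t0) fA.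
have ge0 k : 0 <= grid t n m k := le_trans t0 (grid_ge tn m k).
pose F (k : 'I_m.+1) w := D (grid t n m k) * phi (clock (grid t n m k) w) (clock (grid t n m k.+1) w).
have H k := pair_integral phi (tc_ginv_ge0 tc (ge0 k)) (tc_ginv_ge0 tc (ge0 k.+1)) mA.
have Fi k : P.-integrable A (EFin \o F k) by apply: RintegrableZ => //; exact: (H k).1.
have [i1 i2] := Rintegral_sum mA (index_enum _) Fi.
split => //; rewrite [LHS]i2.
under [RHS]eq_bigr do under eq_bigr do rewrite mulr_sumr.
under [RHS]eq_bigr do rewrite exchange_big.
rewrite [RHS]exchange_big; apply: eq_bigr => k _.
rewrite /F RintegralZl//; last exact: (H k).1.
rewrite (H k).2 mulr_sumr; apply: eq_bigr => i _; rewrite mulr_sumr; apply: eq_bigr => j _.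
have gk : ginv (grid t n m k) <= ginv (grid t n m k.+1) by apply: (ginv_le tc) => //; exact: grid_le.
rewrite (state_prob_transition hZ _ _ (tc_ginv_ge0 tc (ge0 k)) gk); first by rewrite /E; ring.
by apply: filtration_le fA; apply: (ginv_le tc) => //; exact: grid_ge.
Qed.

(** By the Markov property from time t, this is a finite combination of entries of the exponential
    at the elapsed clock time. *)
Lemma state_prob_continuous A i : filtration (ginv t) A ->
  {within `[t, n], continuous (fun a => prob A (ginv a) i)}.
Proof.
move=> fA.
have cE j : {within `[t, n], continuous (fun a => E j i (ginv a - ginv t))}.
  have ctau : {within `[t, n], continuous (fun a => ginv a - ginv t)}.
    have cg := ginv_continuous tc t0 (ltW tn).
    by move=> x; apply: cvgB; [exact: cg|exact: cvg_cst].
  exact: (continuous_comp_within (@expmx_continuous _ _ L j i) ctau).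
have cS : {within `[t, n], continuous (fun a =>
    \sum_j prob A (ginv t) j * E j i (ginv a - ginv t))}.
  move=> x; apply: cvg_sumr => j; apply: cvgMr; exact: cE.
apply: (@subspace_eq_continuous _ `[t, n] _ _ _ _ cS) => a /set_mem /=.
rewrite in_itv/= => /andP[ta an].
exact/esym/(state_prob_markov hZ i (tc_ginv_ge0 tc t0) (ginv_le tc t0 ta) fA).
Qed.

(** The compensator of the jump sum, integrated over [A]: from state i, jumps to j occur at rate
    L_ij lambda(u). *)
Definition jump_expectation A (D : R -> R) (phi : 'I_p.+1 -> 'I_p.+1 -> R) :=
  \sum_i \sum_j phi i j *
    \int[mu]_(u in `[t, n]) (D u * prob A (ginv u) i * (L i j * lam u)).

Lemma grid_expectation_cvg A (D : R -> R) (phi : 'I_p.+1 -> 'I_p.+1 -> R) :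
  filtration (ginv t) A -> {within `[t, n], continuous D} -> (forall i, phi i i = 0) ->
  (fun m => \int[P]_(w in A) grid_sum t n (fun a b => D a * phi (clock a w) (clock b w)) m)
    @ \oo --> jump_expectation A D phi.
Proof.
move=> fA cD phi0.
rewrite (_ : (fun m => _) = fun m => \sum_i \sum_j phi i j *
    grid_sum t n (fun a b => D a * prob A (ginv a) i * E i j (ginv b - ginv a)) m); last first.
  by apply/funext => m; rewrite (grid_expectation D phi m fA).2.
apply: cvg_sumr => i; apply: cvg_sumr => j.
(* On the diagonal the exponential is near 1 and its sums would diverge; the vanishing of [phi]
   there removes these terms. *)
have [<-|ij] := eqVneq i j.
  rewrite phi0 mul0r (_ : (fun m => _) = fun=> 0); first exact: cvg_cst.
  by apply/funext => m; rewrite mul0r.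
apply: cvgMr; pose tot := ginv n - ginv t.
(* The first-order bound on the exponential, with every clock increment in its exponent replaced by
   [tot]. *)
apply: (riemann_stieltjes_cvg tc t0 tn (K := expR (tot * entry_norm L) * entry_norm L ^+ 2)).
- by rewrite mulr_ge0 ?expR_ge0// exprn_ge0// entry_norm_ge0.
- by move=> x; apply: cvgM; [exact: cD|exact: state_prob_continuous].
move=> a b ta ab bn; have a0 := le_trans t0 ta.
have D0 : 0 <= ginv b - ginv a by rewrite subr_ge0 (ginv_le tc).
have := expmx_first_order L (ginv b - ginv a) i j.
rewrite (negbTE ij) subr0 (ger0_norm D0) [_ * L i j]mulrC => /le_trans; apply.
set x := ginv b - ginv a in D0 *.
apply: (@le_trans _ _ (expR (tot * entry_norm L) * (x * entry_norm L) ^+ 2)).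
  rewrite ler_wpM2r ?exprn_ge0 ?mulr_ge0 ?entry_norm_ge0//.
  rewrite ler_expR ler_wpM2r ?entry_norm_ge0// lerB// (ginv_le tc)//.
  exact: le_trans ab.
by rewrite exprMn mulrA mulrAC.
Qed.

End JumpSumExpectation.

Section JumpSums.
Context d (T : measurableType d) {R : realType} (P : probability T R) (p : nat).
Notation mu := (@lebesgue_measure R).
Local Notation mT := (measurableTypeR R).
Variables (L : 'M[R]_p.+1) (Z : R -> T -> 'I_p.+1) (g ginv : R -> R) (t n : R).
Hypothesis hZ : is_markov_jump_process P L Z.
Hypothesis tc : is_time_change g ginv.
Hypotheses (t0 : 0 <= t) (tn : t < n).
Local Notation filtration := (natural_filtration (indicator_process (R := R) Z)).
Local Notation path w := (fun a => clock Z ginv a w).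

Lemma clock_step w : step_path (path w).
Proof.
case: hZ => _ jp _.
exact: (step_path_comp tc (jump_path_step (jp w))).
Qed.

Let fT : filtration (ginv t) setT. Proof. exact: filtrationT. Qed.

Let jumpsum (D : R -> R) (phi : 'I_p.+1 -> 'I_p.+1 -> R) w :=
  \sum_(s <- jump_seq (path w) t n) D s * phi (left_state (path w) s) (path w s).

Let jump_number w : R := (size (jump_seq (path w) t n))%:R.

Let gridsum (D : R -> R) (phi : 'I_p.+1 -> 'I_p.+1 -> R) m w :=
  grid_sum t n (fun a b => D a * phi (path w a) (path w b)) m.

Let measurable_gridsum D phi m : measurable_fun setT (gridsum D phi m).
Proof.
have [/integrableP[/measurable_EFinP]] := grid_expectation hZ tc t0 tn D phi m fT.
by [].
Qed.

(* Fatou: the numbers of state changes along the grids converge to the number of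
   jumps and have bounded expectations. *)
Lemma jump_number_integrable : P.-integrable setT (EFin \o jump_number).
Proof.
(* With this weight and [D] equal to 1, a grid sum counts the cells whose ends carry different
   states. *)
pose phi (i j : 'I_p.+1) : R := (i != j)%:R.
have phi0 i : phi i i = 0 by rewrite /phi eqxx.
have c1 : {within `[t, n], continuous (fun=> 1 : R)} by move=> x; exact: cvg_cst.
have cvgN w : gridsum (fun=> 1) phi ^~ w @ \oo --> jump_number w.
  have := path_grid_sum_cvg (clock_step w) t0 tn phi0 c1.
  rewrite (_ : \sum_(_ <- _) _ = jump_number w)//.
  rewrite big_seq (eq_bigr (fun=> 1)) => [|s].
    by rewrite -big_seq big_const_seq count_predT iter_addr_0.
  by rewrite (jump_seqP _ _ (clock_step w) t0) /phi mul1r => /andP[_ ->].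
have mN : measurable_fun setT jump_number.
  by apply: (@measurable_fun_cvg _ T _ _ (gridsum (fun=> 1) phi)) => // w _; exact: cvgN.
have F0 m w : (0 <= (gridsum (fun=> 1) phi m w)%:E)%E.
  by rewrite lee_fin; apply: sumr_ge0 => k _; rewrite mul1r.
apply/integrableP; split; first exact/measurable_EFinP.
have -> : (\int[P]_w `|(EFin \o jump_number) w| =
    \int[P]_w (limn_einf (fun m => (gridsum (fun=> 1) phi m w)%:E)))%E.
  apply: eq_integral => w _; rewrite /= ger0_norm//.
  have cE : (fun m => (gridsum (fun=> 1) phi m w)%:E) @ \oo --> (jump_number w)%:E.
    by apply: cvg_EFin; [exact: nearW|exact: cvgN].
  by rewrite is_cvg_limn_einfE; [exact/esym/cvg_lim|apply/cvg_ex; exists (jump_number w)%:E].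
apply: le_lt_trans (fatou P measurableT _ _) _ => //.
- by move=> m; exact/measurable_EFinP.
have cI := grid_expectation_cvg hZ tc t0 tn fT c1 phi0.
have cE : (fun m => (\int[P]_w (gridsum (fun=> 1) phi m w)%:E)%E) @ \oo -->
    (jump_expectation P L Z ginv t n setT (fun=> 1) phi)%:E.
  rewrite (_ : (fun m => _) = EFin \o (fun m => \int[P]_w gridsum (fun=> 1) phi m w)).
    by apply: cvg_EFin; [exact: nearW|exact: cI].
  apply/funext => m /=; rewrite /Rintegral fineK//; apply: integrable_fin_num => //.
  exact: (grid_expectation hZ tc t0 tn _ phi m fT).1.
(* The lower limit in Fatou's bound is a genuine limit, with a real and hence finite value. *)
rewrite is_cvg_limn_einfE; last by apply/cvg_ex; eexists; exact: cE.
by rewrite (cvg_lim _ cE)// ltry.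
Qed.

Lemma jumpsum_expectation (D : R -> R) (phi : 'I_p.+1 -> 'I_p.+1 -> R) :
  {within `[t, n], continuous D} -> (forall i, phi i i = 0) ->
  P.-integrable setT (EFin \o jumpsum D phi) /\
  forall A, filtration (ginv t) A ->
    \int[P]_(w in A) jumpsum D phi w = jump_expectation P L Z ginv t n A D phi.
Proof.
move=> cD phi0.
have /compact_bounded[C0 [_ HC]] := continuous_compact cD (@segment_compact R t n).
pose C := (`|C0| + 1) * \sum_i \sum_j `|phi i j|.
have S0 : 0 <= \sum_i \sum_j `|phi i j|.
  by apply: sumr_ge0 => i _; apply: sumr_ge0 => j _.
have C_ge0 : 0 <= C by rewrite mulr_ge0// addr_ge0.
have DC a i j : t <= a -> a <= n -> `|D a * phi i j| <= C.
  move=> ta an; rewrite normrM; apply: ler_pM => //.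
    apply: HC; first by rewrite ltr_pwDr// ler_norm.
    by exists a => //=; rewrite in_itv/= ta.
  rewrite (bigD1 i)//= (bigD1 j)//= -addrA lerDl addr_ge0// ?sumr_ge0// => k _.
  exact: sumr_ge0.
have dom A : measurable A -> P.-integrable A (EFin \o jumpsum D phi) /\
    (fun m => \int[P]_(w in A) gridsum D phi m w) @ \oo --> \int[P]_(w in A) jumpsum D phi w.
  move=> mA; apply: (Rdominated_cvg mA (g := fun w => C * jump_number w)).
  - by move=> m; exact: measurable_funTS.
  - by move=> w _; exact: path_grid_sum_cvg (clock_step w) t0 tn phi0 cD.
  - apply: RintegrableZ => //.
    by apply: (@integrableS _ T _ _ setT) jump_number_integrable.
  - by move=> w m _; apply: path_grid_sum_le => //; exact: clock_step.
split; first exact: (dom setT measurableT).1.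
move=> A fA; have mA := filtration_measurable hZ (tc_ginv_ge0 tc t0) fA.
apply: cvg_unique (dom A mA).2 (grid_expectation_cvg hZ tc t0 tn fA cD phi0).
exact: Rhausdorff.
Qed.

End JumpSums.

(** * Expectation of the annuities *)

Section Annuity.
Context d (T : measurableType d) {R : realType} (P : probability T R) (p : nat).
Notation mu := (@lebesgue_measure R).
Local Notation mT := (measurableTypeR R).
Variables (L : 'M[R]_p.+1) (Z : R -> T -> 'I_p.+1) (g ginv : R -> R) (t n : R).
Hypothesis hZ : is_markov_jump_process P L Z.
Hypothesis tc : is_time_change g ginv.
Hypotheses (t0 : 0 <= t) (tn : t < n).
Local Notation filtration := (natural_filtration (indicator_process (R := R) Z)).
Local Notation prob := (state_prob P Z).
Variables (D : R -> R) (alpha : 'I_p.+1 -> R).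
Hypothesis cD : {within `[t, n], continuous D}.

Let I : set mT := `]t, n]%classic.
Let k (z : T * mT) : R := (t < z.2 <= n)%R%:R * alpha (clock Z ginv z.2 z.1).

(** Sampled at the right end of the cell, which is not before s, so that right continuity
    applies. *)
Let cell_step m (z : T * mT) : R :=
  \sum_(j < m.+1) (in_cell t n z.2 m j)%:R * alpha (clock Z ginv (grid t n m j.+1) z.1).

Let measurable_cell_step m : measurable_fun setT (cell_step m).
Proof.
apply: measurable_sum => j.
have m1 : measurable_fun setT (fun s : mT => (in_cell t n s m j)%:R : R).
  rewrite (_ : (fun s => _) = \1_(`]grid t n m j, grid t n m j.+1]%classic : set mT)).
    exact: measurable_indic.
  apply/funext => s; rewrite indicE; congr (nat_of_bool _)%:R; rewrite /in_cell.
  by apply/idP/idP => [H|/set_mem]; [apply/mem_set; rewrite /= in_itv|rewrite /= in_itv].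
have m2 : measurable_fun setT (fun w => alpha (clock Z ginv (grid t n m j.+1) w)).
  apply: (measurable_fun_state hZ); apply: (tc_ginv_ge0 tc).
  by apply: (le_trans t0); exact: grid_ge.
exact: measurable_funM (measurableT_comp m1 measurable_snd) (measurableT_comp m2 measurable_fst).
Qed.

(* Right continuity of the paths makes (w, s) |-> alpha (X_s w) a limit of
   functions that are constant in s on the cells of a grid. *)
Let measurable_k : measurable_fun setT k.
Proof.
apply: (@measurable_fun_cvg _ _ _ _ cell_step) => // -[w s] _; rewrite /k /=.
have [/= sI|sI] := boolP (t < s <= n); last first.
  rewrite mul0r; apply: cvg_near_cst; apply: nearW => m.
  apply/eqP; rewrite /cell_step big1// => j _ /=; rewrite (_ : in_cell _ _ _ _ _ = false) ?mul0r//.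
  apply: contraNF sI => /andP[s1 s2]; apply/andP; split.
    by apply: le_lt_trans s1; exact: grid_ge.
  by apply: (le_trans s2); exact: grid_len.
rewrite mul1r; have s0 : 0 <= s by case/andP: sI => ts _; exact: le_trans t0 (ltW ts).
have [e e0 He] := (clock_step hZ tc w).1 s s0.
apply: cvg_near_cst; near=> m.
have [j jm sj] := in_cell_exists m sI.
rewrite /cell_step (sum_in_cell tn (fun j => alpha (clock Z ginv (grid t n m j.+1) w)) jm sj).
rewrite /= He//; case/andP: (sj) => s1 s2; rewrite s2/=.
have : (n - t) / m.+1%:R < e by near: m; exact: near_grid_step.
rewrite -(grid_step t n m j); lra.
Unshelve. all: by end_near.
Qed.

Let k_bound z : `|k z| <= \sum_i `|alpha i|.
Proof.
rewrite /k normrM normr_nat; apply: (@le_trans _ _ `|alpha (clock Z ginv z.2 z.1)|).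
  by rewrite ler_piMl//; case: (_ && _).
by rewrite (bigD1 (clock Z ginv z.2 z.1))//= lerDl sumr_ge0.
Qed.

Let E : set (T * mT) := setT `*` I.
Let mI : measurable I. Proof. exact: measurable_itv. Qed.
Let mE : measurable E. Proof. exact: measurableX. Qed.

Let mDI : measurable_fun I D.
Proof.
have : measurable_fun (`[t, n]%classic : set mT) D.
  by apply: subspace_continuous_measurable_fun => //; exact: measurable_itv.
by apply: measurable_funS; [exact: measurable_itv|exact: subset_itv_oc_cc].
Qed.

Let Dbound : exists2 C : R, 0 <= C & forall s, I s -> `|D s| <= C.
Proof.
have /compact_bounded[C0 [_ HC]] := continuous_compact cD (@segment_compact R t n).
exists (`|C0| + 1); first by rewrite addr_ge0.
move=> s sI; apply: HC; first by rewrite ltr_pwDr// ler_norm.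
by exists s => //; exact: subset_itv_oc_cc sI.
Qed.

(** The event and the interval enter as factors, so that Fubini's theorem is applied on the whole
    product. *)
Let F A (z : T * mT) : R := \1_A z.1 * ((D \_ I) z.2 * k z).

Let measurable_F A : measurable A -> measurable_fun setT (F A).
Proof.
move=> mA.
have m1 : measurable_fun setT (\1_A : T -> R) by exact: measurable_indic.
have m2 : measurable_fun setT (D \_ I) by apply/measurable_restrict => //; rewrite setTI.
apply: (measurable_funM (measurableT_comp m1 measurable_fst)).
exact: (measurable_funM (measurableT_comp m2 measurable_snd)).
Qed.

Let F_integrable A : measurable A -> (P \x mu)%E.-integrable setT (EFin \o F A).
Proof.
move=> mA; have [C C0 HC] := Dbound.
have FE : EFin \o F A = (EFin \o F A) \_ E.
  apply/funext => z; rewrite /patch; case: ifPn => // /negP zE.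
  rewrite /= /F /patch; case: ifPn => [zI|_]; last by rewrite mul0r mulr0.
  by case: zE; apply/mem_set; split => //; exact: set_mem zI.
have PE : (P \x mu)%E E = (n - t)%:E.
  transitivity (P setT * mu I)%E; first exact: product_measure1E.
  by rewrite probability_setT mul1e /I lebesgue_measure_itv/= lte_fin tn -EFinB.
rewrite FE; apply/(integrable_mkcond _ mE).
apply: measurable_bounded_integrable => //.
- by rewrite [X in (X < _)%E]PE ltry.
- by apply: measurable_funTS; exact: measurable_F.
exists (C * \sum_i `|alpha i|); split; first exact: num_real.
move=> M HM z _ /=; apply: le_trans (ltW HM).
have kb := k_bound z.
rewrite /F normrM; apply: (@le_trans _ _ (`|(D \_ I) z.2 * k z|)).
  by rewrite ler_piMl// indicE normr_nat; case: (_ \in _).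
rewrite normrM; apply: ler_pM => //; rewrite /patch; case: ifPn => [/set_mem/HC//|_].
by rewrite normr0.
Qed.

Let annuity w := \int[mu]_(s in I) (D s * alpha (clock Z ginv s w)).

Let annuity_integrable w :
  mu.-integrable I (EFin \o (fun s => D s * alpha (clock Z ginv s w))).
Proof.
have [C C0 HC] := Dbound.
have muI : mu I = (n - t)%:E by rewrite /I lebesgue_measure_itv/= lte_fin tn -EFinB.
have mk : measurable_fun setT (fun s : mT => k (w, s)).
  exact: (measurableT_comp measurable_k (pair1_measurable w)).
apply: (eq_Rintegrable mT (f := fun s => D s * k (w, s))) => //.
  by move=> s; rewrite /I /= in_itv/= /k /= => ->; rewrite mul1r.
apply: (integrable_mul_bounded mT C) => //.
apply: measurable_bounded_integrable => //.
- by rewrite [X in (X < _)%E]muI ltry.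
- exact: measurable_funTS.
exists (\sum_i `|alpha i|); split; first exact: num_real.
by move=> M HM s _ /=; apply: le_trans (ltW HM); exact: k_bound.
Qed.

Let FE A w s : F A (w, s) =
  \1_A w * (((fun s => D s * alpha (clock Z ginv s w)) \_ I) s).
Proof.
rewrite /F /k /= /patch; case: ifPn => [/set_mem|_]; last by rewrite mul0r.
by rewrite /I /= in_itv/= => ->; rewrite mul1r.
Qed.

Let annuity_section A w :
  (\int[mu]_s (F A (w, s))%:E = (\1_A w * annuity w)%:E)%E.
Proof.
have iI := (integrable_mkcond _ mI).1 (annuity_integrable w).
rewrite restrict_EFin in iI.
transitivity (\int[mu]_s ((\1_A w)%:E *
    (((fun s => D s * alpha (clock Z ginv s w)) \_ I) s)%:E))%E.
  by apply: eq_integral => s _; rewrite FE EFinM.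
rewrite integralZl// EFinM; congr (_ * _)%E.
rewrite /annuity /Rintegral fineK; last exact: integrable_fin_num (annuity_integrable w).
by rewrite [RHS]integral_mkcond restrict_EFin.
Qed.

Let prob_section A s : filtration (ginv t) A ->
  (\int[P]_w (F A (w, s))%:E =
    (((fun s => D s * \sum_i alpha i * prob A (ginv s) i) \_ I) s)%:E)%E.
Proof.
move=> fA; have mA := filtration_measurable hZ (tc_ginv_ge0 tc t0) fA.
have [sI|sI] := boolP (s \in I); last first.
  rewrite /patch (negbTE sI) integral0_eq// => w _.
  by rewrite FE /patch (negbTE sI) mulr0.
have gs0 : 0 <= ginv s.
  move/set_mem: (sI); rewrite /I /= in_itv/= => /andP[ts _].
  by apply: (tc_ginv_ge0 tc); exact: le_trans t0 (ltW ts).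
have ia := state_integrable hZ alpha gs0 mA.
rewrite /patch sI -(Rintegral_state hZ alpha gs0 mA) -RintegralZl//.
rewrite /Rintegral fineK; last first.
  by apply: integrable_fin_num => //; apply: RintegrableZ.
rewrite [RHS]integral_mkcond; apply: eq_integral => w _.
rewrite FE {1}/patch sI /patch indicE; case: (w \in A); first by rewrite mul1r.
by rewrite mul0r.
Qed.

Lemma annuity_expectation : P.-integrable setT (EFin \o annuity) /\
  forall A, filtration (ginv t) A -> \int[P]_(w in A) annuity w =
    \int[mu]_(s in I) (D s * \sum_i alpha i * prob A (ginv s) i).
Proof.
split.
  (* For the whole space as event, the partial integral over time is the annuity itself. *)
  have := integrable_fubini_F (F_integrable measurableT).
  apply: eq_integrable => // w _; rewrite /fubini_F [LHS]annuity_section indicE.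
  by rewrite mem_set ?mul1r.
move=> A fA; have mA := filtration_measurable hZ (tc_ginv_ge0 tc t0) fA.
have := Fubini (F_integrable mA).
have -> : (\int[P]_w \int[mu]_s (EFin \o F A) (w, s) =
    \int[P]_(w in A) (annuity w)%:E)%E.
  rewrite [RHS]integral_mkcond; apply: eq_integral => w _.
  rewrite [LHS]annuity_section /patch indicE; case: (w \in A); first by rewrite mul1r.
  by rewrite mul0r.
have -> : (\int[mu]_s \int[P]_w (EFin \o F A) (w, s) =
    \int[mu]_(s in I) (D s * \sum_i alpha i * prob A (ginv s) i)%:E)%E.
  rewrite [RHS]integral_mkcond restrict_EFin.
  by apply: eq_integral => s _; exact: prob_section.
by rewrite /Rintegral => ->.
Qed.

End Annuity.

(** * The reserve *)

Section Reserve.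
Context d (T : measurableType d) {R : realType} (P : probability T R) (p : nat).
Notation mu := (@lebesgue_measure R).
Local Notation mT := (measurableTypeR R).
Variables (L : 'M[R]_p.+1) (Z : R -> T -> 'I_p.+1) (g ginv : R -> R) (t n : R).
Hypothesis hZ : is_markov_jump_process P L Z.
Hypothesis tc : is_time_change g ginv.
Hypotheses (t0 : 0 <= t) (tn : t < n).
Local Notation filtration := (natural_filtration (indicator_process (R := R) Z)).
Local Notation prob := (state_prob P Z).
Local Notation lam := (Rplus_derive ginv).

(** The expected time spent in state i during [t, n], weighted by [om], when the state at time t is
    m. *)
Definition occupation (om : R -> R) m i :=
  \int[mu]_(u in `[t, n]) (om u * expmx ((ginv u - ginv t) *: L) m i).

Let mI : measurable (`[t, n]%classic : set mT). Proof. exact: measurable_itv. Qed.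

Lemma elapsed_continuous : {within `[t, n], continuous (fun u => ginv u - ginv t)}.
Proof.
have cg := ginv_continuous tc t0 (ltW tn).
by move=> x; apply: cvgB; [exact: cg|exact: cvg_cst].
Qed.

Lemma integrable_mul_continuous (om k : R -> R) :
  mu.-integrable (`[t, n]%classic : set mT) (EFin \o om) ->
  {within `[t, n], continuous k} ->
  mu.-integrable (`[t, n]%classic : set mT) (EFin \o (fun u => om u * k u)).
Proof.
move=> iom ck.
have /compact_bounded[C0 [_ HC]] := continuous_compact ck (@segment_compact R t n).
apply: (eq_Rintegrable mT (f := fun u => k u * om u)) => //.
  by move=> u _; rewrite mulrC.
apply: (integrable_mul_bounded mT (`|C0| + 1)) => //.
  exact: subspace_continuous_measurable_fun.
move=> u uI; apply: HC; first by rewrite ltr_pwDr// ler_norm.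
by exists u.
Qed.

Lemma Rintegral_state_prob A (om : R -> R) i :
  mu.-integrable (`[t, n]%classic : set mT) (EFin \o om) -> filtration (ginv t) A ->
  \int[mu]_(u in `[t, n]) (om u * prob A (ginv u) i) =
  \sum_m prob A (ginv t) m * occupation om m i.
Proof.
move=> iom fA.
have iF m : mu.-integrable (`[t, n]%classic : set mT) (EFin \o (fun u =>
    prob A (ginv t) m * (om u * expmx ((ginv u - ginv t) *: L) m i))).
  apply: (RintegrableZ mT) => //; apply: integrable_mul_continuous => //.
  exact: (continuous_comp_within (@expmx_continuous _ _ L m i) elapsed_continuous).
have [_ e] := Rintegral_sum mI (index_enum _) iF.
transitivity (\int[mu]_(u in `[t, n]) (\sum_m
    prob A (ginv t) m * (om u * expmx ((ginv u - ginv t) *: L) m i))).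
  apply: (@eq_Rintegral _ mT) => u /set_mem /=; rewrite in_itv/= => /andP[tu _].
  rewrite (state_prob_markov hZ i (tc_ginv_ge0 tc t0) (ginv_le tc t0 tu) fA) mulr_sumr.
  by apply: eq_bigr => m _; rewrite mulrCA.
rewrite e; apply: eq_bigr => m _; rewrite (@RintegralZl _ mT _ _ _ _ _ mI)//.
apply: integrable_mul_continuous => //.
exact: (continuous_comp_within (@expmx_continuous _ _ L m i) elapsed_continuous).
Qed.

Variables (D : R -> R) (alpha : 'I_p.+1 -> R) (phi : 'I_p.+1 -> 'I_p.+1 -> R).
Hypothesis cD : {within `[t, n], continuous D}.

(** The inner sum of the second term is the i-th entry of (Lambda . B) e when [phi] is [B]. *)
Definition reserve_value m := \sum_i occupation D m i * alpha i +
  \sum_i occupation (fun u => D u * lam u) m i * \sum_j L i j * phi i j.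

Let iD : mu.-integrable (`[t, n]%classic : set mT) (EFin \o D).
Proof. by apply: continuous_compact_integrable => //; exact: segment_compact. Qed.

Lemma integrable_discount_rate :
  mu.-integrable (`[t, n]%classic : set mT) (EFin \o (fun u => D u * lam u)).
Proof.
have [il _] := Rplus_derive_integral tc t0 (ltW tn).
apply: (eq_Rintegrable mT mI _ (integrable_mul_continuous il cD)) => u _.
by rewrite mulrC.
Qed.

Lemma jump_expectationE A : filtration (ginv t) A ->
  jump_expectation P L Z ginv t n A D phi =
  \sum_m (\sum_i occupation (fun u => D u * lam u) m i * \sum_j L i j * phi i j) *
    prob A (ginv t) m.
Proof.
move=> fA.
under [RHS]eq_bigr do rewrite mulr_suml.
rewrite [RHS]exchange_big; apply: eq_bigr => i _.
transitivity ((\sum_j L i j * phi i j) *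
    \int[mu]_(u in `[t, n]) (D u * lam u * prob A (ginv u) i)).
  rewrite mulr_suml; apply: eq_bigr => j _.
  rewrite mulrAC [RHS]mulrC; congr (_ * _).
  rewrite -(@RintegralZl _ mT _ _ _ _ _ mI).
    by apply: (@eq_Rintegral _ mT) => u _; ring.
  exact: integrable_mul_continuous integrable_discount_rate (state_prob_continuous hZ tc t0 tn fA).
rewrite (Rintegral_state_prob i integrable_discount_rate fA) mulr_sumr.
by apply: eq_bigr => m _; ring.
Qed.

Lemma annuity_expectationE A : filtration (ginv t) A ->
  \int[mu]_(s in `]t, n]) (D s * \sum_i alpha i * prob A (ginv s) i) =
  \sum_m (\sum_i occupation D m i * alpha i) * prob A (ginv t) m.
Proof.
move=> fA.
have iF i : mu.-integrable (`[t, n]%classic : set mT)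
    (EFin \o (fun u => D u * prob A (ginv u) i)).
  exact: integrable_mul_continuous iD (state_prob_continuous hZ tc t0 tn fA).
have iaF i := RintegrableZ mT (alpha i) mI (iF i).
have [i1 i2] := Rintegral_sum mI (index_enum _) iaF.
have E s : D s * (\sum_i alpha i * prob A (ginv s) i) =
    \sum_i alpha i * (D s * prob A (ginv s) i).
  by rewrite mulr_sumr; apply: eq_bigr => i _; rewrite mulrCA.
rewrite Rintegral_itv_obnd_cbnd; last first.
  apply: (@integrableS _ mT _ _ _ _ _ mI) => //; first exact: subset_itv_oc_cc.
  by apply: (eq_Rintegrable mT mI _ i1) => s _; rewrite E.
under eq_Rintegral do rewrite E.
rewrite i2; under [RHS]eq_bigr do rewrite mulr_suml.
rewrite [RHS]exchange_big; apply: eq_bigr => i _.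
rewrite (@RintegralZl _ mT _ _ _ _ _ mI); last exact: iF.
rewrite (Rintegral_state_prob i iD fA) mulr_sumr.
by apply: eq_bigr => m _; ring.
Qed.

End Reserve.

(** * Versions of the conditional expectation *)

Section ConditionalExpectation.
Context d (T : measurableType d) {R : realType} (P : probability T R) (p : nat).
Variables (L : 'M[R]_p.+1) (Z : R -> T -> 'I_p.+1).
Hypothesis hZ : is_markov_jump_process P L Z.
Local Notation filtration := (natural_filtration (indicator_process (R := R) Z)).
Variables (s : R) (s0 : 0 <= s).

Lemma negligible_positive A (h : T -> R) : measurable A ->
  P.-integrable A (EFin \o h) -> (forall w, A w -> 0 < h w) ->
  \int[P]_(w in A) h w = 0 -> {ae P, forall w, ~ A w}.
Proof.
move=> mA ih hpos h0.
have e0 : (\int[P]_(w in A) `|(EFin \o h) w| = 0)%E.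
  transitivity (\int[P]_(w in A) (h w)%:E)%E.
    by apply: eq_integral => w /set_mem Aw /=; rewrite gtr0_norm ?hpos.
  by rewrite -[LHS]fineK ?[X in X%:E]h0//; exact: integrable_fin_num.
have mh : measurable_fun A (EFin \o h) by case/integrableP: ih.
have := (ae_eq_integral_abs P mA mh).1 e0.
apply: filterS => w /= H Aw; have /H[hw] := Aw.
by have := hpos w Aw; rewrite hw ltxx.
Qed.

(** The finite family is padded with empty sets into a countable one. *)
Lemma filtration_bigcup (A : 'I_p.+1 -> set T) :
  (forall i, filtration s (A i)) -> filtration s [set w | exists i, A i w].
Proof.
move=> fA; rewrite (_ : [set w | _] =
  \bigcup_k (fun k => if (k < p.+1)%N then A (inord k) else set0) k).
  apply: sigma_algebra_bigcup => k; by case: ifP => _; [exact: fA|exact: sigma_algebra0].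
apply/seteqP; split => [w [i Aiw]|w [k _]].
  by exists i => //=; rewrite ltn_ord inord_val.
by case: ifP => // _ Aw; exists (inord k).
Qed.

Lemma filtration_comp_state (v : 'I_p.+1 -> R) (Y : set R) :
  filtration s ((fun w => v (Z s w)) @^-1` Y).
Proof.
rewrite (_ : _ @^-1` Y = [set w | exists i, [set w | Y (v i) /\ Z s w = i] w]).
  apply: filtration_bigcup => i; have [Yi|nYi] := pselect (Y (v i)).
    rewrite (_ : [set w | _] = state_set Z s i); first by apply: filtration_state.
    by apply/seteqP; split => [w []|w].
  rewrite (_ : [set w | _] = set0); first exact: sigma_algebra0.
  by apply/seteqP; split => [w []|w].
apply/seteqP; split => [w Yw|w [i [Yi e]]]; first by exists (Z s w).
by rewrite /preimage /= e.
Qed.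

Variables (X : T -> R) (v : 'I_p.+1 -> R).
Hypothesis iX : P.-integrable setT (EFin \o X).
Hypothesis XE : forall A, filtration s A ->
  \int[P]_(w in A) X w = \sum_i v i * state_prob P Z A s i.

Lemma state_condexp : is_condexp P (filtration s) X (fun w => v (Z s w)).
Proof.
split => //.
- exact: (state_integrable hZ).
- by move=> Y _; exact: filtration_comp_state.
move=> A fA; rewrite XE// (Rintegral_state hZ)//.
exact: (filtration_measurable hZ s0 fA).
Qed.

(** The events where [Y] exceeds or falls below v(Z_s) belong to the filtration: on each state the
    threshold is a constant. The difference has integral 0 and a strict sign on each of them, so
    both are null. *)
Lemma state_condexp_unique Y : is_condexp P (filtration s) X Y ->
  {ae P, forall w, Y w = v (Z s w)}.
Proof.
move=> [_ iY mY YE].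
have mF A := @filtration_measurable _ _ _ _ _ _ _ hZ s A s0.
have int0 A : filtration s A -> \int[P]_(w in A) (Y w - v (Z s w)) = 0.
  move=> fA; have mA := mF _ fA.
  rewrite RintegralB//; last exact: (state_integrable hZ).
    by rewrite -YE// XE// (Rintegral_state hZ)// subrr.
  by apply: integrableS iY.
have iYA A : filtration s A -> P.-integrable A (EFin \o (fun w => Y w - v (Z s w))).
  move=> fA; have mA := mF _ fA; apply: RintegrableB => //.
    by apply: integrableS iY.
  exact: (state_integrable hZ).
pose U := [set w | exists i, ((Y @^-1` `]v i, +oo[) `&` state_set Z s i) w].
pose V := [set w | exists i, ((Y @^-1` `]-oo, v i[) `&` state_set Z s i) w].
have fU : filtration s U.
  by apply: filtration_bigcup => i; apply: filtrationI; [exact: mY|by apply: filtration_state].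
have fV : filtration s V.
  by apply: filtration_bigcup => i; apply: filtrationI; [exact: mY|by apply: filtration_state].
have U0 : {ae P, forall w, ~ U w}.
  apply: (negligible_positive (mF _ fU) (iYA _ fU)) (int0 _ fU).
  move=> w [i [/= + e]]; rewrite in_itv/= andbT => vY.
  by rewrite (e : Z s w = i) subr_gt0.
(* Here the difference is negative, so its opposite is used. *)
have V0 : {ae P, forall w, ~ V w}.
  have iV := RintegrableZ _ (-1) (mF _ fV) (iYA _ fV).
  apply: (negligible_positive (mF _ fV) iV).
    move=> w [i [/= + e]]; rewrite in_itv/= => vY.
    by rewrite (e : Z s w = i) mulN1r opprB subr_gt0.
  rewrite RintegralZl//; [|exact: mF|exact: iYA].
  by rewrite int0// mulr0.
apply: filterS2 U0 V0 => w nU nV.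
apply/eqP; rewrite eq_le !leNgt; apply/andP; split; apply/negP => lt.
  by apply: nU; exists (Z s w); split => //=; rewrite in_itv/= andbT.
by apply: nV; exists (Z s w); split => //=; rewrite in_itv/=.
Qed.

End ConditionalExpectation.

(** The unit row vector extracts row m, whose entries under [mxfun] are the occupation integrals.
    Each term has a path of its own, and the values do not depend on the choice. *)
Lemma reserve_value_mxfun {R : realType} p (L : 'M[R]_p.+1) (g ginv r : R -> R) (t n : R)
    (a c : 'cV[R]_p.+1) (B : 'M[R]_p.+1) (gamma1 gamma2 : R -> R[i]) m :
  is_time_change g ginv -> 0 <= t -> t < n ->
  {within `[t, n], continuous (discount r t)} ->
  admissible_path gamma1 (mxC L) -> admissible_path gamma2 (mxC L) ->
  (reserve_value L ginv t n (discount r t) (fun i => (a - c) i 0) B m)%:C%:M =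
  mxC (delta_mx 0 m) *m (mxfun gamma1 (f1 r ginv t n) (mxC L) *m mxC (a - c)
    + mxfun gamma2 (f2 r ginv t n) (mxC L) *m (mxC (map2_mx *%R L B) *m const_mx 1)).
Proof.
move=> tc t0 tn cD adm1 adm2.
have ctau := elapsed_continuous tc t0 tn.
have iD : (@lebesgue_measure R).-integrable `[t, n] (EFin \o discount r t).
  by apply: continuous_compact_integrable => //; exact: segment_compact.
have iDl := integrable_discount_rate tc t0 tn cD.
(* The rate joins the discount factor in the real weight, giving the shape of
   [mxfun_exp_integral]. *)
have f2E : f2 r ginv t n = fun w => cintegral `[t, n] (fun u =>
    (discount r t u * Rplus_derive ginv u)%:C * cexp (w * (ginv u - ginv t)%:C)).
  apply/funext => w; congr (cintegral _ _); apply/funext => u.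
  by rewrite [(discount r t u * _)%:C](rmorphM (real_complex R)) mulrAC.
have E1 i : mxfun gamma1 (f1 r ginv t n) (mxC L) m i =
    (occupation L ginv t n (discount r t) m i)%:C.
  exact: (mxfun_exp_integral adm1 iD ctau).
have E2 i : mxfun gamma2 (f2 r ginv t n) (mxC L) m i =
    (occupation L ginv t n (fun u => discount r t u * Rplus_derive ginv u) m i)%:C.
  rewrite f2E; exact: (mxfun_exp_integral adm2 iDl ctau).
have -> : mxC (delta_mx 0 m : 'rV[R]_p.+1) = delta_mx 0 m.
  by apply/matrixP => i j; rewrite !mxE; case: (_ && _).
rewrite -rowE; apply/matrixP => i j; rewrite !ord1 [LHS]mxE eqxx mulr1n.
rewrite [RHS]mxE [RHS]mxE /reserve_value rmorphD; congr (_ + _).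
  rewrite mxE rmorph_sum; apply: eq_bigr => k _.
  by rewrite E1 rmorphM [mxC _ _ _]mxE.
rewrite mxE rmorph_sum; apply: eq_bigr => k _.
rewrite E2 rmorphM; congr (_ * _); rewrite mxE rmorph_sum; apply: eq_bigr => l _.
by rewrite [const_mx _ _ _]mxE mulr1 [mxC _ _ _]mxE [map2_mx _ _ _ _ _]mxE.
Qed.

Theorem proposition3p2
  (R : realType) (d : measure_display) (T : measurableType d)
  (P : probability T R) (p : nat)
  (Lambda : 'M[R]_p) (Z : R -> T -> 'I_p) (g ginv : R -> R)
  (a c : 'cV[R]_p) (B : 'M[R]_p) (r : R -> R) (t n : R)
  (hLambda : is_intensity_matrix Lambda)
  (hZ : is_markov_jump_process P Lambda Z)
  (hg : is_time_change g ginv)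
  (hB : forall i, B i i = 0)
  (hr : forall u, 0 <= u ->
          lebesgue_measure.-integrable `[0, u] (EFin \o r))
  (ht : 0 <= t) (htn : t < n) :
  let X : R -> T -> 'rV[R]_p :=
    fun s w => indicator_process Z (ginv s) w in
  let payments : T -> R :=
    fun w => discounted_payments a c B r t n (X ^~ w) in
  let is_reserve : (T -> R) -> Prop :=
    is_condexp P (natural_filtration X t) payments in
  (exists Y, is_reserve Y) /\
  forall (Y : T -> R) (gamma1 gamma2 : R -> R[i]),
    is_reserve Y ->
    admissible_path gamma1 (mxC Lambda) ->
    admissible_path gamma2 (mxC Lambda) ->
    {ae P, forall w,
      (Y w)%:C%:M = mxC (X t w) *m
        (mxfun gamma1 (f1 r ginv t n) (mxC Lambda) *m mxC (a - c)
         + mxfun gamma2 (f2 r ginv t n) (mxC Lambda)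
             *m (mxC (map2_mx *%R Lambda B) *m const_mx 1))}.
Proof.
(* Without states the sample space would be empty, contradicting total mass 1; the rest works with p
   + 1 states, where square matrices form a ring. *)
case: p Lambda Z a c B hLambda hZ hB => [|p] L Z a c B _ hZ hB X payments is_reserve.
  have := probability_setT P.
  rewrite (_ : [set: T] = set0); last by apply/seteqP; split => // w; case: (Z 0 w).
  by rewrite measure0 => -[] /esym/eqP; rewrite oner_eq0.
have ir : lebesgue_measure.-integrable `[t, n] (EFin \o r).
  have mI0 : measurable (`[0, n]%classic : set (measurableTypeR R)) by exact: measurable_itv.
  apply: (@integrableS _ (measurableTypeR R) _ _ _ _ _ mI0) => //.
    by apply: subset_itvr; rewrite bnd_simp.
  by apply: hr; exact: le_trans ht (ltW htn).
have cD := discount_continuous (ltW htn) ir.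
pose alpha i := (a - c) i 0.
have [ia ea] := annuity_expectation hZ hg ht htn alpha cD.
have [ij ej] := jumpsum_expectation hZ hg ht htn cD hB.
have paymentsE w : payments w = \int[lebesgue_measure]_(s in `]t, n])
      (discount r t s * alpha (clock Z ginv s w)) +
    \sum_(s <- jump_seq (fun u => clock Z ginv u w) t n)
      discount r t s * B (left_state (fun u => clock Z ginv u w) s) (clock Z ginv s w).
  exact: (discounted_paymentsE a c (clock_step hZ hg w) ht (ltW htn) hB ir).
have ipay : P.-integrable setT (EFin \o payments).
  by apply: (eq_Rintegrable _ measurableT _ (RintegrableD _ measurableT ia ij)) => w _.
pose v := reserve_value L ginv t n (discount r t) alpha B.
have hs := tc_ginv_ge0 hg ht.
(* The payments have the same integral as [v] of the state on every event of the filtration, which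
   yields both existence and uniqueness. *)
have pay A : natural_filtration (indicator_process (R := R) Z) (ginv t) A ->
    \int[P]_(w in A) payments w = \sum_i v i * state_prob P Z A (ginv t) i.
  move=> fA; have mA := filtration_measurable hZ hs fA.
  under eq_Rintegral do rewrite paymentsE.
  rewrite RintegralD//; [|by apply: integrableS ia|by apply: integrableS ij].
  rewrite ea// ej// (annuity_expectationE hZ hg ht htn)// (jump_expectationE hZ hg ht htn)//.
  by rewrite -big_split; apply: eq_bigr => i _; exact/esym/mulrDl.
have filtE : natural_filtration X t = natural_filtration (indicator_process Z) (ginv t).
  exact: natural_filtration_time_change hg ht.
rewrite /is_reserve filtE; split.
  by exists (fun w => v (Z (ginv t) w)); exact: (state_condexp hZ hs ipay pay).
move=> Y gamma1 gamma2 hY adm1 adm2.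
(* The exceptional null set comes from the choice of version alone: for [v] of the state the matrix
   formula holds at every point. *)
apply: filterS (state_condexp_unique hZ hs pay hY) => w ->.
exact: (reserve_value_mxfun _ _ _ _ hg ht htn cD adm1 adm2).
Qed.
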